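(* Let $\pi_1 := \dfrac{1}{\lambda_n(\Delta^{-1}A^{(2)})}$ and assume that the eigenvalue $\lambda_n(\Delta^{-1}A^{(2)})$ is simple. Assume that the functions $\psi_i$ satisfy (A.1)--(A.4) and that the matrices $A^{(3)}_i$ satisfy (i)--(ii) for all $i=1,\dots,n$ (conditions listed in the context). Let $g(y,\pi,A^{(3)})$ be the Lyapunov--Schmidt reduction at $(x,\pi,A^{(3)})=(0,\pi_1,0)$ of the system $$\dot x_i = -\delta_i x_i + \pi\sum_{j=1}^n a^{(2)}_{ij}\psi_j(x_j) + \pi\sum_{j,k=1}^n a^{(3)}_{ijk}\psi_j(x_j)\psi_k(x_k),\qquad i=1,\dots,n.$$ Then: (i) The bifurcation problem $g(y,\pi,0)$ has a symmetric pitchfork singularity at $(y,\pi)=(0,\pi_1)$: when $A^{(3)}=0$, the system undergoes a pitchfork bifurcation at $\pi=\pi_1$, where, as $\pi$ increases through $\pi_1$, the origin becomes unstable and two new equilibria appear (for $\pi>\pi_1$ close to $\pi_1$, near the origin); these two equilibria are locally asymptotically stable. (ii) For $A^{(3)}\neq 0$, the bifurcation problem $g(y,\pi,A^{(3)})$ is an $n^3$-parameter unfolding of the symmetric pitchfork, the parameters being the $n^3$ entries $a^{(3)}_{ijk}$.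
   Context: Setting. $n\ge 2$ agents with opinions $x=(x_1,\dots,x_n)\in\mathbb{R}^n$; $\pi>0$ is a scalar bifurcation parameter. $A^{(2)}=[a^{(2)}_{ij}]\in\mathbb{R}^{n\times n}$ is entrywise nonnegative, symmetric, irreducible, with zero diagonal. $A^{(3)}=(a^{(3)}_{ijk})$ is an entrywise nonnegative $n\times n\times n$ tensor; for each $i$, $A^{(3)}_i:=[a^{(3)}_{ijk}]_{j,k=1}^n\in\mathbb{R}^{n\times n}$. The degrees are $\delta_i=\sum_j a^{(2)}_{ij}+\sum_{j,k}a^{(3)}_{ijk}>0$ and $\Delta=\mathrm{diag}(\delta_1,\dots,\delta_n)$. In the unfolding analysis $\Delta$ is regarded as fixed: the bifurcation problem is for $F(x,\pi,A^{(3)})$ equal to the right-hand side of the system, with the entries of $A^{(3)}$ in the quadratic interaction term as auxiliary parameters and base value $A^{(3)}=0$. The eigenvalues of $\Delta^{-1}A^{(2)}$ are real and ordered $\lambda_1\le\dots\le\lambda_n$. Conditions on $\psi_i:\mathbb{R}\to\mathbb{R}$ (assumed smooth enough for the Lyapunov--Schmidt reduction to be defined and for the derivatives involved to exist): (A.1) $\psi_i(-s)=-\psi_i(s)$ for all $s$; (A.2) $\psi_i'(s)>0$ for all $s$ and $\psi_i'(0)=1$; (A.3) $\lim_{s\to\pm\infty}\psi_i(s)=\pm1$; (A.4) $\psi_i$ is strictly convex for $s<0$ and strictly concave for $s>0$. Conditions on $A^{(3)}_i$: (i) $A^{(3)}_i=(A^{(3)}_i)^T$; (ii) $[A^{(3)}_i]_{ij}=[A^{(3)}_i]_{ji}=0$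 for all $j$. Terminology (Golubitsky--Schaeffer singularity theory). The Lyapunov--Schmidt reduction $g(y,\pi,A^{(3)})$ is the scalar function of $y\in\mathbb{R}$ (coordinate along the one-dimensional kernel of the Jacobian of the system at $(0,\pi_1,0)$) whose zeros near $(0,\pi_1,0)$ correspond to equilibria of the system near the origin. A symmetric pitchfork singularity at $(0,\pi_1)$ means that $g(y,\pi,0)$ is odd in $y$ and is equivalent, as a bifurcation problem, to $(\pi-\pi_1)y-y^3$. A $k$-parameter unfolding of a bifurcation problem $g_0(y,\pi)$ is a family $G(y,\pi,\beta)$, $\beta\in\mathbb{R}^k$, with $G(y,\pi,0)=g_0(y,\pi)$.
   Formalization: Equivalence of g(y,π,0) to (π−π₁)y − y³ is claimed only if some ψ_j'''(0) ≠ 0: (A.1)–(A.4) allow all ψ_j'''(0) = 0, and then the cubic term vanishes and the equivalence fails; oddness, the dynamical pitchfork and the unfolding hold without this condition. *)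

(* Defs.v *)
(* MathComp / MathComp-Analysis *)
From HB Require Import structures.
From mathcomp Require Import all_boot all_order all_algebra.
From mathcomp Require Import all_classical all_reals all_analysis.
Set Implicit Arguments.
Unset Strict Implicit.
Unset Printing Implicit Defensive.
Import Order.TTheory GRing.Theory Num.Theory.
Import numFieldNormedType.Exports.
Local Open Scope classical_set_scope.
Local Open Scope ring_scope.

(* On a finite-dimensional [V], for an open [U], this is the usual class C^k. *)
Fixpoint Ck_on (R : realType) (V W : normedModType R) (k : nat)
    (U : set V) (f : V -> W) : Prop :=
  match k with
  | 0 => forall x, U x -> {for x, continuous f}
  | k'.+1 => (forall x, U x -> differentiable f x) /\
             forall v, Ck_on k' U (fun x => 'D_v f x)
  end.

Definition smooth_near (R : realType) (V W : normedModType R)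
    (f : V -> W) (x0 : V) : Prop :=
  exists U : set V, open_nbhs x0 U /\ forall k, Ck_on k U f.

(* [s] lists the eigenvalues of [M] with algebraic multiplicity, in
   nondecreasing order; in particular they are all real. *)
Definition ordered_eigenvalues (R : realType) n (M : 'M[R]_n) (s : seq R)
    : Prop :=
  sorted <=%R s /\ char_poly M = \prod_(l <- s) ('X - l%:P).

Definition irreducible_mx (R : realType) n (A : 'M[R]_n) : Prop :=
  forall S : {set 'I_n}, S != finset.set0 -> S != [set: 'I_n]%SET ->
    exists i j, [/\ i \in S, j \notin S & A i j != 0].

(* An n x n x n tensor is stored as the n x n^2 matrix whose i-th row is the
   vectorised i-th slice: a_{ijk} = slice A i j k. *)
Definition slice (R : realType) n (A : 'M[R]_(n, n * n)) (i : 'I_n) : 'M[R]_n :=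
  vec_mx (row i A).

Definition degree (R : realType) n (A2 : 'M[R]_n) (A3 : 'M[R]_(n, n * n))
    (i : 'I_n) : R :=
  \sum_j A2 i j + \sum_j \sum_k slice A3 i j k.

Definition degree_mx (R : realType) n (delta : 'I_n -> R) : 'M[R]_n :=
  diag_mx (\row_i delta i).

(* [delta] is an argument of its own: it stays fixed when [A3] varies. *)
Definition opinion_field (R : realType) n (delta : 'I_n -> R) (A2 : 'M[R]_n)
    (psi : 'I_n -> R -> R) (x : 'rV[R]_n) (p : R) (A3 : 'M[R]_(n, n * n))
    : 'rV[R]_n :=
  \row_i (- delta i * x 0 i
          + p * (\sum_j A2 i j * psi j (x 0 j))
          + p * (\sum_j \sum_k slice A3 i j k * psi j (x 0 j) * psi k (x 0 k))).

Definition strictly_convex_on (R : realType) (D : set R) (f : R -> R) : Prop :=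
  forall s t th : R, D s -> D t -> s != t -> 0 < th < 1 ->
    f (th * s + (1 - th) * t) < th * f s + (1 - th) * f t.

Definition strictly_concave_on (R : realType) (D : set R) (f : R -> R) : Prop :=
  strictly_convex_on D (fun s => - f s).

(* These conditions give f'''(0) <= 0 but not f'''(0) < 0: take f(s)
   proportional to the integral of exp(- (c t)^4) over [0, s]. *)
Definition saturating (R : realType) (f : R -> R) : Prop :=
  [/\ forall s, f (- s) = - f s,
      (forall s, 0 < f^`()%classic s) /\ f^`()%classic 0 = 1,
      f s @[s --> -oo] --> (- 1 : R) /\ f s @[s --> +oo] --> (1 : R)
    & strictly_convex_on [set s | s < 0] f /\
      strictly_concave_on [set s | 0 < s] f].

(* Lyapunov-Schmidt reduction of F(x, p, b) = 0 at (0, p1, b0), where the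
   Jacobian L has a one-dimensional kernel, spanned by v.
   Vectors are rows, so ker L is [kermx L] and the range of L is its row space.
   M and N are complements of ker L and of range L, [proj_mx L N] is the
   projection onto range L along N, W is the implicit solution in M of
     proj (F (y v + W, p, b)) = 0,
   and g (y, p, b) = < vs, F (y v + W, p, b) > with vs orthogonal to range L.
   The orientation < v, vs > > 0 fixes the sign of g, so that g > 0 means
   drift towards increasing y. *)
Definition lyapunov_schmidt (R : realType) n (P : normedModType R)
    (F : 'rV[R]_n -> R -> P -> 'rV[R]_n) (p1 : R) (b0 : P)
    (g : R -> R -> P -> R) : Prop :=
  let L : 'M[R]_n := 'J (fun x => F x p1 b0) (0 : 'rV[R]_n) in
  exists (v vs : 'rV[R]_n) (M N : 'M[R]_n) (W : R -> R -> P -> 'rV[R]_n),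
    [/\ [/\ v != 0, (v == kermx L)%MS, L *m vs^T = 0
          & 0 < \sum_i v 0 i * vs 0 i],
        row_full (kermx L + M)%MS /\ (kermx L :&: M)%MS = 0,
        row_full (L + N)%MS /\ (L :&: N)%MS = 0,
        [/\ smooth_near (fun z : R * R * P => W z.1.1 z.1.2 z.2) (0, p1, b0),
            W 0 p1 b0 = 0
          & \forall z \near ((0, p1, b0) : R * R * P),
              let w := W z.1.1 z.1.2 z.2 in
              (w <= M)%MS /\
              F (z.1.1 *: v + w) z.1.2 z.2 *m proj_mx L N = 0]
      & \forall z \near ((0, p1, b0) : R * R * P),
          g z.1.1 z.1.2 z.2 =
          \sum_i F (z.1.1 *: v + W z.1.1 z.1.2 z.2) z.1.2 z.2 0 i * vs 0 i].

(* Equivalence of bifurcation problems at (0, p1), in the sense of Golubitsky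
   and Schaeffer: g(y, p) = S(y, p) h(Y(y, p), Q(p)). *)
Definition bifurcation_equiv (R : realType) (p1 : R) (g h : R -> R -> R)
    : Prop :=
  exists (S Y : R -> R -> R) (Q : R -> R),
    [/\ [/\ smooth_near (fun z : R * R => S z.1 z.2) (0, p1),
            smooth_near (fun z : R * R => Y z.1 z.2) (0, p1)
          & smooth_near Q p1],
        0 < S 0 p1,
        Y 0 p1 = 0 /\ 0 < (fun y => Y y p1)^`()%classic 0,
        Q p1 = p1 /\ 0 < Q^`()%classic p1
      & \forall z \near ((0, p1) : R * R),
          g z.1 z.2 = S z.1 z.2 * h (Y z.1 z.2) (Q z.2)].

Definition odd_near (R : realType) (p1 : R) (g : R -> R -> R) : Prop :=
  \forall z \near ((0, p1) : R * R), g (- z.1) z.2 = - g z.1 z.2.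

Definition symmetric_pitchfork (R : realType) (p1 : R) (g : R -> R -> R)
    : Prop :=
  odd_near p1 g /\
  bifurcation_equiv p1 g (fun y p => (p - p1) * y - y ^+ 3).

Definition unfolding (R : realType) (p1 : R) (k : nat) (g0 : R -> R -> R)
    (G : R -> R -> 'rV[R]_k -> R) : Prop :=
  smooth_near (fun z : R * R * 'rV[R]_k => G z.1.1 z.1.2 z.2) (0, p1, 0) /\
  \forall z \near ((0, p1) : R * R), G z.1 z.2 0 = g0 z.1 z.2.

(* The derivative at the endpoint t = 0 is two-sided, which costs nothing: a
   forward solution extends to t < 0 by its tangent line. *)
Definition solves (R : realType) (V : normedModType R) (f : V -> V)
    (D : set R) (x : R -> V) : Prop :=
  forall t, D t -> is_derive t 1 x (f (x t)).

Definition stable (R : realType) (V : normedModType R) (f : V -> V) (xs : V)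
    : Prop :=
  forall e : R, 0 < e -> exists2 d : R, 0 < d & forall T x,
    solves f `[0, T[ x -> `|x 0 - xs| < d ->
    forall t, t \in `[0, T[ -> `|x t - xs| < e.

Definition attractive (R : realType) (V : normedModType R) (f : V -> V) (xs : V)
    : Prop :=
  exists2 d : R, 0 < d & forall x,
    solves f `[0, +oo[ x -> `|x 0 - xs| < d -> x t @[t --> +oo] --> xs.

Definition asymptotically_stable (R : realType) (V : normedModType R)
    (f : V -> V) (xs : V) : Prop :=
  stable f xs /\ attractive f xs.

(* As p increases through p1: for p <= p1 the origin is the only equilibrium
   near the origin; for p > p1 there are exactly two more, which emanate from
   the origin at p = p1. *)
Definition stable_pitchfork_bifurcation (R : realType) (V : normedModType R)
    (f : R -> V -> V) (p1 : R) : Prop :=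
  exists (U : set V) (eta : R) (xa xb : R -> V),
    [/\ open_nbhs (0 : V) U /\ 0 < eta,
        forall p : R, p1 - eta < p <= p1 -> forall x, U x -> (f p x = 0 <-> x = 0),
        forall p : R, p1 - eta < p < p1 -> asymptotically_stable (f p) 0,
        forall p : R, p1 < p < p1 + eta ->
          [/\ [/\ U (xa p), U (xb p), xa p != 0, xb p != 0 & xa p != xb p],
              forall x, U x ->
                (f p x = 0 <-> [\/ x = 0, x = xa p | x = xb p]),
              ~ stable (f p) 0,
              asymptotically_stable (f p) (xa p)
            & asymptotically_stable (f p) (xb p)]
      & xa p @[p --> p1^'+] --> (0 : V) /\ xb p @[p --> p1^'+] --> (0 : V)].

(* Main.v *)
(** Let u > 0 be the Perron vector, A u = mu Delta u; since A is symmetric, mu is the largest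
    eigenvalue of Delta^-1 A and p1 = 1 / mu.  For a symmetric nonnegative A and z > 0,
      sum_ij A_ij z_i r_i z_j r_j
        = sum_i z_i r_i^2 (A z)_i - 1/2 sum_ij A_ij z_i z_j (r_i - r_j)^2.
    With z = u this makes 0 the only equilibrium for p <= p1 and, A being irreducible, forces
    equilibria for p slightly above p1 to have all coordinates of one strict sign; by concavity there
    is exactly one positive equilibrium.  With z = psi(x) it makes the linearization at the positive
    equilibrium x negative definite, hence a quadratic Lyapunov function.  The origin is unstable for
    p > p1 because sum_i u_i x_i grows along a nonnegative solution as long as the solution is small.

    For the reduction g, uniqueness of the implicit solution W makes W, hence g, odd in y.  Dividing g by
    y three times (Hadamard) gives g = y (alpha(p) - y^2 kappa(y, p)) with alpha(p1) = 0 < alpha'(p1),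
    and kappa(0, p1) > 0 as soon as some psi_j^(3)(0) is nonzero.  Then Y = y sqrt(kappa),
    S = 1 / sqrt(kappa) and Q = p1 + alpha turn g into the normal form. *)

Require Import Defs.
From HB Require Import structures.
From mathcomp Require Import all_boot all_order all_algebra.
From mathcomp Require Import all_classical all_reals all_analysis.
From mathcomp Require Import ring lra.
Import Order.TTheory GRing.Theory Num.Theory.
Import numFieldNormedType.Exports.
Local Open Scope classical_set_scope.
Local Open Scope ring_scope.
Set Implicit Arguments.
Unset Strict Implicit.
Unset Printing Implicit Defensive.

(** * Real calculus *)

(** The hypotheses allow every psi_j^(3)(0) to vanish, and then g has no cubic term at p1. The
    bifurcation of the vector field therefore cannot be read off from g; it is proved directly and
    globally in x, by classifying all equilibria for p in an interval around p1. Stability is a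
    statement about given solutions, so refuting it needs an actual solution that leaves a
    neighbourhood of the origin. A Picard iteration builds one inside the positive cone. In the
    reduction W is given and only known to be smooth and to solve the projected equation near the
    base point. Uniqueness and W(y, p1) = o(y) both follow from one estimate: strict
    differentiability of the field at the origin, combined with a left inverse of L on M. Symmetry
    of A makes vs a multiple of u. In the pairing with vs the linear terms cancel at p1, so o(y)
    accuracy of W suffices to find the cubic coefficient of g. *)

Lemma antiderivative (R : realType) (h : R -> R) (a b : R) :
  continuous h -> exists H : R -> R, forall x, a < x < b -> is_derive x 1 H (h x).
Proof.
move=> ch; exists (fun x => \int[lebesgue_measure]_(t in [set` `[a, x]]) h t)%R.
move=> x /andP[ax xb].
have hi : lebesgue_measure.-integrable `[a, b] (EFin \o h).
  by apply: continuous_compact_integrable; [exact: segment_compact|exact: continuous_subspaceT].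
have [dH Hh] := continuous_FTC1_closed xb hi ax (ch x).
by apply: DeriveDef; [exact: dH|rewrite -derive1E; exact: Hh].
Qed.

Lemma derive_MVT (R : realType) (f df : R -> R) (a b : R) :
  a < b -> (forall x, a <= x <= b -> is_derive x 1 f (df x)) ->
  exists2 c, a < c < b & f b - f a = df c * (b - a).
Proof.
move=> ab Df.
have cf : {within `[a, b], continuous f}.
  apply: derivable_within_continuous => x xab.
  by have [] := Df x _; rewrite ?(itvP xab).
have Doo x : x \in `]a, b[ -> is_derive x 1 f (df x).
  by move=> xab; apply: Df; rewrite !(itvP xab).
by have [c cab ->] := MVT ab Doo cf; exists c => //; rewrite !(itvP cab).
Qed.

Lemma le_of_derive (R : realType) (f g df dg : R -> R) (a b : R) :
  a <= b ->
  (forall x, a <= x <= b -> is_derive x 1 f (df x)) ->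
  (forall x, a <= x <= b -> is_derive x 1 g (dg x)) ->
  (forall x, a < x < b -> df x <= dg x) ->
  f b - f a <= g b - g a.
Proof.
rewrite le_eqVlt => /predU1P[-> _ _ _|ab Df Dg dfg]; first by rewrite !subrr.
have Dh x : a <= x <= b -> is_derive x 1 (g - f) (dg x - df x).
  by move=> xab; apply: is_deriveB; [exact: Dg|exact: Df].
have [c cab] := derive_MVT ab Dh; rewrite !fctE => E.
suff : 0 <= g b - f b - (g a - f a) by lra.
by rewrite E mulr_ge0// subr_ge0 ?dfg// ltW.
Qed.

(** Later estimates combine explicit radii, often as minima over finitely many coordinates; for this
    an epsilon-delta form is handier than little-o notation. *)
Lemma differentiable_eps (R : realFieldType) (V W : normedModType R) (f : V -> W) (x : V) :
  differentiable f x -> forall e, 0 < e ->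
  exists2 d, 0 < d & forall h, `|h| < d -> `|f (x + h) - f x - 'd f x h| <= e * `|h|.
Proof.
move=> /diff_locallyP[_ /eqaddoP H] e e0; have := H _ e0.
move=> /nbhs_normP[d /= d0 hd]; exists d => // h hx.
have := hd h; rewrite /ball_/= sub0r normrN => /(_ hx).
by rewrite !fctE /cst/= (addrC h) opprD addrA.
Qed.

Lemma eps_differentiable (R : realFieldType) (V W : normedModType R) (f : V -> W) (x : V)
  (df : {linear V -> W}) : continuous df ->
  (forall e, 0 < e ->
    exists2 d, 0 < d & forall h, `|h| < d -> `|f (x + h) - f x - df h| <= e * `|h|) ->
  differentiable f x /\ 'd f x = df :> (V -> W).
Proof.
move=> cdf H.
have E : f \o shift x = cst (f x) + df +o_ 0 id.
  apply/eqaddoP => e e0; have [d d0 hd] := H _ e0.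
  apply/nbhs_normP; exists d => // h; rewrite /ball_/= sub0r normrN => hx.
  have := hd h hx.
  by rewrite !fctE /cst/= (addrC h) opprD addrA.
have D := diff_unique cdf E; split=> //.
by apply/diff_locallyP; rewrite D; split.
Qed.

Lemma is_derive_eps (R : realFieldType) (V : normedModType R) (f : R -> V) (x : R) (l : V) :
  is_derive x 1 f l -> forall e, 0 < e ->
  exists2 d, 0 < d & forall h, `|h| < d -> `|f (x + h) - f x - h *: l| <= e * `|h|.
Proof.
move=> [df dl] e e0; move: df => /derivable1_diffP df.
have [d d0 hd] := differentiable_eps df e0; exists d => // h hx.
have := hd h hx; rewrite -[in 'd f x _](mulr1 h) -[_ * 1]/(h *: (1 : R)) linearZ /=.
by rewrite -deriveE// dl.
Qed.

Lemma eps_is_derive (R : realFieldType) (V : normedModType R) (f : R -> V) (x : R) (l : V) :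
  (forall e, 0 < e ->
  exists2 d, 0 < d & forall h, `|h| < d -> `|f (x + h) - f x - h *: l| <= e * `|h|) ->
  is_derive x 1 f l.
Proof.
move=> H; pose d (h : R) := h *: l.
have lin_d : linear d by move=> ? ? ?; rewrite /d scalerDl scalerA.
pose dM := GRing.isLinear.Build _ _ _ _ _ lin_d.
pose dL : {linear R -> V} := HB.pack d dM.
have [|df dl] := @eps_differentiable _ _ _ f x dL _ H; first exact: scalel_continuous.
by apply: DeriveDef; [exact/derivable1_diffP|rewrite deriveE// dl; exact: scale1r].
Qed.

Lemma continuous_eps (R : realFieldType) (V W : normedModType R) (f : V -> W) (x : V) :
  {for x, continuous f} -> forall e, 0 < e ->
  exists2 d, 0 < d & forall h, `|h| < d -> `|f (x + h) - f x| < e.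
Proof.
move=> cf e e0; have /cvgr_distC_lt/(_ e e0)/nbhs_normP[d /= d0 hd] := cf.
exists d => // h hx; apply: hd; rewrite /ball_/=.
by rewrite opprD addNKr normrN.
Qed.

Lemma near_eps (R : realFieldType) (V : normedModType R) (P : V -> Prop) (x : V) :
  (\forall z \near x, P z) -> exists2 d, 0 < d & forall h, `|h| < d -> P (x + h).
Proof.
move=> /nbhs_normP[d /= d0 hd]; exists d => // h hx; apply: hd; rewrite /ball_/=.
by rewrite opprD addNKr normrN.
Qed.

Section derive_lambda.
Variables (R : realType) (x : R) (f g : R -> R) (df dg : R).
Hypotheses (Df : is_derive x 1 f df) (Dg : is_derive x 1 g dg).

Lemma is_derive_add : is_derive x 1 (fun z => f z + g z) (df + dg).
Proof. exact: (is_deriveD Df Dg). Qed.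

Lemma is_derive_sub : is_derive x 1 (fun z => f z - g z) (df - dg).
Proof. exact: (is_deriveB Df Dg). Qed.

Lemma is_derive_mul : is_derive x 1 (fun z => f z * g z) (f x * dg + g x * df).
Proof. exact: (is_deriveM Df Dg). Qed.

Lemma is_derive_scale (k : R) : is_derive x 1 (fun z => k * f z) (k * df).
Proof. exact: (@is_deriveZ _ _ _ f k x 1 df Df). Qed.

Lemma is_derive_pow n : is_derive x 1 (fun z => f z ^+ n) (n%:R * f x ^+ n.-1 * df).
Proof.
have -> : (fun z => f z ^+ n) = f ^+ n by apply/funext => z; elim: n => [|n IH]; rewrite ?expr0// !exprS IH.
exact: (is_deriveX n Df).
Qed.
End derive_lambda.

Lemma eps_continuous (R : realFieldType) (V W : normedModType R) (f : V -> W) (x : V) :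
  (forall e, 0 < e -> exists2 d, 0 < d & forall h, `|h| < d -> `|f (x + h) - f x| <= e) ->
  {for x, continuous f}.
Proof.
move=> H; apply/cvgrPdist_le => e /H[d d0 hd]; apply/nbhs_normP; exists d => // z.
rewrite /ball_/= distrC => zx; rewrite distrC.
by have := hd (z - x) zx; rewrite subrKC.
Qed.

Lemma norm_le_of_derive (R : realType) (f g df dg : R -> R) (a b : R) :
  a <= b ->
  (forall x, a <= x <= b -> is_derive x 1 f (df x)) ->
  (forall x, a <= x <= b -> is_derive x 1 g (dg x)) ->
  (forall x, a < x < b -> `|df x| <= dg x) ->
  `|f b - f a| <= g b - g a.
Proof.
move=> ab Df Dg dfg; rewrite ler_norml; apply/andP; split; last first.
  by apply: (le_of_derive ab Df Dg) => x /dfg; apply: le_trans; exact: ler_norm.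
have Dg' x : a <= x <= b -> is_derive x 1 (fun z => -1 * g z) (-1 * dg x).
  by move=> xab; apply: is_derive_scale; exact: Dg.
have /= := le_of_derive ab Dg' Df; rewrite !mulN1r => h; rewrite -opprB opprK addrC.
suff : - g b - - g a <= f b - f a by lra.
apply: h => x /dfg; rewrite mulN1r lerNl; apply: le_trans.
by rewrite -normrN ler_norm.
Qed.

Section clamp.
Variables (R : realType) (T : R).
Hypothesis T_ge0 : 0 <= T.

(* Precomposition with [clamp] extends to R a function that is only known to be continuous on [0, T]. *)
Definition clamp (t : R) : R := Num.max 0 (Num.min t T).

Lemma clamp_itv t : 0 <= clamp t <= T.
Proof. by rewrite /clamp le_max lexx/= ge_max T_ge0 ge_min lexx orbT. Qed.

Lemma clamp_id t : 0 <= t <= T -> clamp t = t.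
Proof. by move=> /andP[t0 tT]; rewrite /clamp min_l// max_r. Qed.

Lemma continuous_clamp : continuous clamp.
Proof.
have nn (a : R) : - `|a| <= a <= `|a| by rewrite -ler_norml.
have lmax (a b : R) : `|Num.max 0 a - Num.max 0 b| <= `|a - b|.
  rewrite /Num.max; have /andP[h1 h2] := nn (a - b).
  by case: (ltP 0 a); case: (ltP 0 b) => ? ?; rewrite ler_norml; apply/andP; split; lra.
have lmin (a b : R) : `|Num.min a T - Num.min b T| <= `|a - b|.
  rewrite /Num.min; have /andP[h1 h2] := nn (a - b).
  by case: (ltP a T); case: (ltP b T) => ? ?; rewrite ler_norml; apply/andP; split; lra.
move=> t; apply: eps_continuous => e e0; exists e => // h he; apply: (le_trans _ (ltW he)).
by apply: (le_trans (lmax _ _)); apply: (le_trans (lmin _ _)); rewrite addrAC subrr add0r.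
Qed.

Lemma continuous_clamped (V : topologicalType) (y : R -> V) :
  (forall t, 0 <= t <= T -> {for t, continuous y}) -> continuous (y \o clamp).
Proof.
move=> cy t; apply: continuous_comp; first exact: continuous_clamp.
exact/cy/clamp_itv.
Qed.

Lemma antiderivative_itv (h : R -> R) :
  (forall t, 0 <= t <= T -> {for t, continuous h}) ->
  exists H : R -> R, forall t, 0 <= t <= T -> is_derive t 1 H (h t).
Proof.
move=> ch; have [H DH] := antiderivative (-1) (T + 1) (continuous_clamped ch).
exists H => t tT; rewrite -(clamp_id tT); have /andP[t0 t1] := tT.
by rewrite [in X in is_derive X](clamp_id tT); apply: DH; apply/andP; split; lra.
Qed.
End clamp.

(** * Saturating functions *)

Section saturating_theory.
Variables (R : realType) (f : R -> R).
Hypotheses (f_smooth : forall k (s : R), derivable f^`(k)%classic s 1)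
  (f_sat : saturating f).
Local Notation f' := (f^`()%classic).

Lemma sat_is_derive (s : R) : is_derive s 1 f (f' s).
Proof. by apply: DeriveDef; [|by rewrite derive1E]; exact: (@f_smooth 0%N s). Qed.

Lemma sat_is_deriven k (s : R) : is_derive s 1 f^`(k)%classic (f^`(k.+1)%classic s).
Proof. by apply: DeriveDef; [exact: f_smooth|rewrite derive1nS derive1E]. Qed.

Lemma sat_continuousn k : continuous f^`(k)%classic.
Proof.
by move=> s; apply: differentiable_continuous; apply/derivable1_diffP; exact: f_smooth.
Qed.

Lemma satN (s : R) : f (- s) = - f s.
Proof. by case: f_sat. Qed.

Lemma sat0 : f 0 = 0.
Proof. by have := satN 0; rewrite oppr0 => ?; lra. Qed.

Lemma sat_deriv0 : f' 0 = 1.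
Proof. by case: f_sat => _ []. Qed.

Lemma sat_deriv_gt0 (s : R) : 0 < f' s.
Proof. by case: f_sat => _ [] h. Qed.

Lemma sat_derivN (s : R) : f' (- s) = f' s.
Proof.
have h : is_derive s 1 (f \o -%R) (f' (- s) * -1).
  have := sat_is_derive (- s) => ?.
  by apply: is_derive1_comp.
have : (f \o -%R) = - f by apply/funext => x; rewrite !fctE satN.
move=> E; have := @derive_val _ _ _ _ _ _ _ h; rewrite E.
have := sat_is_derive s => ?.
by rewrite derive_val mulrN1 => /oppr_inj.
Qed.

Lemma sat_lt (x y : R) : x < y -> f x < f y.
Proof.
move=> xy; have [c _ E] := derive_MVT xy (fun z _ => sat_is_derive z).
by rewrite -subr_gt0 E mulr_gt0 ?subr_gt0 ?sat_deriv_gt0.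
Qed.

Lemma sat_le (x y : R) : x <= y -> f x <= f y.
Proof. by rewrite le_eqVlt => /predU1P[->//|/sat_lt/ltW]. Qed.

Lemma sat_gt0 (x : R) : 0 < x -> 0 < f x.
Proof. by move=> /sat_lt; rewrite sat0. Qed.

(** Concavity bounds f (x + t (y - x)) - f x below by t (f y - f x). Dividing by t and replacing the
    left side by its linear part costs only e, for t small. *)
Lemma sat_tangent_le (x y : R) : 0 < x -> 0 < y -> f y - f x <= f' x * (y - x).
Proof.
move=> x0 y0; have [->|xy] := eqVneq y x; first by rewrite !subrr mulr0.
case: f_sat => _ _ _ [_ cc]; apply/ler_addgt0Pr => e e0.
have yx0 : 0 < `|y - x| by rewrite normr_gt0 subr_eq0.
have e'0 : 0 < e / `|y - x| by rewrite divr_gt0.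
have [d d0 hd] := is_derive_eps (sat_is_derive x) e'0.
pose t := Num.min (1/2) (d / `|y - x| / 2).
have t0 : 0 < t by rewrite lt_min; apply/andP; split; [lra|rewrite !divr_gt0].
have t1 : t < 1 by rewrite gt_min; apply/orP; left; lra.
have td : `|t * (y - x)| < d.
  rewrite normrM gtr0_norm// -ltr_pdivlMr// (@le_lt_trans _ _ (d / `|y - x| / 2))//.
    by rewrite ge_min lexx orbT.
  by rewrite ltr_pdivrMr// ltr_pMr ?divr_gt0// ltr1n.
have := hd _ td; rewrite normrM (gtr0_norm t0) mulrCA -mulrA mulVf ?lt0r_neq0// mulr1.
move=> /ler_normlW H.
have t01 : 0 < t < 1 by rewrite t0.
have := cc y x t y0 x0 xy t01.
have -> : t * y + (1 - t) * x = x + t * (y - x) by ring.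
move=> C; rewrite -(ler_pM2l t0).
move: H; rewrite /GRing.scale/=.
have -> : t * (y - x) * f' x = t * (f' x * (y - x)) by ring.
nra.
Qed.

Lemma sat_mid (a b : R) : 0 < a -> a < b -> (f a + f b) / 2 < f ((a + b) / 2).
Proof.
move=> a0 ab; case: f_sat => _ _ _ [_ cc].
have h : 0 < (1/2 : R) < 1 by apply/andP; split; lra.
have := cc a b (1/2) a0 (lt_trans a0 ab) _ h; rewrite lt_eqF// => /(_ isT).
have -> : 1 / 2 * a + (1 - 1 / 2) * b = (a + b) / 2 by field.
lra.
Qed.

(** The tangents at a and b both bound f at the midpoint from above; the strict midpoint inequality
    leaves room only if the slopes differ. *)
Lemma sat_deriv_decr0 (a b : R) : 0 < a -> a < b -> f' b < f' a.
Proof.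
move=> a0 ab; pose m := (a + b) / 2.
have := sat_mid a0 ab; rewrite -/m => hm.
have m0 : 0 < m by rewrite /m; lra.
have := sat_tangent_le a0 m0.
have := sat_tangent_le (lt_trans a0 ab) m0.
have -> : m - b = - ((b - a) / 2) by rewrite /m; field.
have -> : m - a = (b - a) / 2 by rewrite /m; field.
move=> h1 h2; suff : f' b * ((b - a)/2) < f' a * ((b - a)/2).
  by rewrite ltr_pM2r//; lra.
lra.
Qed.

(** Concavity is assumed only on s > 0, so a = 0 is reached by continuity of f': if f' 0 < f' (b /
    2), then f' s < f' (b / 2) for some small s > 0, against monotonicity on s > 0. *)
Lemma sat_deriv_decr (a b : R) : 0 <= a -> a < b -> f' b < f' a.
Proof.
rewrite le_eqVlt => /predU1P[<- b0|]; last exact: sat_deriv_decr0.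
have : f' b < f' (b / 2) by apply: sat_deriv_decr0; lra.
move=> /lt_le_trans; apply; rewrite leNgt; apply/negP => h.
have h' : 0 < f' (b / 2) - f' 0 by rewrite subr_gt0.
have [d d0 hd] := continuous_eps (@sat_continuousn 1%N (0 : R)) h'.
pose s := Num.min (b / 4) (d / 2).
have s0 : 0 < s by rewrite lt_min; apply/andP; split; lra.
have sb : s < b / 2 by rewrite gt_min; apply/orP; left; lra.
have sd : s < d by rewrite gt_min; apply/orP; right; lra.
have := hd s; rewrite gtr0_norm// add0r => /(_ sd)/ltr_normlW.
have := sat_deriv_decr0 s0 sb; rewrite -derive1n1; lra.
Qed.

Lemma sat_deriv_norm (s : R) : f' `|s| = f' s.
Proof. by case: (ger0P s) => //; rewrite sat_derivN. Qed.

Lemma sat_deriv_le1 (s : R) : f' s <= 1.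
Proof.
rewrite -sat_deriv_norm -sat_deriv0; have [->|s0] := eqVneq `|s| 0; first by [].
by apply/ltW/sat_deriv_decr; rewrite // lt_neqAle eq_sym s0 normr_ge0.
Qed.

Lemma sat_lt_id (x : R) : 0 < x -> f x < x.
Proof.
move=> x0; have [c /andP[c0 cx]] := derive_MVT x0 (fun z _ => sat_is_derive z).
rewrite sat0 !subr0 => ->; rewrite gtr_pMl// -sat_deriv0.
exact: sat_deriv_decr.
Qed.

Lemma sat_deriv_lt_secant (x : R) : 0 < x -> x * f' x < f x.
Proof.
move=> x0; have [c /andP[c0 cx]] := derive_MVT x0 (fun z _ => sat_is_derive z).
rewrite sat0 !subr0 => ->; rewrite mulrC ltr_pM2r//.
by apply: sat_deriv_decr => //; exact: ltW.
Qed.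

(** Between x and t x the slope stays below f' x, and x f' x < f x. *)
Lemma sat_sublinear (x t : R) : 0 < x -> 1 < t -> f (t * x) < t * f x.
Proof.
move=> x0 t1; have xt : x < t * x by rewrite ltr_pMl.
have [c /andP[c0 cx] E] := derive_MVT xt (fun z _ => sat_is_derive z).
have h1 := sat_deriv_lt_secant x0.
have h2 : f' c < f' x by apply: sat_deriv_decr => //; exact: ltW.
have : f' c * (t * x - x) < f' x * (t * x - x) by rewrite ltr_pM2r// subr_gt0.
rewrite -E; have -> : f' x * (t * x - x) = (t - 1) * (x * f' x) by ring.
have : (t - 1) * (x * f' x) < (t - 1) * f x by rewrite ltr_pM2l// subr_gt0.
lra.
Qed.

Lemma sat_le1 (x : R) : f x <= 1.
Proof.
case: f_sat => _ _ [_ h] _; apply: (cvgr_to_ge h).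
near=> s; apply: sat_le; by near: s; apply: nbhs_pinfty_ge; exact: num_real.
Unshelve. all: by end_near. Qed.

Lemma sat_lipschitz (x y : R) : `|f x - f y| <= `|x - y|.
Proof.
wlog xy : x y / y <= x.
  move=> H; case: (leP y x) => [/H//|/ltW/H]; by rewrite (distrC (f y)) (distrC y).
have /= := le_of_derive xy (fun z _ => sat_is_derive z) (fun z _ => is_derive_id z (1 : R)).
move=> /(_ (fun z _ => sat_deriv_le1 z)) h.
by rewrite !ger0_norm ?subr_ge0// sat_le.
Qed.

Lemma sat_deriv2_0 : f^`(2)%classic 0 = 0.
Proof.
have h : is_derive (0 : R) 1 (f' \o -%R) (f^`(2)%classic (- 0) * -1).
  have := @sat_is_deriven 1%N (- 0) => ?.
  by apply: is_derive1_comp.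
have E : (f' \o -%R) = f' by apply/funext => x /=; rewrite sat_derivN.
have := @derive_val _ _ _ _ _ _ _ h; rewrite E oppr0.
have := @sat_is_deriven 1%N 0; rewrite derive1n1 => ?.
by rewrite derive_val => ?; lra.
Qed.

(** Differentiability of f'' at 0 encloses f'' between (c - e) x and (c + e) x; two integrations
    from 0, where f, f' - 1 and f'' vanish, give the claim for s >= 0. Oddness gives the rest. *)
Lemma sat_taylor3 e : 0 < e -> exists2 d, 0 < d &
  forall s, `|s| < d -> `|f s - s - f^`(3)%classic 0 / 6 * s ^+ 3| <= e * `|s| ^+ 3.
Proof.
move=> e0; pose c := f^`(3)%classic 0.
have [d d0 hd] := is_derive_eps (@sat_is_deriven 2%N 0) e0.
exists d => // s sd.
wlog s0 : s sd / 0 <= s.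
  move=> H; case: (leP 0 s) => [/(H _ sd)//|/ltW s0].
  have := H (- s); rewrite !normrN => /(_ sd); rewrite oppr_ge0 => /(_ s0).
  rewrite satN -[X in _ -> X <= _]normrN.
  by apply: le_trans; rewrite le_eqVlt; apply/orP; left; apply/eqP; congr Num.norm; ring.
have b2 x : 0 <= x <= s -> `|f^`(2)%classic x - c * x| <= e * x.
  move=> /andP[x0 xs]; have := hd x; rewrite (ger0_norm x0) add0r sat_deriv2_0 subr0.
  rewrite ger0_norm// in sd; move=> /(_ (le_lt_trans xs sd)).
  by rewrite /GRing.scale/= (mulrC x).
have b1 x : 0 <= x <= s -> `|f' x - 1 - c / 2 * x ^+ 2| <= e / 2 * x ^+ 2.
  move=> /andP[x0 xs].
  have D1 z : 0 <= z <= x -> is_derive z 1 (f' : R -> R) (f^`(2)%classic z).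
    by move=> _; have := @sat_is_deriven 1%N z; rewrite derive1n1.
  have D2 k z : 0 <= z <= x -> is_derive z 1 (fun z : R => k / 2 * z ^+ 2) (k * z).
    move=> _; apply: (is_derive_eq (is_derive_scale (is_derive_pow (is_derive_id z 1) 2) (k / 2))).
    by rewrite /=; field.
  have b2' z : 0 < z < x -> `|f^`(2)%classic z - c * z| <= e * z.
    by move=> /andP[z0 zx]; apply: b2; rewrite (ltW z0) (le_trans (ltW zx)).
  have lo w : 0 < w < x -> (c - e) * w <= f^`(2)%classic w.
    by move=> /b2'; rewrite ler_norml => /andP[]; lra.
  have hi w : 0 < w < x -> f^`(2)%classic w <= (c + e) * w.
    by move=> /b2'; rewrite ler_norml => /andP[]; lra.
  have := le_of_derive x0 D1 (D2 (c + e)) hi.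
  have := le_of_derive x0 (D2 (c - e)) D1 lo.
  rewrite expr0n/= !mulr0 !subr0 sat_deriv0 => h1 h2.
  by rewrite ler_norml; apply/andP; split; lra.
have D1 z : 0 <= z <= s -> is_derive z 1 f (f' z) by move=> _; exact: sat_is_derive.
have D2 k z : 0 <= z <= s -> is_derive z 1 (fun z : R => z + k / 6 * z ^+ 3) (1 + k / 2 * z ^+ 2).
  move=> _; have iz := is_derive_id z (1 : R).
  apply: (is_derive_eq (is_derive_add iz (is_derive_scale (is_derive_pow iz 3) (k / 6)))).
  by rewrite /=; field.
have b1' z : 0 < z < s -> `|f' z - 1 - c / 2 * z ^+ 2| <= e / 2 * z ^+ 2.
  by move=> /andP[z0 zx]; apply: b1; rewrite (ltW z0) ltW.
have lo w : 0 < w < s -> 1 + (c - e) / 2 * w ^+ 2 <= f' w.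
  by move=> /b1'; rewrite ler_norml => /andP[]; lra.
have hi w : 0 < w < s -> f' w <= 1 + (c + e) / 2 * w ^+ 2.
  by move=> /b1'; rewrite ler_norml => /andP[]; lra.
have h2 := le_of_derive s0 D1 (D2 (c + e)) hi.
have h1 := le_of_derive s0 (D2 (c - e)) D1 lo.
rewrite (ger0_norm s0).
have es : 0 <= e * s ^+ 3 by rewrite mulr_ge0 ?exprn_ge0// ltW.
move: h1 h2; rewrite expr0n/= !mulr0 !addr0 !subr0 sat0 subr0 => h1 h2.
by rewrite -[X in _ - X]/(c / 6 * s ^+ 3) ler_norml; apply/andP; split; lra.
Qed.

(** A positive third derivative would give f s > s for small s > 0. The tolerance is half of the
    cubic coefficient. *)
Lemma sat_deriv3_le0 : f^`(3)%classic 0 <= 0.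
Proof.
rewrite leNgt; apply/negP => c0.
have c12 : 0 < f^`(3)%classic 0 / 12 by lra.
have [d d0 hd] := sat_taylor3 c12.
have s0 : 0 < d / 2 by lra.
have s1 : d / 2 < d by lra.
have := hd (d / 2); rewrite gtr0_norm// => /(_ s1).
have := sat_lt_id s0; have s3 : 0 < (d/2) ^+ 3 by rewrite exprn_gt0.
rewrite ler_norml => h /andP[h1 _].
have : 0 < f^`(3)%classic 0 / 12 * (d / 2) ^+ 3 by rewrite mulr_gt0.
lra.
Qed.
End saturating_theory.

(** * Symmetric irreducible matrices *)

(* [r] is the ratio of a vector to the positive vector [z]. *)
Lemma symmetric_form_ground_state (R : realFieldType) (n : nat) (A : 'I_n -> 'I_n -> R)
    (z r : 'I_n -> R) : (forall i j, A i j = A j i) ->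
  \sum_i \sum_j A i j * (z i * r i) * (z j * r j) =
  \sum_i z i * r i ^+ 2 * (\sum_j A i j * z j)
  - 1/2 * \sum_i \sum_j A i j * z i * z j * (r i - r j) ^+ 2.
Proof.
move=> Asym.
have E : \sum_i \sum_j A i j * z i * z j * (r i - r j) ^+ 2 =
    \sum_i \sum_j A i j * z i * z j * r i ^+ 2 + \sum_i \sum_j A i j * z i * z j * r j ^+ 2
    - 2 * \sum_i \sum_j A i j * (z i * r i) * (z j * r j).
  rewrite -big_split/= mulr_sumr -sumrB; apply: eq_bigr => i _.
  rewrite -big_split/= mulr_sumr -sumrB; apply: eq_bigr => j _.
  ring.
have E2 : \sum_i \sum_j A i j * z i * z j * r j ^+ 2 = \sum_i \sum_j A i j * z i * z j * r i ^+ 2.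
  rewrite exchange_big/=; apply: eq_bigr => i _; apply: eq_bigr => j _.
  by rewrite Asym; ring.
have E3 : \sum_i z i * r i ^+ 2 * (\sum_j A i j * z j) = \sum_i \sum_j A i j * z i * z j * r i ^+ 2.
  by apply: eq_bigr => i _; rewrite mulr_sumr; apply: eq_bigr => j _; ring.
rewrite E E2 E3; lra.
Qed.

Section irreducible_theory.
Variables (R : realType) (n : nat) (A : 'M[R]_n) (d : 'I_n -> R).
Hypotheses (A_ge0 : forall i j, 0 <= A i j) (A_sym : A^T = A) (A_irr : irreducible_mx A)
  (d_gt0 : forall i, 0 < d i).

Lemma mx_symE i j : A i j = A j i.
Proof. by rewrite -[in LHS]A_sym mxE. Qed.

(** If the zero set of x were nonempty, it would be a proper subset with an edge leaving it, and the
    row sum at the start of that edge would be positive. *)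
Lemma irreducible_gt0 (x : 'I_n -> R) :
  (forall i, 0 <= x i) -> (exists i, x i != 0) ->
  (forall i, x i = 0 -> \sum_j A i j * x j = 0) -> forall i, 0 < x i.
Proof.
move=> x0 [k xk] h i; rewrite lt_def x0 andbT; apply/negP => /eqP xi.
have [||a [b []]] := @A_irr [set j | x j == 0]%SET.
- by apply/set0Pn; exists i; rewrite inE xi.
- by apply/eqP => /setP/(_ k); rewrite !inE (negbTE xk).
rewrite !inE => /eqP xa xb Aab; have := h a xa.
move/eqP; rewrite psumr_eq0; last by move=> j _; rewrite mulr_ge0.
by move=> /allP/(_ b); rewrite mem_index_enum => /(_ isT); rewrite /= mulf_eq0 (negbTE Aab) (negbTE xb).
Qed.

(** For n >= 2 a singleton is a proper subset, so every row of A has a nonzero entry. *)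
Lemma irreducible_row_gt0 (x : 'I_n -> R) : (2 <= n)%N ->
  (forall i, 0 < x i) -> forall i, 0 < \sum_j A i j * x j.
Proof.
move=> n2 x0 i; have [||a [b []]] := @A_irr [set i]%SET.
- by apply/set0Pn; exists i; rewrite inE.
- apply/eqP => /(congr1 (fun s : {set _} => #|s|)); rewrite cards1 cardsT card_ord => E.
  by rewrite -E in n2.
rewrite !inE => /eqP -> bi Aab; rewrite (bigD1 b)//= ltr_pwDl//.
  by rewrite mulr_gt0// lt_def Aab A_ge0.
by rewrite sumr_ge0// => j _; rewrite mulr_ge0// ltW.
Qed.

Lemma irreducible_connect i j : connect (fun a b => A a b != 0) i j.
Proof.
pose e := (fun a b => A a b != 0) : rel 'I_n.
have [//|nij] := boolP (connect e i j).
have [||a [b []]] := @A_irr [set k | connect e i k]%SET.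
- by apply/set0Pn; exists i; rewrite inE connect0.
- by apply/eqP => /setP/(_ j); rewrite !inE (negbTE nij).
rewrite !inE => ia ib Aab.
by have := connect_trans ia (connect1 (Aab : e a b)); rewrite (negbTE ib).
Qed.

(** Telescoping along a simple path from i to j, which has at most n edges. *)
Lemma irreducible_oscillation (r : 'I_n -> R) (s : R) :
  (forall i j, A i j != 0 -> `|r i - r j| <= s) -> 0 <= s ->
  forall i j, `|r i - r j| <= n%:R * s.
Proof.
move=> h s0 i j; have /connectP[p0 ep0 ->] := irreducible_connect i j.
case/shortenP : ep0 => p ep up _ {p0}.
have : (size p <= n)%N.
  have /card_uniqP/= := up; have := max_card (mem (i :: p)); rewrite card_ord => + E.
  by rewrite E; exact: ltnW.
move=> sp; apply: (@le_trans _ _ ((size p)%:R * s)); last by rewrite ler_wpM2r// ler_nat.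
elim: p i ep {up sp} => [|a p IH] i /=; first by rewrite subrr normr0 mul0r.
move=> /andP[ia ap]; rewrite -[r i](subrK (r a)) -addrA (le_trans (ler_normD _ _))//.
by rewrite -[(size p).+1]add1n natrD mulrDl mul1r lerD ?h ?IH.
Qed.

Section ground_state.
Variables (u : 'I_n -> R) (lam : R).
Hypotheses (u_gt0 : forall i, 0 < u i) (u_eig : forall i, \sum_j A i j * u j = lam * d i * u i).

Let edge_ge0 (r : 'I_n -> R) i j : 0 <= A i j * u i * u j * (r i - r j) ^+ 2.
Proof. by rewrite mulr_ge0 ?sqr_ge0// mulr_ge0 ?(ltW (u_gt0 _))// mulr_ge0 ?A_ge0// ltW. Qed.

(** The subtracted term is a Dirichlet energy of the ratio z / u. Its sign makes [lam] the top of
    the spectrum, and its zeros describe the eigenspace. *)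
Lemma ground_state_form (z : 'I_n -> R) :
  \sum_i \sum_j A i j * z i * z j = lam * (\sum_i d i * z i ^+ 2)
  - 1/2 * \sum_i \sum_j A i j * u i * u j * (z i / u i - z j / u j) ^+ 2.
Proof.
have uz i : u i * (z i / u i) = z i by rewrite mulrC divfK ?lt0r_neq0.
transitivity (\sum_i \sum_j A i j * (u i * (z i / u i)) * (u j * (z j / u j))).
  by apply: eq_bigr => i _; apply: eq_bigr => j _; rewrite !uz.
rewrite (symmetric_form_ground_state u (fun i => z i / u i) mx_symE).
congr (_ - _); rewrite mulr_sumr; apply: eq_bigr => i _.
by rewrite u_eig; field; rewrite lt0r_neq0.
Qed.

Lemma ground_state_form_le (z : 'I_n -> R) :
  \sum_i \sum_j A i j * z i * z j <= lam * (\sum_i d i * z i ^+ 2).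
Proof.
rewrite ground_state_form gerBl mulr_ge0//.
by apply: sumr_ge0 => i _; apply: sumr_ge0 => j _; exact: (edge_ge0 (fun i => z i / u i)).
Qed.

(** An eigenvector for [lam] has zero energy, so z / u is constant along edges, hence constant by
    irreducibility. *)
Lemma ground_state_unique (z : 'I_n -> R) :
  (forall i, \sum_j A i j * z j = lam * d i * z i) ->
  exists c, forall i, z i = c * u i.
Proof.
move=> zE.
have E0 : \sum_i \sum_j A i j * u i * u j * (z i / u i - z j / u j) ^+ 2 = 0.
  have := ground_state_form z.
  have -> : \sum_i \sum_j A i j * z i * z j = lam * (\sum_i d i * z i ^+ 2).
    rewrite mulr_sumr; apply: eq_bigr => i _.
    under eq_bigr do rewrite mulrAC.
    by rewrite -mulr_suml zE; ring.
  lra.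
have ge0 i j : 0 <= A i j * u i * u j * (z i / u i - z j / u j) ^+ 2.
  exact: (edge_ge0 (fun i => z i / u i)).
have E i j : A i j != 0 -> `|z i / u i - z j / u j| <= 0.
  move=> Aij; move/eqP: E0; rewrite psumr_eq0; last by move=> *; exact: sumr_ge0.
  move=> /allP/(_ i); rewrite mem_index_enum => /(_ isT); rewrite /= psumr_eq0//.
  move=> /allP/(_ j); rewrite mem_index_enum => /(_ isT) /=.
  have nz : A i j * u i * u j != 0 by rewrite !mulf_neq0// lt0r_neq0.
  by rewrite mulf_eq0 (negbTE nz) sqrf_eq0 => /eqP ->; rewrite normr0.
have [k _|noi] := pickP (@predT 'I_n); last by exists 0 => i; have := noi i.
exists (z k / u k) => i.
have := irreducible_oscillation E (lexx 0) i k; rewrite mulr0 normr_le0 subr_eq0 => /eqP <-.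
by rewrite divfK// lt0r_neq0.
Qed.
End ground_state.
End irreducible_theory.

Lemma mx_entry_le_norm (R : realFieldType) (m n : nat) (x : 'M[R]_(m, n)) i j : `|x i j| <= `|x|.
Proof. by rewrite [leRHS]/Num.norm/= mx_normrE; exact: (le_bigmax _ (fun ij => `|x ij.1 ij.2|) (i, j)). Qed.

Lemma mx_norm_le (R : realFieldType) (m n : nat) (x : 'M[R]_(m, n)) e :
  0 <= e -> (forall i j, `|x i j| <= e) -> `|x| <= e.
Proof. by move=> e0 H; rewrite [leLHS]/Num.norm/= mx_normrE; apply: bigmax_le => // -[i j] _; exact: H. Qed.

Lemma row_norm_le (R : realFieldType) (n : nat) (x : 'rV[R]_n) e :
  0 <= e -> (forall j, `|x 0 j| <= e) -> `|x| <= e.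
Proof. by move=> e0 H; apply: mx_norm_le => // i j; rewrite ord1. Qed.

Lemma continuous_sumr (R : realType) (T : topologicalType) (I : Type) (r : seq I) (F : I -> T -> R) :
  (forall i, continuous (F i)) -> continuous (fun x => \sum_(i <- r) F i x).
Proof. by move=> cF; apply: continuous_big => //; exact: add_continuous. Qed.

(** * The Perron vector as a maximizer of the Rayleigh quotient *)

Section perron_frobenius.
Variables (R : realType) (n : nat) (A : 'M[R]_n) (d : 'I_n -> R).
Hypotheses (A_ge0 : forall i j, 0 <= A i j) (A_sym : A^T = A) (A_irr : irreducible_mx A)
  (d_gt0 : forall i, 0 < d i) (n_gt0 : (0 < n)%N).

Let N (z : 'I_n -> R) := \sum_i d i * z i ^+ 2.
Let q (z : 'I_n -> R) := \sum_i \sum_j A i j * z i * z j.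

Let N_ge0 z : 0 <= N z.
Proof. by apply: sumr_ge0 => i _; rewrite mulr_ge0 ?sqr_ge0// ltW. Qed.

Let N_eq0 z : N z = 0 -> forall i, z i = 0.
Proof.
move=> /eqP; rewrite psumr_eq0; last by move=> i _; rewrite mulr_ge0 ?sqr_ge0// ltW.
move=> /allP h i; have := h i; rewrite mem_index_enum => /(_ isT).
by rewrite /= mulf_eq0 gt_eqF//= sqrf_eq0 => /eqP.
Qed.

(** The form attains its maximum on the compact ellipsoid N = 1, and homogeneity extends the bound
    to every w. *)
Lemma rayleigh_max : exists (mu : R) (z : 'I_n -> R), [/\ N z = 1, q z = mu
  & forall w, q w <= mu * N w].
Proof.
pose K := [set x : 'rV[R]_n | N (x 0) = 1].
have cc (i : 'I_n) : continuous (fun x : 'rV[R]_n => x 0 i) by exact: coord_continuous.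
have cN : continuous (fun x : 'rV[R]_n => N (x 0)).
  apply: continuous_sumr => i x.
  exact: (cvgM (cvg_cst (d i)) (cvgM (cc i x) (cc i x))).
have cq : continuous (fun x : 'rV[R]_n => q (x 0)).
  apply: continuous_sumr => i; apply: continuous_sumr => j x.
  exact: (cvgM (cvgM (cvg_cst (A i j)) (cc i x)) (cc j x)).
have Kcl : closed K.
  apply: (@preimage_closed _ _ (fun x : 'rV[R]_n => N (x 0)) [set x | x = 1]).
    by move=> x _; exact: cN.
  exact: closed_eq.
have Kbd : bounded_set K.
  (* From d_j x_j^2 <= 1 and (|x_j| - 1)^2 >= 0 follows |x_j| <= 1 + 1 / d_j. *)
  exists (\sum_i (1 + (d i)^-1)); split; first exact: num_real.
  have t0 i : 0 <= 1 + (d i)^-1 by rewrite addr_ge0// invr_ge0 ltW.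
  move=> M ltM x Kx; apply: row_norm_le; first by rewrite ltW// (le_lt_trans _ ltM)// sumr_ge0.
  move=> j; apply/ltW/(le_lt_trans _ ltM); rewrite (bigD1 j)//= ler_wpDr ?sumr_ge0//.
  have h : x 0 j ^+ 2 <= (d j)^-1.
    rewrite -[leRHS]mul1r ler_pdivlMr// mulrC -Kx /N (bigD1 j)//= ler_wpDr// sumr_ge0//.
    by move=> i _; rewrite mulr_ge0 ?sqr_ge0// ltW.
  rewrite -(real_normK (num_real _)) in h.
  by have := sqr_ge0 (`|x 0 j| - 1); nra.
have K0 : K !=set0.
  pose i0 := Ordinal n_gt0; exists (\row_i ((i == i0)%:R / Num.sqrt (d i0))).
  rewrite /K/= /N (bigD1 i0)//= big1 => [|i /negbTE ii]; rewrite mxE ?ii ?mul0r ?expr0n ?mulr0//.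
  by rewrite eqxx addr0 expr_div_n sqr_sqrtr ?ltW// expr1n mul1r divff// gt_eqF.
have [x /set_mem Kx xmax] := EVT_max_rV K0 (bounded_closed_compact Kbd Kcl) (continuous_subspaceT cq).
exists (q (x 0)), (x 0); split=> // w.
have [Nw|Nw] := eqVneq (N w) 0.
  have w0 := N_eq0 Nw; rewrite Nw mulr0 /q big1// => i _; rewrite big1// => j _.
  by rewrite !w0 !mulr0.
have Nw0 : 0 < N w by rewrite lt_def Nw N_ge0.
pose s := Num.sqrt (N w); have s2 : s ^+ 2 = N w by rewrite sqr_sqrtr// ltW.
have s0 : 0 < s by rewrite sqrtr_gt0.
have := xmax (\row_i (w i / s)); rewrite inE => /(_ _).
have -> : q ((\row_i (w i / s)) 0) = q w / N w.
  rewrite -s2 /q mulr_suml; apply: eq_bigr => i _; rewrite mulr_suml; apply: eq_bigr => j _.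
  by rewrite !mxE; field; rewrite gt_eqF.
rewrite ler_pdivrMr//; apply; rewrite /K/=.
transitivity (N w / s ^+ 2); last by rewrite s2 divff.
by rewrite /N mulr_suml; apply: eq_bigr => i _; rewrite !mxE; field; rewrite gt_eqF.
Qed.

(** As A is nonnegative, passing from z to |z| does not lower the form, so |z| is a maximizer too.
    Stationarity is the eigenvalue equation, and irreducibility then excludes zero entries. *)
Lemma perron_frobenius : exists (mu : R) (u : 'I_n -> R),
  (forall i, 0 < u i) /\ (forall i, \sum_j A i j * u j = mu * d i * u i).
Proof.
have [mu [z [Nz qz mumax]]] := rayleigh_max.
pose u i := `|z i|; exists mu, u.
have Nu : N u = 1 by rewrite -Nz; apply: eq_bigr => i _; rewrite real_normK ?num_real.
have qu : q u = mu.
  apply/le_anti/andP; split; first by have := mumax u; rewrite Nu mulr1.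
  rewrite -qz; apply: ler_sum => i _; apply: ler_sum => j _.
  by rewrite -!mulrA ler_wpM2l// /u -normrM ler_norm.
(* [res] vanishes because [u + t res] cannot beat the maximum [u] for any t. *)
pose res i := mu * d i * u i - \sum_j A i j * u j.
have expand t w : mu * N (fun i => u i + t * w i) - q (fun i => u i + t * w i) =
    2 * t * (\sum_i w i * res i) + t ^+ 2 * (mu * N w - q w).
  have EN : N (fun i => u i + t * w i) = N u + 2 * t * (\sum_i d i * u i * w i) + t ^+ 2 * N w.
    rewrite /N !mulr_sumr -!big_split/=; apply: eq_bigr => i _; ring.
  have Eq : q (fun i => u i + t * w i) = q u + 2 * t * (\sum_i \sum_j A i j * w i * u j) + t ^+ 2 * q w.
    have sw : \sum_i \sum_j A i j * u i * w j = \sum_i \sum_j A i j * w i * u j.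
      rewrite exchange_big/=; apply: eq_bigr => i _; apply: eq_bigr => j _.
      by rewrite (mx_symE A_sym); ring.
    have -> : 2 * t * (\sum_i \sum_j A i j * w i * u j) =
        t * (\sum_i \sum_j A i j * w i * u j) + t * (\sum_i \sum_j A i j * u i * w j).
      by rewrite sw; ring.
    rewrite /q !mulr_sumr -!big_split/=; apply: eq_bigr => i _.
    rewrite !mulr_sumr -!big_split/=; apply: eq_bigr => j _; ring.
  have Er : \sum_i w i * res i = mu * (\sum_i d i * u i * w i) - \sum_i \sum_j A i j * w i * u j.
    rewrite mulr_sumr -sumrB; apply: eq_bigr => i _; rewrite mulrBr mulr_sumr; congr (_ - _); first ring.
    by apply: eq_bigr => j _; ring.
  by rewrite EN Eq Er Nu qu; ring.
pose S := \sum_i res i * res i.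
have S0 : 0 <= S by apply: sumr_ge0 => i _; rewrite -expr2 sqr_ge0.
pose C := mu * N res - q res.
have C0 : 0 <= C by rewrite subr_ge0.
have Sz : S = 0.
  have h t : 0 <= 2 * t * S + t ^+ 2 * C by rewrite -expand subr_ge0.
  (* The parabola 2 t S + t^2 C has its minimum at - S / C; the denominator 1 + C also covers C = 0
     and still gives a negative value unless S = 0. *)
  have := h (- (S / (1 + C))).
  have -> : 2 * (- (S / (1 + C))) * S + (- (S / (1 + C))) ^+ 2 * C
    = - (S ^+ 2 * (2 + C) / (1 + C) ^+ 2) by field; lra.
  rewrite oppr_ge0 pmulr_lle0 ?invr_gt0 ?exprn_gt0//; last by lra.
  rewrite pmulr_lle0; last by lra.
  by move=> h2; apply/eqP; rewrite -sqrf_eq0 eq_le h2 sqr_ge0.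
have uE i : \sum_j A i j * u j = mu * d i * u i.
  move/eqP: Sz; rewrite psumr_eq0; last by move=> k _; rewrite -expr2 sqr_ge0.
  move=> /allP/(_ i); rewrite mem_index_enum => /(_ isT) /=.
  by rewrite -expr2 sqrf_eq0 subr_eq0 => /eqP ->.
split=> //; apply: (irreducible_gt0 A_ge0 A_irr).
- by move=> i; exact: normr_ge0.
- apply: contrapT => h; have : N u = 0.
    by rewrite /N big1// => i _; apply/eqP; rewrite mulf_eq0 sqrf_eq0; apply/orP; right; apply/negP => /negP ui; apply: h; exists i.
  by rewrite Nu => /eqP; rewrite oner_eq0.
- by move=> i ui; rewrite uE ui mulr0.
Qed.
End perron_frobenius.

Section largest_eigenvalue.
Variables (R : realType) (n : nat) (A : 'M[R]_n) (d : 'I_n -> R).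
Hypotheses (n_ge2 : (2 <= n)%N)
  (A_ge0 : forall i j, 0 <= A i j) (A_sym : A^T = A) (A_irr : irreducible_mx A)
  (d_gt0 : forall i, 0 < d i).

Lemma invmx_degree_mx : invmx (degree_mx d) = diag_mx (\row_i (d i)^-1).
Proof.
have E : degree_mx d *m diag_mx (\row_i (d i)^-1) = 1%:M.
  rewrite /degree_mx mulmx_diag; apply/matrixP => i j; rewrite !mxE.
  by have [->|] := eqVneq i j; rewrite ?mulr0n ?mulr1n// divff// gt_eqF.
have [U _] := mulmx1_unit E.
by rewrite -[RHS]mul1mx -(mulVmx U) -mulmxA E mulmx1.
Qed.

(** Eigenvectors are rows here: a row eigenvector v corresponds to z = v / d with A z = a d z, by
    symmetry of A. So d u is one for [mu], and [ground_state_form_le] applied to z bounds every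
    other eigenvalue by [mu]. *)
Lemma largest_eigenvalue (lam : n.-tuple R) (u : 'I_n -> R) (mu : R) :
  ordered_eigenvalues (invmx (degree_mx d) *m A) lam ->
  (forall i, 0 < u i) -> (forall i, \sum_j A i j * u j = mu * d i * u i) ->
  lam`_n.-1 = mu.
Proof.
rewrite invmx_degree_mx => -[srt chp] u0 uE.
set M := _ *m A in chp.
have ME i j : M i j = A i j / d i by rewrite /M mul_diag_mx !mxE mulrC.
have eigP a : eigenvalue M a = (a \in lam).
  by rewrite eigenvalue_root_char chp root_prod_XsubC.
have muin : mu \in lam.
  rewrite -eigP; apply/eigenvalueP; exists (\row_i (d i * u i)).
    apply/rowP => j; rewrite !mxE mulrA -uE; apply: eq_bigr => i _.
    by rewrite mxE ME (mx_symE A_sym i j); field; rewrite gt_eqF.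
  pose i0 := Ordinal (ltnW n_ge2); apply/eqP => /rowP/(_ i0); rewrite !mxE => /eqP.
  by rewrite mulf_eq0 !gt_eqF.
have n1 : (n.-1 < n)%N by case: (n) n_ge2.
apply/le_anti/andP; split.
  have : eigenvalue M lam`_n.-1 by rewrite eigP mem_nth// size_tuple.
  move=> /eigenvalueP[v vM v0]; set a := lam`_n.-1 in vM *.
  pose z i := v 0 i / d i.
  have zE i : \sum_j A i j * z j = a * d i * z i.
    move/rowP/(_ i): vM; rewrite !mxE /z => E.
    transitivity (a * v 0 i); last by field; rewrite gt_eqF.
    by rewrite -E; apply: eq_bigr => j _; rewrite ME (mx_symE A_sym i j); field; rewrite gt_eqF.
  have := ground_state_form_le A_ge0 A_sym u0 uE z.
  have -> : \sum_i \sum_j A i j * z i * z j = a * (\sum_i d i * z i ^+ 2).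
    rewrite mulr_sumr; apply: eq_bigr => i _.
    under eq_bigr do rewrite mulrAC.
    by rewrite -mulr_suml zE; ring.
  have [j vj] : exists j, v 0 j != 0 by apply/rV0Pn.
  rewrite ler_pM2r// (bigD1 j)//= ltr_pwDl//.
    by rewrite mulr_gt0// exprn_even_gt0//= mulf_neq0// invr_neq0// gt_eqF.
  by apply: sumr_ge0 => i _; rewrite mulr_ge0 ?sqr_ge0// ltW.
have /(nthP 0)[k] := muin; rewrite size_tuple => kn <-.
by apply: (sorted_leq_nth le_trans le_refl 0 srt); rewrite ?inE ?size_tuple// -ltnS prednK// ltnW.
Qed.

Lemma ground_state_eigenvalue_gt0 (u : 'I_n -> R) (mu : R) :
  (forall i, 0 < u i) -> (forall i, \sum_j A i j * u j = mu * d i * u i) -> 0 < mu.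
Proof.
move=> u0 uE; pose i0 := Ordinal (ltnW n_ge2).
have := irreducible_row_gt0 A_ge0 A_irr n_ge2 u0 i0.
by rewrite uE -mulrA pmulr_lgt0// mulr_gt0.
Qed.
End largest_eigenvalue.

(** * Equilibria *)

(** Provides one radius for all coordinates. The default 1 of the minimum covers an empty index
    type. *)
Lemma finite_delta (R : realType) (I : finType) (P : I -> R -> Prop) :
  (forall i, exists2 d, 0 < d & P i d) ->
  (forall i d d', 0 < d' -> d' <= d -> P i d -> P i d') ->
  exists2 d, 0 < d & forall i, P i d.
Proof.
move=> H mono; have /choice[dl hd] : forall i, exists e, 0 < e /\ P i e.
  by move=> i; have [e e0 ?] := H i; exists e.
pose d := \big[Order.min/1]_i dl i.
have d0 : 0 < d by apply/bigmin_gtP; split=> // i _; have [] := hd i.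
exists d => // i; have [_ Pi] := hd i; apply: (mono i _ _ d0 _ Pi).
exact: bigmin_le.
Qed.

Lemma finite_argmax (R : realType) (I : finType) (i0 : I) (f : I -> R) :
  exists k, forall i, f i <= f k.
Proof. by have [k _ h] := @arg_maxP _ R I i0 xpredT f isT; exists k => i; exact: h. Qed.

Lemma ltr_sum1 (R : realType) (I : finType) (F G : I -> R) (k : I) :
  (forall i, F i <= G i) -> F k < G k -> \sum_i F i < \sum_i G i.
Proof.
move=> FG Fk; rewrite (bigD1 k)//= [ltRHS](bigD1 k)//= ltr_leD// ler_sum// => i _; exact: FG.
Qed.

Section equilibria.
Variables (R : realType) (n : nat) (A : 'M[R]_n) (d : 'I_n -> R) (psi : 'I_n -> R -> R).
Variables (u : 'I_n -> R) (mu : R).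
Hypotheses (n_ge2 : (2 <= n)%N)
  (A_ge0 : forall i j, 0 <= A i j) (A_sym : A^T = A) (A_irr : irreducible_mx A)
  (d_gt0 : forall i, 0 < d i)
  (psi_smooth : forall i k (s : R), derivable (psi i)^`(k)%classic s 1)
  (psi_sat : forall i, saturating (psi i))
  (u_gt0 : forall i, 0 < u i) (u_eig : forall i, \sum_j A i j * u j = mu * d i * u i).

Definition equilibrium (p : R) (x : 'I_n -> R) :=
  forall i, d i * x i = p * \sum_j A i j * psi j (x j).

Let mu_gt0 : 0 < mu.
Proof. exact: (ground_state_eigenvalue_gt0 n_ge2 A_ge0 A_irr d_gt0 u_gt0 u_eig). Qed.

Lemma sat_family_eps (a : 'I_n -> R) e : 0 < e -> exists2 dl, 0 < dl &
  forall j h, `|h| < dl -> `|psi j (a j + h) - psi j (a j) - h * (psi j)^`()%classic (a j)| <= e * `|h|.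
Proof.
move=> e0; apply: finite_delta => [j|j d1 d2 _ d21 H h hd]; last exact/H/(lt_le_trans hd).
have [dj dj0 H] := is_derive_eps (sat_is_derive (@psi_smooth j) (a j)) e0.
by exists dj => // h; exact: H.
Qed.

Lemma sat_sqr_lt j x : x != 0 -> psi j x ^+ 2 < x * psi j x.
Proof.
wlog x0 : x / 0 <= x => [H xn0|].
  case: (leP 0 x) => [/H/(_ xn0)//|/ltW x0].
  have := H (- x); rewrite oppr_ge0 oppr_eq0 => /(_ x0 xn0).
  by rewrite (satN (psi_sat j)) sqrrN mulrNN.
move=> xn0; have {xn0}x0 : 0 < x by rewrite lt_def xn0.
rewrite expr2 ltr_pM2r; first exact: sat_lt_id.
exact: (sat_gt0 (@psi_smooth j)).
Qed.

Lemma sat_sqr_le j x : psi j x ^+ 2 <= x * psi j x.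
Proof.
have [->|/(sat_sqr_lt j)/ltW//] := eqVneq x 0.
by rewrite (sat0 (psi_sat j)) expr0n mul0r.
Qed.

(** Pairing the i-th equation with psi_i (x_i) produces the quadratic form at z = psi(x), to which
    the ground state identity applies. *)
Lemma equilibrium_form p x : equilibrium p x ->
  \sum_i d i * (x i * psi i (x i)) =
  p * \sum_i \sum_j A i j * psi i (x i) * psi j (x j).
Proof.
move=> xE; rewrite mulr_sumr; apply: eq_bigr => i _.
rewrite mulrA xE -mulrA; congr (_ * _); rewrite mulr_suml; apply: eq_bigr => j _; ring.
Qed.

(** The form is at most mu times the sum of d_i psi_i(x_i)^2, while psi(x)^2 < x psi(x) at a nonzero
    coordinate; for p mu <= 1 these contradict [equilibrium_form]. *)
Lemma equilibrium_subcritical p x : 0 < p -> p * mu <= 1 -> equilibrium p x -> forall i, x i = 0.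
Proof.
move=> p0 pmu /equilibrium_form E i; apply: contrapT => /eqP xi.
have := ground_state_form_le A_ge0 A_sym u_gt0 u_eig (fun i => psi i (x i)).
rewrite -(ler_pM2l p0) -E mulrA; apply/negP; rewrite -ltNge.
set S := \sum_i d i * psi i (x i) ^+ 2.
have S0 : 0 <= S by apply: sumr_ge0 => k _; rewrite mulr_ge0 ?sqr_ge0// ltW.
apply: (@le_lt_trans _ _ S); first by rewrite ler_piMl.
by apply: (@ltr_sum1 _ _ _ _ i) => [k|]; rewrite ?ler_pM2l ?ltr_pM2l//; [exact: sat_sqr_le|exact: sat_sqr_lt].
Qed.

(** Slightly above threshold the energy of the ratios r = psi(x) / u is a small multiple of their
    squared maximum. Irreducibility then keeps every ratio within half of the maximum from the
    extremal one. *)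
Lemma equilibrium_sign : exists2 eta, 0 < eta & forall p x, 0 < p -> p * mu < 1 + eta ->
  equilibrium p x -> [\/ forall i, x i = 0, forall i, 0 < x i | forall i, x i < 0].
Proof.
pose K := \sum_i \sum_j (A i j * u i * u j)^-1.
have Aui_ge0 i j : 0 <= A i j * u i * u j by rewrite mulr_ge0 ?(ltW (u_gt0 _))// mulr_ge0 ?A_ge0// ltW.
have K0 i j : (A i j * u i * u j)^-1 <= K.
  rewrite /K (bigD1 i)//= (bigD1 j)//= -addrA ler_wpDr// addr_ge0//.
    by apply: sumr_ge0 => b _; rewrite invr_ge0.
  by apply: sumr_ge0 => a _; apply: sumr_ge0 => b _; rewrite invr_ge0.
have K_ge0 : 0 <= K by apply: sumr_ge0 => a _; apply: sumr_ge0 => b _; rewrite invr_ge0.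
pose T := \sum_i d i * u i ^+ 2.
have T_ge0 : 0 <= T by apply: sumr_ge0 => i _; rewrite mulr_ge0 ?sqr_ge0// ltW.
pose i0 := Ordinal (ltnW n_ge2).
have n0 : 0 < n%:R :> R by rewrite ltr0n ltnW.
(* [K] bounds a squared edge difference by the energy, and [T] bounds S by rho^2; with this [C] the
   eta below makes every edge difference at most rho / (2 n). The 1 keeps [C] positive. *)
pose C := 2 * K * T * mu + 1; have C0 : 0 < C by rewrite ltr_wpDl// !mulr_ge0// ltW.
have eta0 : 0 < ((2 * n%:R) ^+ 2)^-1 / C by rewrite divr_gt0// invr_gt0 exprn_gt0// mulr_gt0.
exists (((2 * n%:R) ^+ 2)^-1 / C) => // p x p0 pmu xE.
pose r i := psi i (x i) / u i.
have zr i : psi i (x i) = r i * u i by rewrite divfK// lt0r_neq0.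
have [k kmax] := finite_argmax i0 (fun i => `|r i|).
pose rho := `|r k|; have rho0 : 0 <= rho by exact: normr_ge0.
pose E := \sum_i \sum_j A i j * u i * u j * (r i - r j) ^+ 2.
pose S := \sum_i d i * psi i (x i) ^+ 2.
have ST : S <= T * rho ^+ 2.
  rewrite mulr_suml; apply: ler_sum => i _; rewrite -mulrA ler_pM2l// zr exprMn mulrC.
  by rewrite ler_pM2l ?exprn_gt0// -(real_normK (num_real (r i))) lerXn2r// nnegrE.
have ES : E <= 2 * mu * ((2 * n%:R) ^+ 2)^-1 / C * S.
  have := ground_state_form A_sym u_gt0 u_eig (fun i => psi i (x i)).
  rewrite -/E -/S => q.
  have SS : S <= \sum_i d i * (x i * psi i (x i)).
    by apply: ler_sum => i _; rewrite ler_pM2l//; exact: sat_sqr_le.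
  rewrite (equilibrium_form xE) q in SS.
  have S0 : 0 <= S by apply: sumr_ge0 => i _; rewrite mulr_ge0 ?sqr_ge0// ltW.
  have E0 : 0 <= E by apply: sumr_ge0 => i _; apply: sumr_ge0 => j _; rewrite mulr_ge0 ?sqr_ge0.
  set e := _ / C in pmu eta0; rewrite -[leRHS]/(2 * mu * ((2 * n%:R) ^+ 2)^-1 / C * S).
  have -> : 2 * mu * ((2 * n%:R) ^+ 2)^-1 / C * S = 2 * mu * e * S by rewrite /e; ring.
  have h1 : p * E <= 2 * (p * mu - 1) * S by lra.
  have h2 : (p * mu - 1) * S <= e * S by rewrite ler_wpM2r//; lra.
  (* Removes p from the left side: below threshold the energy is nonpositive, above it p > 1 / mu.
     The bound obtained is uniform in p. *)
  have [p1|p1] := lerP (p * mu) 1.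
    have : 2 * (p * mu - 1) * S <= 0 by rewrite mulr_le0_ge0//; lra.
    move=> h3; have : p * E <= 0 by exact: le_trans h3.
    rewrite pmulr_rle0// => h4; apply: (le_trans h4).
    by rewrite mulr_ge0// mulr_ge0 ?(ltW eta0)// mulr_ge0// ltW.
  have : mu^-1 < p by rewrite -[ltLHS]mul1r ltr_pdivrMr.
  move=> pm; have : mu^-1 * E <= 2 * e * S.
    by apply: (le_trans (ler_wpM2r E0 (ltW pm))); lra.
  by rewrite ler_pdivrMl// => h; apply: (le_trans h); rewrite !mulrA (mulrC mu).
have osc i j : A i j != 0 -> `|r i - r j| <= rho / (2 * n%:R).
  move=> Aij; rewrite -(@ler_pXn2r _ 2)// ?nnegrE ?divr_ge0 ?mulr_ge0//.
  rewrite real_normK ?num_real// exprMn exprVn.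
  have nz : 0 < A i j * u i * u j.
    by rewrite lt_def Aui_ge0 andbT !mulf_neq0// lt0r_neq0.
  apply: (@le_trans _ _ (K * E)).
    apply: (@le_trans _ _ ((A i j * u i * u j)^-1 * E)); last first.
      by rewrite ler_wpM2r// sumr_ge0// => a _; apply: sumr_ge0 => b _; rewrite mulr_ge0 ?sqr_ge0.
    rewrite ler_pdivlMl// /E (bigD1 i)//= (bigD1 j)//= -addrA ler_wpDr// addr_ge0//.
      by apply: sumr_ge0 => b _; rewrite mulr_ge0 ?sqr_ge0.
    by apply: sumr_ge0 => a _; apply: sumr_ge0 => b _; rewrite mulr_ge0 ?sqr_ge0.
  apply: (@le_trans _ _ (K * (2 * mu * ((2 * n%:R) ^+ 2)^-1 / C * (T * rho ^+ 2)))).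
    rewrite ler_wpM2l// (le_trans ES)// ler_wpM2l// !mulr_ge0 ?invr_ge0 ?exprn_ge0 ?mulr_ge0//; exact: ltW.
  have -> : K * (2 * mu * ((2 * n%:R) ^+ 2)^-1 / C * (T * rho ^+ 2)) =
     rho ^+ 2 * ((2 * n%:R) ^+ 2)^-1 * ((C - 1) / C) by rewrite /C; field; rewrite -/C !lt0r_neq0.
  rewrite ler_piMr//; first by rewrite mulr_ge0 ?invr_ge0 ?exprn_ge0// mulr_ge0// ltW.
  by rewrite ler_pdivrMr// mul1r; lra.
have s0 : 0 <= rho / (2 * n%:R) by rewrite divr_ge0// mulr_ge0// ltW.
have close i : `|r k - r i| <= rho / 2.
  have := irreducible_oscillation A_irr osc s0 k i.
  by have -> : n%:R * (rho / (2 * n%:R)) = rho / 2 by field; rewrite lt0r_neq0.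
have xsgn i : (0 < r i -> 0 < x i) /\ (r i < 0 -> x i < 0) /\ (r i = 0 -> x i = 0).
  have si := @psi_smooth i; have sati := psi_sat i.
  have rz : (0 < r i) = (0 < psi i (x i)) by rewrite /r pmulr_lgt0// invr_gt0.
  have rn : (r i < 0) = (psi i (x i) < 0) by rewrite /r pmulr_llt0// invr_gt0.
  split; [|split].
  - rewrite rz; case: (ltrgt0P (x i)) => // [x0|->]; last by rewrite (sat0 sati) ltxx.
    by have := sat_lt si sati x0; rewrite (sat0 sati) => /lt_trans h /h; rewrite ltxx.
  - rewrite rn; case: (ltrgt0P (x i)) => // [x0|->]; last by rewrite (sat0 sati) ltxx.
    by have := sat_lt si sati x0; rewrite (sat0 sati) => /lt_trans h /h; rewrite ltxx.
  - move=> ri; case: (ltrgt0P (x i)) => // x0; have := sat_lt si sati x0;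
      by rewrite (sat0 sati) zr ri mul0r ltxx.
(* All ratios lie within rho / 2 of r k and |r k| = rho, so they share its sign. *)
case: (ltrgt0P (r k)) => rk.
- constructor 2 => i; have [h _] := xsgn i; apply: h.
  by have := close i; rewrite /rho (gtr0_norm rk) ler_norml; lra.
- constructor 3 => i; have [_ [h _]] := xsgn i; apply: h.
  by have := close i; rewrite /rho (ltr0_norm rk) ler_norml; lra.
- constructor 1 => i; have [_ [_ h]] := xsgn i; apply: h.
  by have := kmax i; rewrite rk normr0 normr_le0 => /eqP.
Qed.

(** Let t be the largest ratio x_k / y_k. If t > 1, then x <= t y and strict sublinearity of psi
    give d_k x_k < t d_k y_k, whereas equality holds by choice of k. *)
Lemma positive_equilibrium_le p x y : 0 < p -> equilibrium p x -> equilibrium p y ->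
  (forall i, 0 < x i) -> (forall i, 0 < y i) -> forall i, x i <= y i.
Proof.
move=> p0 xE yE x0 y0 i; have [k kmax] := finite_argmax i (fun j => x j / y j).
rewrite -[leRHS]mul1r -ler_pdivrMr//; apply: (le_trans (kmax i)); rewrite leNgt; apply/negP.
set t := x k / y k => t1.
have xty j : x j <= t * y j by rewrite -ler_pdivrMr// kmax.
have : d k * x k < t * (d k * y k).
  rewrite xE yE mulrCA ltr_pM2l//.
  apply: (@le_lt_trans _ _ (\sum_j A k j * psi j (t * y j))).
    by apply: ler_sum => j _; rewrite ler_wpM2l//; exact: (sat_le (@psi_smooth j)).
  rewrite -subr_gt0 mulr_sumr -sumrB.
  have := irreducible_row_gt0 A_ge0 A_irr n_ge2 (x := fun j => t * psi j (y j) - psi j (t * y j)) _ k.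
  under eq_bigr do rewrite mulrBr mulrCA; apply => j.
  by rewrite subr_gt0; exact: (sat_sublinear (@psi_smooth j)).
by rewrite mulrCA /t divfK ?ltxx// lt0r_neq0.
Qed.

Lemma positive_equilibrium_unique p x y : 0 < p -> equilibrium p x -> equilibrium p y ->
  (forall i, 0 < x i) -> (forall i, 0 < y i) -> x =1 y.
Proof.
by move=> p0 xE yE x0 y0 i; apply/le_anti; rewrite !(@positive_equilibrium_le p).
Qed.

Lemma equilibriumN p x : equilibrium p x -> equilibrium p (fun i => - x i).
Proof.
move=> xE i; rewrite mulrN xE -mulrN -sumrN; congr (_ * _); apply: eq_bigr => j _.
by rewrite (satN (psi_sat j)) mulrN.
Qed.

Lemma positive_equilibrium_exists p : 0 < p -> 1 < p * mu ->
  exists2 x, equilibrium p x & forall i, 0 < x i.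
Proof.
move=> p0 pmu.
pose T (x : 'I_n -> R) i := p / d i * \sum_j A i j * psi j (x j).
have Tmono x y : (forall i, x i <= y i) -> forall i, T x i <= T y i.
  move=> xy i; rewrite /T ler_pM2l ?divr_gt0//; apply: ler_sum => j _.
  by rewrite ler_wpM2l//; exact: (sat_le (@psi_smooth j)).
pose B i := p / d i * \sum_j A i j.
have TB x i : T x i <= B i.
  rewrite /T ler_pM2l ?divr_gt0//; apply: ler_sum => j _.
  by rewrite ler_piMr//; exact: (sat_le1 (@psi_smooth j)).
have [s s0 su] : exists2 s, 0 < s & forall i, s * u i <= T (fun j => s * u j) i.
  (* Chosen so that (1 - q) p mu = 1: where psi(h) >= (1 - q) h, the eigenvalue equation turns s u
     into a subsolution. *)
  pose q := 1 - (p * mu)^-1.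
  have q0 : 0 < q by rewrite subr_gt0 invf_lt1// mulr_gt0.
  have [dl dl0 hdl] := sat_family_eps (fun=> 0) q0.
  pose U := \sum_i u i; have U0 i : u i <= U.
    by rewrite /U (bigD1 i)//= ler_wpDr// sumr_ge0// => j _; exact: ltW.
  have Up : 0 < U by exact: lt_le_trans (u_gt0 (Ordinal (ltnW n_ge2))) (U0 _).
  exists (dl / U / 2); first by rewrite !divr_gt0.
  move=> i; set s := dl / U / 2; have s0 : 0 < s by rewrite !divr_gt0.
  have su j : (1 - q) * (s * u j) <= psi j (s * u j).
    have suj : 0 < s * u j by rewrite mulr_gt0.
    have := hdl j (s * u j); rewrite gtr0_norm// => /(_ _).
    rewrite add0r (sat0 (psi_sat j)) (sat_deriv0 (psi_sat j)) subr0 mulr1 ler_norml => h.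
    have /h/andP[+ _] : s * u j < dl; last by lra.
    apply: (@le_lt_trans _ _ (s * U)); first by rewrite ler_pM2l.
    by rewrite /s mulrAC divfK ?lt0r_neq0//; lra.
  apply: (@le_trans _ _ (p / d i * \sum_j A i j * ((1 - q) * (s * u j)))); last first.
    by rewrite /T ler_pM2l ?divr_gt0//; apply: ler_sum => j _; rewrite ler_wpM2l.
  have -> : \sum_j A i j * ((1 - q) * (s * u j)) = (1 - q) * (s * (mu * d i * u i)).
    by rewrite -u_eig !mulr_sumr; apply: eq_bigr => j _; ring.
  rewrite /q subKr le_eqVlt; apply/orP; left; apply/eqP; field.
  by rewrite !lt0r_neq0// mulr_gt0.
(* Knaster-Tarski: the supremum of the subsolutions is a fixed point of the monotone map T. *)
pose S := [set x : 'I_n -> R | forall i, x i <= T x i].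
pose xs i := sup [set x i | x in S].
have Ssup i : has_sup [set x i | x in S].
  split; first by exists (s * u i); exists (fun j => s * u j).
  by exists (B i) => _ [x Sx <-]; exact: le_trans (Sx i) (TB x i).
have xsub x : S x -> forall i, x i <= xs i.
  by move=> Sx i; apply: ub_le_sup; [exact: (Ssup i).2|exists x].
have Sxs : S xs.
  move=> i; apply: ge_sup; first exact: (Ssup i).1.
  by move=> _ [x Sx <-]; apply: (le_trans (Sx i)); apply: Tmono; exact: xsub.
have xsT i : xs i = T xs i.
  by apply/le_anti; rewrite Sxs/=; apply: xsub => k; apply: Tmono.
exists xs => [i|i]; last first.
  by apply: lt_le_trans (xsub _ su i); rewrite mulr_gt0.
by rewrite {1}xsT /T; field; rewrite lt0r_neq0.
Qed.

(** Weighting the equations by u gives sum u d (x - psi(x)) = (p mu - 1) sum u d psi(x). The right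
    side is small near threshold because psi <= 1, while x - psi(x) is nondecreasing and positive at
    e. *)
Lemma positive_equilibrium_small e : 0 < e -> exists2 eta, 0 < eta & forall p x,
  0 < p -> p * mu < 1 + eta -> equilibrium p x -> (forall i, 0 < x i) -> forall i, x i < e.
Proof.
move=> e0; pose T := \sum_i u i * d i.
have T0 : 0 < T + 1.
  by rewrite ltr_wpDl// sumr_ge0// => i _; rewrite mulr_ge0 ?ltW.
have gap i : 0 < e - psi i e by rewrite subr_gt0; exact: (sat_lt_id (@psi_smooth i)).
have [eta eta0 heta] : exists2 eta, 0 < eta & forall i, eta * (T + 1) <= u i * d i * (e - psi i e).
  apply: finite_delta => [i|i a b b0 ba]; last by apply: le_trans; rewrite ler_pM2r.
  by exists (u i * d i * (e - psi i e) / (T + 1)); rewrite ?divr_gt0 ?mulr_gt0// divfK// lt0r_neq0.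
exists eta => // p x p0 pmu xE x0 i; rewrite ltNge; apply/negP => exi.
have Sle : \sum_j u j * d j * (x j - psi j (x j)) = (p * mu - 1) * \sum_j u j * d j * psi j (x j).
  have : \sum_j u j * (d j * x j) = p * mu * \sum_j u j * d j * psi j (x j).
    under eq_bigr do rewrite xE mulrCA mulr_sumr.
    rewrite -mulr_sumr exchange_big/= -mulrA; congr (_ * _); rewrite mulr_sumr; apply: eq_bigr => j _.
    transitivity ((\sum_k A j k * u k) * psi j (x j)); last by rewrite u_eig; ring.
    by rewrite mulr_suml; apply: eq_bigr => k _; rewrite (mx_symE A_sym); ring.
  move=> E; rewrite mulrBl mul1r -E -sumrB; apply: eq_bigr => j _; ring.
have ge0 j : 0 <= u j * d j * (x j - psi j (x j)).
  rewrite !mulr_ge0 ?(ltW (u_gt0 _)) ?(ltW (d_gt0 _))// subr_ge0 ltW//.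
  exact: (sat_lt_id (@psi_smooth j)).
have : u i * d i * (e - psi i e) <= \sum_j u j * d j * (x j - psi j (x j)).
  rewrite (bigD1 i)//= ler_wpDr ?sumr_ge0// ler_pM2l ?mulr_gt0//.
  have := sat_lipschitz (@psi_smooth i) (psi_sat i) (x i) e.
  rewrite !ger0_norm ?subr_ge0//; first lra.
  exact: (sat_le (@psi_smooth i)).
apply/negP; rewrite -ltNge; apply: lt_le_trans (heta i); rewrite Sle.
pose P := \sum_j u j * d j * psi j (x j).
have P0 : 0 <= P.
  by apply: sumr_ge0 => j _; rewrite !mulr_ge0 ?(ltW (u_gt0 _)) ?(ltW (d_gt0 _))// ltW// (sat_gt0 (@psi_smooth j)).
have PT : P <= T.
  apply: ler_sum => j _; rewrite ler_piMr//; first by rewrite mulr_ge0 ?(ltW (u_gt0 _)) ?(ltW (d_gt0 _)).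
  exact: (sat_le1 (@psi_smooth j)).
rewrite -/P; have : (p * mu - 1) * P <= eta * P by rewrite ler_wpM2r//; lra.
move=> h; apply: (le_lt_trans h); apply: (@le_lt_trans _ _ (eta * T)); first by rewrite ler_pM2l.
by rewrite ltr_pM2l// ltrDl.
Qed.

(** Because x psi'(x) < psi(x), the vector psi(x) is a strict positive supersolution of the
    linearization in the variables psi'(x) w. This is the hypothesis of the stability criterion. *)
Lemma positive_equilibrium_hyperbolic p x : equilibrium p x -> (forall i, 0 < x i) ->
  forall i, p * \sum_j A i j * psi j (x j) < d i / (psi i)^`()%classic (x i) * psi i (x i).
Proof.
move=> xE x0 i; rewrite -xE -mulrA ltr_pM2l// mulrC ltr_pdivlMr.
  exact: (sat_deriv_lt_secant (@psi_smooth i)).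
exact: sat_deriv_gt0.
Qed.
End equilibria.

(** * Stability *)

(* As v is nonincreasing, v' <= - k v integrates to v(t) - v(0) <= - k t v(t): this decay is enough. *)
Lemma decay_trap (R : realType) (v dv : R -> R) (k rho t : R) :
  0 <= t -> 0 <= k -> (forall s, 0 <= v s) ->
  (forall s, 0 <= s <= t -> is_derive s 1 v (dv s)) ->
  (forall s, 0 <= s <= t -> v s < rho -> dv s <= - k * v s) ->
  v 0 < rho -> v t * (1 + k * t) <= v 0.
Proof.
move=> t0 k0 v0 Dv dvle v0rho.
have noninc a b : 0 <= a -> a <= b -> b <= t -> (forall s, a < s < b -> v s < rho) -> v b <= v a.
  move=> a0 ab bt vr.
  have Dc x : a <= x <= b -> is_derive x 1 (cst (0 : R)) (0 : R) by move=> _; exact: is_derive_cst.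
  have Dva x : a <= x <= b -> is_derive x 1 v (dv x).
    by move=> /andP[ax xb]; apply: Dv; rewrite (le_trans a0 ax) (le_trans xb bt).
  have := le_of_derive ab Dva Dc; rewrite /cst subrr subr_le0; apply => x /[dup] /vr vx /andP[ax xb].
  apply: (le_trans (dvle x _ vx)); first by rewrite (le_trans a0 (ltW ax)) (le_trans (ltW xb) bt).
  by rewrite mulNr oppr_le0 mulr_ge0.
(* Let m be the first time at which v reaches rho. Up to m the function does not increase, so v m <=
   v 0 < rho, a contradiction. *)
have small s : 0 <= s <= t -> v s < rho.
  move=> /andP[s0 st]; rewrite ltNge; apply/negP => vs.
  pose S := [set x | 0 <= x <= s /\ rho <= v x].
  have Si : has_inf S.
    by split; [exists s; rewrite /S/= s0 lexx|exists 0 => x [/andP[]]].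
  pose m := inf S.
  have mle x : S x -> m <= x by move=> Sx; apply: ge_inf => //; exact: Si.2.
  have m0 : 0 <= m by apply: lb_le_inf; [exact: Si.1|move=> x [/andP[]]].
  have ms : m <= s by apply: mle; rewrite /S/= s0 lexx.
  have vm : rho <= v m.
    rewrite leNgt; apply/negP => vm.
    have mt : 0 <= m <= t by rewrite m0 (le_trans ms).
    have cv : {for m, continuous v}.
      by apply: differentiable_continuous; apply/derivable1_diffP; have [] := Dv m mt.
    have gap : 0 < rho - v m by rewrite subr_gt0.
    have [e e0 he] := continuous_eps cv gap.
    have : m + e <= m; last by rewrite gerDl leNgt e0.
    apply: lb_le_inf; first exact: Si.1.
    move=> x Sx; rewrite leNgt; apply/negP => xm.
    have := he (x - m); rewrite subrKC ger0_norm ?subr_ge0 ?mle// => /(_ _)/ltr_normlW h.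
    have /h : x - m < e by rewrite ltrBlDl.
    by case: Sx => _; lra.
  have : v m <= v 0.
    apply: noninc => // [|x /andP[x0 xm]]; first exact: le_trans st.
    rewrite ltNge; apply/negP => vx; have := mle x; rewrite leNgt xm => /(_ _); apply/not_implyP.
    by split=> //; split=> //; rewrite ltW// (le_trans (ltW xm)).
  by move=> /(le_trans vm); rewrite leNgt v0rho.
have vt s : 0 <= s <= t -> v t <= v s.
  move=> /andP[s0 st]; apply: noninc => // x /andP[sx xt]; apply: small.
  by rewrite (le_trans s0 (ltW sx)) ltW.
have Dl x : 0 <= x <= t -> is_derive x 1 (fun z => - (k * v t) * z) (- (k * v t) * 1).
  by move=> _; exact: (is_derive_scale (is_derive_id x 1)).
have := le_of_derive t0 Dv Dl; rewrite !mulr0 mulr1 subr0 => h.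
suff : v t - v 0 <= - (k * v t) * t by lra.
apply: h => x /andP[x0 xt]; have xx : 0 <= x <= t by rewrite !ltW.
by apply: (le_trans (dvle x xx (small x xx))); rewrite mulNr lerN2 ler_wpM2l// vt.
Qed.

Lemma is_derive_coord (R : realType) n (x : R -> 'rV[R]_n) (t : R) (l : 'rV[R]_n) i :
  is_derive t 1 x l -> is_derive t 1 (fun s => x s 0 i) (l 0 i).
Proof.
move=> Dx; apply: eps_is_derive => e e0; have [a a0 ha] := is_derive_eps Dx e0.
exists a => // h hx; apply: (le_trans _ (ha h hx)).
by have := mx_entry_le_norm (x (t + h) - x t - h *: l) 0 i; rewrite !mxE.
Qed.

Lemma is_derive_sumr (R : realType) (I : Type) (s : seq I) (F : I -> R -> R) (dF : I -> R) (t : R) :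
  (forall i, is_derive t 1 (F i) (dF i)) ->
  is_derive t 1 (fun z => \sum_(i <- s) F i z) (\sum_(i <- s) dF i).
Proof.
move=> DF; elim: s => [|a s IH].
  rewrite big_nil; have -> : (fun z => \sum_(i <- [::]) F i z) = cst 0.
    by apply/funext => z; rewrite big_nil.
  exact: is_derive_cst.
rewrite big_cons; have -> : (fun z => \sum_(i <- a :: s) F i z) = (fun z => F a z + \sum_(i <- s) F i z).
  by apply/funext => z; rewrite big_cons.
exact: is_derive_add.
Qed.

Lemma is_derive_row (R : realType) n (x : R -> 'rV[R]_n) (t : R) (l : 'rV[R]_n) :
  (forall i, is_derive t 1 (fun s => x s 0 i) (l 0 i)) -> is_derive t 1 x l.
Proof.
move=> Dx; apply: eps_is_derive => e e0.
have [i|i a b _ ba hb z za|a a0 ha] := @finite_delta R 'I_n (fun i a => forall z, `|z| < a ->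
   `|x (t + z) 0 i - x t 0 i - z * l 0 i| <= e * `|z|).
- by have [a a0 ha] := is_derive_eps (Dx i) e0; exists a => // z; exact: ha.
- exact: (hb z (lt_le_trans za ba)).
exists a => // z za; apply: row_norm_le => [|j]; first by rewrite mulr_ge0// ltW.
by rewrite !mxE; exact: ha.
Qed.

(** * Weighted squares as Lyapunov functions *)

Section quadratic_lyapunov.
Variables (R : realType) (n : nat) (f : 'rV[R]_n -> 'rV[R]_n) (xs : 'rV[R]_n).
Variables (D : 'I_n -> R) (k r : R).
Hypotheses (D_gt0 : forall i, 0 < D i) (k_gt0 : 0 < k) (r_gt0 : 0 < r).
Hypothesis dissip : forall x : 'rV[R]_n, (forall i, `|x 0 i - xs 0 i| < r) ->
  \sum_i D i * ((x 0 i - xs 0 i) * f x 0 i) <= - k * \sum_i D i * (x 0 i - xs 0 i) ^+ 2.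

Let V (x : 'rV[R]_n) := \sum_i D i * (x 0 i - xs 0 i) ^+ 2.

Let V_ge0 x : 0 <= V x.
Proof. by apply: sumr_ge0 => i _; rewrite mulr_ge0 ?sqr_ge0// ltW. Qed.

Let V_small : exists2 m, 0 < m & forall (x : 'rV[R]_n) e, 0 <= e -> V x <= m * e ^+ 2 -> forall i, `|x 0 i - xs 0 i| <= e.
Proof.
have [m m0 hm] : exists2 m, 0 < m & forall i, m <= D i.
  apply: finite_delta => [i|i a b _ ba]; first by exists (D i).
  exact: le_trans ba.
exists m => // x e e0 Ve i; rewrite -(@ler_pXn2r _ 2)// ?nnegrE// real_normK ?num_real//.
rewrite -(ler_pM2l m0); apply: le_trans Ve; rewrite /V (bigD1 i)//=.
rewrite ler_wpDr//; last by rewrite ler_wpM2r// sqr_ge0.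
by apply: sumr_ge0 => j _; rewrite mulr_ge0 ?sqr_ge0// ltW.
Qed.

Lemma lyapunov_decay : exists2 rho : R, 0 < rho & forall (x : R -> 'rV[R]_n) (t : R), 0 <= t ->
  (forall s : R, 0 <= s <= t -> is_derive s 1 x (f (x s))) -> V (x 0) < rho ->
  V (x t) * (1 + 2 * k * t) <= V (x 0).
Proof.
have [m m0 hm] := V_small.
(* On this sublevel set every coordinate is within r / 2 of [xs], where the dissipation hypothesis
   is available. *)
exists (m * (r / 2) ^+ 2); first by rewrite mulr_gt0// exprn_gt0// divr_gt0.
move=> x t t0 Dx Vx.
apply: (@decay_trap _ (V \o x) (fun s => 2 * \sum_i D i * ((x s 0 i - xs 0 i) * f (x s) 0 i)) (2 * k) _ t t0 _ _ _ _ Vx).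
- by rewrite mulr_ge0// ltW.
- by move=> s; exact: V_ge0.
- move=> s st; rewrite /V mulr_sumr; apply: is_derive_sumr => i.
  have Dc : is_derive s 1 (fun z => x z 0 i - xs 0 i) (f (x s) 0 i - 0).
    exact: (is_derive_sub (is_derive_coord i (Dx s st)) (is_derive_cst (xs 0 i) s 1)).
  apply: (is_derive_eq (is_derive_scale (is_derive_pow Dc 2) (D i))).
  by rewrite subr0/=; ring.
- move=> s st Vs; have small i : `|x s 0 i - xs 0 i| < r.
    have r20 : 0 <= r / 2 by rewrite ltW// divr_gt0.
    by apply: (le_lt_trans (hm _ _ r20 (ltW Vs) i)); rewrite gtr_pMr// invf_lt1 ?ltr1n.
  by have := dissip small; rewrite -/(V _) /comp; lra.
Qed.

Let V_init rho : 0 < rho -> exists2 d, 0 < d & forall x, `|x - xs| < d -> V x < rho.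
Proof.
move=> rho0; pose S := \sum_i D i.
have S0 : 0 <= S by apply: sumr_ge0 => i _; exact: ltW.
(* Numbers in [0, 1] exceed their squares, so inside the unit ball V x <= S |x - xs|. *)
exists (Num.min 1 (rho / (S + 1))).
  by rewrite lt_min ltr01/= divr_gt0// ltr_wpDl.
move=> x; rewrite lt_min => /andP[x1 x2].
have S1 : 0 < S + 1 by rewrite ltr_wpDl.
apply: (@le_lt_trans _ _ (S * `|x - xs|)); last first.
  apply: (@le_lt_trans _ _ ((S + 1) * `|x - xs|)); first by rewrite ler_wpM2r// lerDl.
  by rewrite mulrC -ltr_pdivlMr.
rewrite mulr_suml; apply: ler_sum => i _; rewrite ler_pM2l//.
have h := mx_entry_le_norm (x - xs) 0 i; rewrite !mxE in h.
rewrite -real_normK ?num_real// expr2 (le_trans _ h)// ler_piMr//.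
by apply: (le_trans h); exact: ltW.
Qed.

Lemma lyapunov_stable : stable f xs.
Proof.
move=> e e0; have [rho rho0 hrho] := lyapunov_decay; have [m m0 hm] := V_small.
have me0 : 0 < Num.min rho (m * (e / 2) ^+ 2).
  by rewrite lt_min rho0/= mulr_gt0// exprn_gt0// divr_gt0.
have [d d0 hd] := V_init me0; exists d => // T x sol x0 t /itvP tT.
have := hd _ x0; rewrite lt_min => /andP[V1 V2].
have Dx s : 0 <= s <= t -> is_derive s 1 x (f (x s)).
  move=> /andP[s0 st]; apply: sol; rewrite /= in_itv/= s0/=.
  by rewrite (le_lt_trans st)// tT.
have t0 : 0 <= t by rewrite tT.
have e2 : 0 <= e / 2 by rewrite ltW// divr_gt0.
apply: (@le_lt_trans _ _ (e / 2)); last by lra.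
apply: row_norm_le => // i; rewrite !mxE; apply: hm => //.
apply: (le_trans _ (ltW V2)); apply: (le_trans _ (hrho x t t0 Dx V1)).
by rewrite ler_peMr// lerDl !mulr_ge0// ltW.
Qed.

Lemma lyapunov_attractive : attractive f xs.
Proof.
have [rho rho0 hrho] := lyapunov_decay; have [m m0 hm] := V_small.
have [d d0 hd] := V_init rho0; exists d => // x sol /hd Vx0.
apply/cvgrPdist_le => e e0.
near=> t.
have t0 : 0 <= t by near: t; apply: nbhs_pinfty_ge; exact: num_real.
have Dx s : 0 <= s <= t -> is_derive s 1 x (f (x s)).
  by move=> /andP[s0 st]; apply: sol; rewrite /= in_itv/= s0.
rewrite distrC; apply: row_norm_le => [|i]; first exact: ltW.
rewrite !mxE; apply: hm; first exact: ltW.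
have h := hrho x t t0 Dx Vx0.
have k2 : 0 < 2 * k by rewrite mulr_gt0.
have kt : 0 < 1 + 2 * k * t by rewrite ltr_pwDl// mulr_ge0// ltW.
rewrite -(ler_pM2r kt); apply: (le_trans h); apply: (le_trans (ltW Vx0)).
have me : 0 < m * e ^+ 2 by rewrite mulr_gt0// exprn_gt0.
rewrite -ler_pdivrMl//; apply: (@le_trans _ _ (2 * k * t)); last by rewrite lerDr.
rewrite -ler_pdivrMl//.
Unshelve. all: by end_near. Qed.

Lemma lyapunov_asymptotically_stable : asymptotically_stable f xs.
Proof. by split; [exact: lyapunov_stable|exact: lyapunov_attractive]. Qed.
End quadratic_lyapunov.

Section hyperbolic_stability.
Variables (R : realType) (n : nat) (A : 'M[R]_n) (d : 'I_n -> R) (psi : 'I_n -> R -> R).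
Variables (p : R) (f : 'rV[R]_n -> 'rV[R]_n).
Hypotheses (A_ge0 : forall i j, 0 <= A i j) (A_sym : A^T = A) (p_gt0 : 0 < p)
  (d_gt0 : forall i, 0 < d i)
  (psi_smooth : forall i k (s : R), derivable (psi i)^`(k)%classic s 1)
  (psi_sat : forall i, saturating (psi i))
  (fE : forall x i, f x 0 i = - d i * x 0 i + p * \sum_j A i j * psi j (x 0 j)).

Local Notation D xs i := ((psi i)^`()%classic (xs 0 i)).

(** With r = psi'(xs) w / z the ground state identity writes the form as sum z_i r_i^2 g_i plus a
    nonnegative energy, where g_i > 0 is the gap in the supersolution inequality for z. *)
Lemma linearization_form_ge (xs : 'rV[R]_n) (z : 'I_n -> R) : (forall i, 0 < z i) ->
  (forall i, p * \sum_j A i j * z j < d i / D xs i * z i) ->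
  exists2 k, 0 < k & forall w : 'I_n -> R,
    k * \sum_i D xs i * w i ^+ 2 <= \sum_i d i * D xs i * w i ^+ 2 -
      p * \sum_i \sum_j A i j * (D xs i * w i) * (D xs j * w j).
Proof.
move=> z0 zA; have D0 i : 0 < D xs i by exact: sat_deriv_gt0.
pose g i := d i / D xs i * z i - p * \sum_j A i j * z j.
have g0 i : 0 < g i by rewrite subr_gt0.
have [k k0 hk] : exists2 k, 0 < k & forall i, k * z i <= g i * D xs i.
  apply: finite_delta => [i|i a b _ ba]; last by apply: le_trans; rewrite ler_pM2r.
  by exists (g i * D xs i / z i); rewrite ?divfK ?lt0r_neq0// divr_gt0// mulr_gt0.
exists k => // w; pose r i := D xs i * w i / z i.
have rz i : z i * r i = D xs i * w i by rewrite mulrC divfK// lt0r_neq0.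
have -> : \sum_i \sum_j A i j * (D xs i * w i) * (D xs j * w j) =
    \sum_i \sum_j A i j * (z i * r i) * (z j * r j).
  by apply: eq_bigr => i _; apply: eq_bigr => j _; rewrite !rz.
rewrite symmetric_form_ground_state; last exact: mx_symE.
have E0 : 0 <= \sum_i \sum_j A i j * z i * z j * (r i - r j) ^+ 2.
  by apply: sumr_ge0 => i _; apply: sumr_ge0 => j _; rewrite mulr_ge0 ?sqr_ge0// mulr_ge0 ?(ltW (z0 _))// mulr_ge0 ?A_ge0// ltW.
have E1 : \sum_i d i * D xs i * w i ^+ 2 - p * \sum_i z i * r i ^+ 2 * (\sum_j A i j * z j) =
   \sum_i z i * r i ^+ 2 * g i.
  rewrite mulr_sumr -sumrB; apply: eq_bigr => i _; rewrite /g /r; field.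
  by rewrite !lt0r_neq0.
rewrite mulrBr opprB addrCA E1 ler_wpDl//; first by rewrite !mulr_ge0// ltW.
rewrite mulr_sumr; apply: ler_sum => i _.
have -> : k * (D xs i * w i ^+ 2) = z i * r i ^+ 2 * (k * z i / D xs i).
  by rewrite /r; field; rewrite !lt0r_neq0.
have zr : 0 <= z i * r i ^+ 2 by rewrite mulr_ge0 ?sqr_ge0// ltW.
by rewrite ler_wpM2l// ler_pdivrMr.
Qed.

Lemma hyperbolic_asymptotically_stable (xs : 'rV[R]_n) (z : 'I_n -> R) :
  f xs = 0 -> (forall i, 0 < z i) ->
  (forall i, p * \sum_j A i j * z j < d i / D xs i * z i) -> asymptotically_stable f xs.
Proof.
move=> fxs z0 zA; have D0 i : 0 < D xs i by exact: sat_deriv_gt0.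
have [k k0 hk] := linearization_form_ge z0 zA.
pose M := p * (\sum_i \sum_j A i j * D xs i) * \sum_i (D xs i)^-1.
have M0 : 0 <= M.
  rewrite mulr_ge0//; last by apply: sumr_ge0 => i _; rewrite invr_ge0 ltW.
  rewrite mulr_ge0 ?(ltW p_gt0)//; apply: sumr_ge0 => i _; apply: sumr_ge0 => j _.
  by rewrite mulr_ge0 ?A_ge0// ltW.
(* With this tolerance the nonlinear remainder consumes at most half of the dissipation rate k; the
   1 covers M = 0. *)
pose e := k / (2 * (M + 1)).
have M1 : 0 < M + 1 by rewrite ltr_wpDl.
have e0 : 0 < e by rewrite divr_gt0// mulr_gt0.
have [r r0 hr] := sat_family_eps psi_smooth (fun i => xs 0 i) e0.
(* The weights [D xs i] make the linearization symmetric. *)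
apply: (@lyapunov_asymptotically_stable _ _ f xs (fun i => D xs i) (k / 2) r) => //.
  by rewrite divr_gt0.
move=> x xr; pose w i := x 0 i - xs 0 i.
pose rho j := psi j (x 0 j) - psi j (xs 0 j) - w j * D xs j.
have rhoe j : `|rho j| <= e * `|w j|.
  by have := hr j (w j) (xr j); rewrite /w subrKC.
have fx i : f x 0 i = - d i * w i + p * (\sum_j A i j * (D xs j * w j)) + p * \sum_j A i j * rho j.
  have : f xs 0 i = 0 by rewrite fxs mxE.
  rewrite !fE => E; rewrite -[LHS]subr0 -[X in _ - X]E.
  have -> : \sum_j A i j * rho j = \sum_j A i j * psi j (x 0 j) - \sum_j A i j * psi j (xs 0 j)
     - \sum_j A i j * (D xs j * w j).
    by rewrite -!sumrB; apply: eq_bigr => j _; rewrite /rho; ring.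
  by rewrite /w; ring.
set W := \sum_i D xs i * w i ^+ 2.
have W0 : 0 <= W by apply: sumr_ge0 => i _; rewrite mulr_ge0 ?sqr_ge0// ltW.
have ww i j : `|w i| * `|w j| <= (\sum_i (D xs i)^-1) * W.
  have wW a : w a ^+ 2 <= (\sum_i (D xs i)^-1) * W.
    apply: (@le_trans _ _ ((D xs a)^-1 * W)).
      rewrite ler_pdivlMl// /W (bigD1 a)//= ler_wpDr// sumr_ge0// => b _.
      by rewrite mulr_ge0 ?sqr_ge0// ltW.
    by rewrite ler_wpM2r// (bigD1 a)//= ler_wpDr// sumr_ge0// => b _; rewrite invr_ge0 ltW.
  have := wW i; have := wW j; rewrite -[w i ^+ 2]real_normK ?num_real// -[w j ^+ 2]real_normK ?num_real//.
  by have := sqr_ge0 (`|w i| - `|w j|); nra.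
have err : p * (\sum_i \sum_j (D xs i * w i) * (A i j * rho j)) <= k / 2 * W.
  apply: (@le_trans _ _ (e * M * W)); last first.
    rewrite ler_wpM2r// /e; have -> : k / (2 * (M + 1)) * M = k / 2 * (M / (M + 1)).
      by field; rewrite lt0r_neq0.
    by rewrite ler_piMr ?ler_pdivrMr ?mul1r ?lerDl// ltW// divr_gt0.
  have -> : e * M * W = p * \sum_i \sum_j A i j * D xs i * (e * ((\sum_i (D xs i)^-1) * W)).
    under eq_bigr do rewrite -mulr_suml.
    by rewrite -mulr_suml /M; ring.
  rewrite ler_pM2l//; apply: ler_sum => i _; apply: ler_sum => j _.
  apply: (le_trans (ler_norm _)); rewrite !normrM (ger0_norm (A_ge0 _ _)) (gtr0_norm (D0 _)).
  have -> : D xs i * `|w i| * (A i j * `|rho j|) = A i j * D xs i * (`|w i| * `|rho j|) by ring.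
  rewrite ler_wpM2l ?mulr_ge0 ?A_ge0 ?(ltW (D0 _))//.
  apply: (@le_trans _ _ (e * (`|w i| * `|w j|))); last by rewrite ler_pM2l.
  by rewrite mulrCA ler_wpM2l.
have -> : \sum_i D xs i * ((x 0 i - xs 0 i) * f x 0 i) =
   - (\sum_i d i * D xs i * w i ^+ 2 - p * \sum_i \sum_j A i j * (D xs i * w i) * (D xs j * w j))
   + p * (\sum_i \sum_j (D xs i * w i) * (A i j * rho j)).
  rewrite opprB !mulr_sumr -sumrB -big_split/=; apply: eq_bigr => i _.
  have -> : \sum_j A i j * (D xs i * w i) * (D xs j * w j) = D xs i * w i * \sum_j A i j * (D xs j * w j).
    by rewrite mulr_sumr; apply: eq_bigr => j _; ring.
  by rewrite fx -/(w i) -mulr_sumr; ring.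
by have := hk w; rewrite -/W; lra.
Qed.
End hyperbolic_stability.

(** * Existence of solutions and instability *)

Lemma is_derive_exp_scale (R : realType) (k x : R) :
  is_derive x 1 (fun s => expR (k * s)) (k * expR (k * x)).
Proof.
have h := is_derive_scale (is_derive_id x (1 : R)) k.
apply: (is_derive_eq (is_derive1_comp (is_derive_expR _) h)).
by rewrite mulr1 mulrC.
Qed.

(** 2 C / 2^k is the tail of the geometric series, so the intervals of this radius around a k are
    nested. The supremum of their left ends is the limit, with an explicit rate. *)
Lemma geometric_limit (R : realType) (a : nat -> R) (C : R) : 0 <= C ->
  (forall k, `|a k.+1 - a k| <= C / 2 ^+ k) ->
  exists l, forall k, `|a k - l| <= 2 * C / 2 ^+ k.
Proof.
move=> C0 H; pose b k := a k - 2 * C / 2 ^+ k; pose c k := a k + 2 * C / 2 ^+ k.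
have half k : 2 * C / 2 ^+ k = C / 2 ^+ k + 2 * C / 2 ^+ k.+1.
  by rewrite exprS; field; rewrite expf_neq0.
have bS k : b k <= b k.+1.
  by have := H k; rewrite /b (half k) ler_norml => /andP[]; lra.
have cS k : c k.+1 <= c k.
  by have := H k; rewrite /c (half k) ler_norml => /andP[]; lra.
have bm : {homo b : i j / (i <= j)%N >-> i <= j} by apply: homo_leq => //; exact: le_trans.
have cm : {homo c : i j / (i <= j)%N >-> j <= i}.
  by apply: (@homo_leq R c (fun x y => y <= x)) => // [y x z h1 h2]; exact: le_trans h2 h1.
have g0 k : 0 <= 2 * C / 2 ^+ k by rewrite divr_ge0 ?exprn_ge0// mulr_ge0.
have bc i j : b i <= c j.
  apply: (le_trans (bm _ _ (leq_maxl i j))); apply: (le_trans _ (cm _ _ (leq_maxr i j))).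
  by rewrite /b /c; have := g0 (maxn i j); lra.
exists (sup (range b)) => k.
have hs : has_sup (range b).
  by split; [exists (b 0%N); exists 0%N|exists (c 0%N) => _ [j _ <-]].
have h1 : b k <= sup (range b) by apply: ub_le_sup; [exact: hs.2|exists k].
have h2 : sup (range b) <= c k by apply: ge_sup; [exact: hs.1|move=> _ [j _ <-]].
by rewrite ler_norml; move: h1 h2; rewrite /b /c => ? ?; apply/andP; split; lra.
Qed.

(** * Picard iteration in the positive cone *)

Section picard.
Variables (R : realType) (n : nat) (H : R -> 'rV[R]_n -> 'rV[R]_n) (K T : R) (y0 : 'rV[R]_n).
Hypotheses (K_gt0 : 0 < K) (T_ge0 : 0 <= T)
  (H_lip : forall (t : R) (x y : 'rV[R]_n), 0 <= t -> `|H t x - H t y| <= K * `|x - y|)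
  (H_cont : forall y : R -> 'rV[R]_n, continuous y -> continuous (fun t => H t (y t)))
  (H_ge0 : forall (t : R) (x : 'rV[R]_n), 0 <= t -> (forall i, 0 <= x 0 i) -> forall i, 0 <= H t x 0 i)
  (y0_ge0 : forall i, 0 <= y0 0 i).

Local Notation cl := (clamp T).

Let picard_step (y : R -> 'rV[R]_n) : exists Y : R -> 'rV[R]_n,
  (forall t, 0 <= t <= T -> {for t, continuous y}) ->
  Y 0 = y0 /\ forall t, 0 <= t <= T -> is_derive t 1 Y (H t (y t)).
Proof.
(* [choice] will need a total operator, so a curve that is not continuous is simply returned. *)
have [cy|ncy] := pselect (forall t, 0 <= t <= T -> {for t, continuous y}); last by exists y => /ncy.
pose h i (t : R) := H t (y (cl t)) 0 i.
have ch i : continuous (h i).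
  have cc : continuous (y \o cl) by exact: continuous_clamped.
  move=> t; apply: (@continuous_comp _ _ _ (fun t => H t (y (cl t))) (fun M : 'rV[R]_n => M 0 i)).
    exact: (H_cont cc).
  exact: coord_continuous.
have /choice[Y0 hY] : forall i, exists Y, forall t, 0 <= t <= T -> is_derive t 1 Y (h i t).
  by move=> i; apply: antiderivative_itv => // t _; exact: ch.
exists (fun t => \row_i (Y0 i t - Y0 i 0 + y0 0 i)) => _; split.
  by apply/rowP => i; rewrite mxE subrr add0r.
move=> t tT; apply: is_derive_row => i.
have -> : (fun s => (\row_i (Y0 i s - Y0 i 0 + y0 0 i)) 0 i) =
    (fun s => Y0 i s - (Y0 i 0 - y0 0 i)).
  by apply/funext => s; rewrite mxE; ring.
have := is_derive_sub (hY i t tT) (is_derive_cst (Y0 i 0 - y0 0 i) t 1).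
by rewrite subr0 /h clamp_id.
Qed.

(** H is nonnegative on the cone, so every iterate stays above its initial value there, and the
    uniform limit inherits nonnegativity. *)
Lemma picard_nonneg : exists y : R -> 'rV[R]_n, y 0 = y0 /\
  forall t : R, 0 <= t <= T -> is_derive t 1 y (H t (y t)) /\ forall i, 0 <= y t 0 i.
Proof.
have /choice[Phi hPhi] := picard_step.
pose Y k := iter k Phi (fun=> y0).
have is_cont (y : R -> 'rV[R]_n) (t : R) l : is_derive t 1 y l -> {for t, continuous y}.
  by case=> /derivable1_diffP/differentiable_continuous.
have sub (t s : R) : 0 <= t <= T -> 0 <= s <= t -> 0 <= s <= T.
  by move=> /andP[_ tT] /andP[-> st]; exact: le_trans tT.
have Ycont k t : 0 <= t <= T -> {for t, continuous (Y k)}.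
  elim: k t => [|k IH] t tT; first exact: cvg_cst.
  by have [_ h] := hPhi _ IH; exact: is_cont (h t tT).
have YS k : Y k.+1 0 = y0 /\ forall t, 0 <= t <= T -> is_derive t 1 (Y k.+1) (H t (Y k t)).
  exact: hPhi (Ycont k).
have Yz k : Y k 0 = y0 by case: k => [//|k]; exact: (YS k).1.
have DY k t i : 0 <= t <= T -> is_derive t 1 (fun s => Y k.+1 s 0 i) (H t (Y k t) 0 i).
  by move=> tT; apply: is_derive_coord; exact: (YS k).2.
have grow (y : R -> 'rV[R]_n) (dy : R -> R) i t : 0 <= t <= T -> y 0 = y0 ->
    (forall s, 0 <= s <= T -> is_derive s 1 (fun s => y s 0 i) (dy s)) ->
    (forall s, 0 <= s <= T -> 0 <= dy s) -> 0 <= y t 0 i.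
  move=> tT yz Dy dy0; have /andP[t0 _] := tT.
  have Dc x : 0 <= x <= t -> is_derive x 1 (cst (0 : R)) (0 : R) by move=> _; exact: is_derive_cst.
  have Dyt x : 0 <= x <= t -> is_derive x 1 (fun s => y s 0 i) (dy x).
    by move=> xt; apply: Dy; exact: sub xt.
  have := le_of_derive t0 Dc Dyt; rewrite /cst subrr yz subr_ge0 => h.
  apply: (le_trans (y0_ge0 i)); apply: h => x /andP[x0 xt]; apply: dy0.
  by apply: (sub t) => //; rewrite !ltW.
have Yge0 k t i : 0 <= t <= T -> 0 <= Y k t 0 i.
  elim: k t i => [|k IH] t i tT; first exact: y0_ge0.
  apply: (grow (Y k.+1) _ i t tT (Yz _) (fun s => DY k s i)) => s sT.
  by apply: H_ge0 => [|j]; [case/andP: sT|exact: IH].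
have [M M0 hM] : exists2 M, 0 <= M & forall t, 0 <= t <= T -> `|Y 1%N t - Y 0%N t| <= M.
  have cD : {within `[0, T], continuous (fun t => `|Y 1%N t - Y 0%N t|)}.
    apply: continuous_in_subspaceT => t; rewrite inE/= in_itv/= => tT.
    apply: continuous_comp; last exact: norm_continuous.
    exact: (continuousB (Ycont 1%N _ tT) (Ycont 0%N _ tT)).
  have [c cT hc] := EVT_max T_ge0 cD.
  by exists `|Y 1%N c - Y 0%N c| => // t tT; apply: hc; rewrite in_itv.
(* The weight [E] makes each Picard step halve the distance on all of [0, T]. *)
pose E t := expR (2 * K * t).
have E0 t : 0 < E t by exact: expR_gt0.
have contr k t : 0 <= t <= T -> `|Y k.+1 t - Y k t| <= M / 2 ^+ k * E t.
  elim: k t => [|k IH] t tT.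
    rewrite expr0 divr1; apply: (le_trans (hM t tT)); rewrite ler_peMr//.
    by rewrite /E -[leLHS]expR0 ler_expR mulr_ge0 ?mulr_ge0 ?(ltW K_gt0)//; case/andP: tT.
  have /andP[t0 _] := tT.
  have c0 j : 0 <= M / 2 ^+ j by rewrite divr_ge0// exprn_ge0.
  apply: row_norm_le => [|i]; first by rewrite mulr_ge0// ltW.
  have D1 x : 0 <= x <= t -> is_derive x 1 (fun s => Y k.+2 s 0 i - Y k.+1 s 0 i)
      (H x (Y k.+1 x) 0 i - H x (Y k x) 0 i).
    by move=> xt; apply: is_derive_sub; apply: DY; exact: sub xt.
  have D2 x : 0 <= x <= t -> is_derive x 1 (fun s => M / 2 ^+ k.+1 * E s)
      (M / 2 ^+ k.+1 * (2 * K * E x)).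
    by move=> xt; apply: is_derive_scale; exact: is_derive_exp_scale.
  have := norm_le_of_derive t0 D1 D2; rewrite !Yz subrr subr0 !mxE => h.
  apply: (@le_trans _ _ (M / 2 ^+ k.+1 * E t - M / 2 ^+ k.+1 * E 0)); last first.
    by rewrite gerBl mulr_ge0// ltW.
  apply: h => x /andP[x0 xt]; have xT : 0 <= x <= T by apply: (sub t); rewrite ?tT// !ltW.
  have := mx_entry_le_norm (H x (Y k.+1 x) - H x (Y k x)) 0 i; rewrite !mxE => /le_trans; apply.
  apply: (le_trans (H_lip _ _ (ltW x0))).
  have -> : M / 2 ^+ k.+1 * (2 * K * E x) = K * (M / 2 ^+ k * E x).
    by rewrite exprS; field; rewrite expf_neq0.
  by rewrite ler_pM2l// IH.
pose C := M * E T.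
have C0 : 0 <= C by rewrite mulr_ge0// ltW.
have /choice[yi hyi] : forall ti : R * 'I_n, exists l, 0 <= ti.1 <= T -> forall k, `|Y k ti.1 0 ti.2 - l| <= 2 * C / 2 ^+ k.
  move=> [t i] /=; have [tT|//] := pselect (0 <= t <= T); last by exists 0.
  have [|l hl] := @geometric_limit R (fun k => Y k t 0 i) C C0; last by exists l.
  move=> k; have := mx_entry_le_norm (Y k.+1 t - Y k t) 0 i; rewrite !mxE => /le_trans; apply.
  apply: (le_trans (contr k t tT)); rewrite /C mulrAC ler_wpM2r ?invr_ge0 ?exprn_ge0//.
  rewrite ler_wpM2l// ler_expR ler_pM2l ?mulr_gt0//; by case/andP: tT.
pose yl t : 'rV[R]_n := \row_i yi (t, i).
have c2 k : 0 <= 2 * C / 2 ^+ k by rewrite divr_ge0 ?exprn_ge0// mulr_ge0.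
have yl_le k t : 0 <= t <= T -> `|Y k t - yl t| <= 2 * C / 2 ^+ k.
  by move=> tT; apply: row_norm_le => // i; rewrite !mxE; exact: (hyi (t, i) tT k).
have small e : 0 < e -> exists k, 2 * C / 2 ^+ k <= e.
  move=> e0; exists (Num.truncn (2 * C / e)).+1; rewrite ler_pdivrMr ?exprn_gt0//.
  rewrite -[leLHS](divfK (lt0r_neq0 e0)) mulrC ler_pM2l//.
  apply: (@le_trans _ _ (Num.truncn (2 * C / e)).+1%:R).
    by apply/ltW; exact: truncnS_gt.
  by rewrite -natrX ler_nat ltnW// ltn_expl.
have yl_lim (x : R) (B : R) : 0 <= B -> (forall k, `|x| <= B * (2 * C / 2 ^+ k)) -> x = 0.
  move=> B0 hB; apply/eqP; rewrite -normr_le0; apply/ler_addgt0Pr => e e0; rewrite add0r.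
  have [k hk] := small (e / (B + 1)) (divr_gt0 e0 (ltr_wpDl B0 ltr01)).
  apply: (le_trans (hB k)); apply: (@le_trans _ _ (B * (e / (B + 1)))); first by rewrite ler_wpM2l.
  have B1 : 0 < B + 1 by rewrite ltr_wpDl.
  by rewrite mulrCA ler_piMr ?(ltW e0)// ler_pdivrMr// mul1r lerDl.
have yl_ge0 t i : 0 <= t <= T -> 0 <= yl t 0 i.
  move=> tT; rewrite leNgt; apply/negP => yneg.
  have [|k hk] := small (- yl t 0 i / 2); first by rewrite divr_gt0// oppr_gt0.
  have := hyi (t, i) tT k; have := Yge0 k t i tT; rewrite mxE in hk yneg => h1 /ler_normlW.
  by move: hk yneg; lra.
(* A uniform limit of continuous curves is continuous; three errors of e / 4 fit into e. *)
have ylc : continuous (yl \o cl).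
  move=> t; apply: eps_continuous => e e0.
  have e4 : 0 < e / 4 by rewrite divr_gt0.
  have [k hk] := small _ e4.
  have cYk : {for t, continuous (Y k \o cl)}.
    by apply: continuous_clamped => // s; exact: Ycont.
  have [dl dl0 hdl] := continuous_eps cYk e4; exists dl => // h hdt.
  have h1 := le_trans (yl_le k (cl (t + h)) (clamp_itv T_ge0 _)) hk.
  have h2 := le_trans (yl_le k (cl t) (clamp_itv T_ge0 _)) hk.
  have h3 := hdl h hdt; rewrite /= in h3.
  have -> : (yl \o cl) (t + h) - (yl \o cl) t = - (Y k (cl (t + h)) - yl (cl (t + h)))
     + ((Y k (cl (t + h)) - Y k (cl t)) + (Y k (cl t) - yl (cl t))).
    by rewrite /= subrKA opprB subrKA.
  apply: (le_trans (ler_normD _ _)); rewrite normrN.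
  by apply: (le_trans (lerD h1 (ler_normD _ _))); lra.
(* One more Picard step from the limit is differentiable by construction. [yE] identifies the result
   with the limit, which is thus a fixed point and a solution. *)
have [y []] := picard_step (yl \o cl).
  by move=> t _; exact: ylc.
move=> y_0 Dy; exists y; split=> //.
have yE t : 0 <= t <= T -> y t = yl t.
  move=> tT; have /andP[t0 _] := tT; apply/rowP => i; apply/eqP; rewrite -subr_eq0; apply/eqP.
  apply: (yl_lim _ (K * T + 1)); first by rewrite addr_ge0// mulr_ge0// ltW.
  move=> k.
  have D1 x : 0 <= x <= t -> is_derive x 1 (fun s => y s 0 i - Y k.+1 s 0 i)
      (H x (yl (cl x)) 0 i - H x (Y k x) 0 i).
    move=> xt; apply: is_derive_sub; last by apply: DY; exact: sub xt.
    by apply: is_derive_coord; apply: Dy; exact: sub xt.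
  have D2 x : 0 <= x <= t -> is_derive x 1 (fun s : R => K * (2 * C / 2 ^+ k) * s)
      (K * (2 * C / 2 ^+ k) * 1).
    by move=> xt; apply: is_derive_scale; exact: is_derive_id.
  have := norm_le_of_derive t0 D1 D2; rewrite Yz y_0 subrr subr0 mulr0 subr0 mulr1 => h.
  have hh : `|y t 0 i - Y k.+1 t 0 i| <= K * (2 * C / 2 ^+ k) * t.
    apply: h => x /andP[x0 xt]; have xT : 0 <= x <= T by apply: (sub t); rewrite ?tT// !ltW.
    have := mx_entry_le_norm (H x (yl (cl x)) - H x (Y k x)) 0 i; rewrite !mxE => /le_trans; apply.
    apply: (le_trans (H_lip _ _ (ltW x0))); rewrite ler_pM2l// clamp_id// distrC.
    exact: yl_le.
  have h2 := yl_le k.+1 t tT.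
  have h3 : `|Y k.+1 t 0 i - yl t 0 i| <= 2 * C / 2 ^+ k.+1.
    by have := mx_entry_le_norm (Y k.+1 t - yl t) 0 i; rewrite !mxE in h2 * => /le_trans; apply.
  have h4 : 2 * C / 2 ^+ k.+1 <= 2 * C / 2 ^+ k.
    have -> : 2 * C / 2 ^+ k = 2 * (2 * C / 2 ^+ k.+1) by rewrite exprS; field; rewrite expf_neq0.
    by have := c2 k.+1; lra.
  have -> : y t 0 i - yl t 0 i = (y t 0 i - Y k.+1 t 0 i) + (Y k.+1 t 0 i - yl t 0 i) by rewrite addrA subrK.
  apply: (le_trans (ler_normD _ _)); apply: (le_trans (lerD hh (le_trans h3 h4))).
  have : K * (2 * C / 2 ^+ k) * t <= K * (2 * C / 2 ^+ k) * T.
    have tT' : t <= T by case/andP: tT.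
    by rewrite ler_wpM2l// mulr_ge0// ltW.
  by lra.
move=> t tT; split.
  by rewrite yE// -[in yl t](clamp_id tT); exact: Dy.
by move=> i; rewrite yE//; exact: yl_ge0.
Qed.
End picard.

(** * The flow of the cooperative system *)

Section cooperative_flow.
Variables (R : realType) (n : nat) (A : 'M[R]_n) (d : 'I_n -> R) (psi : 'I_n -> R -> R).
Variables (p : R) (f : 'rV[R]_n -> 'rV[R]_n).
Hypotheses (A_ge0 : forall i j, 0 <= A i j) (p_gt0 : 0 < p)
  (d_gt0 : forall i, 0 < d i)
  (psi_smooth : forall i k (s : R), derivable (psi i)^`(k)%classic s 1)
  (psi_sat : forall i, saturating (psi i))
  (fE : forall x i, f x 0 i = - d i * x 0 i + p * \sum_j A i j * psi j (x 0 j)).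

Lemma field_lipschitz : exists2 K, 0 < K & forall x y, `|f x - f y| <= K * `|x - y|.
Proof.
pose K := \sum_i (d i + p * \sum_j A i j).
have ge0 i : 0 <= d i + p * \sum_j A i j.
  by rewrite addr_ge0 ?(ltW (d_gt0 _))// mulr_ge0 ?sumr_ge0// ltW.
have K0 : 0 <= K by exact: sumr_ge0.
exists (K + 1) => [|x y]; first by rewrite ltr_wpDl.
apply: (@le_trans _ _ (K * `|x - y|)); last by rewrite ler_wpM2r// lerDl.
apply: row_norm_le => [|i]; first by rewrite mulr_ge0.
apply: (@le_trans _ _ ((d i + p * \sum_j A i j) * `|x - y|)); last first.
  by rewrite ler_wpM2r// /K [leRHS](bigD1 i)//= lerDl sumr_ge0.
rewrite !mxE !fE.
have -> : - d i * x 0 i + p * (\sum_j A i j * psi j (x 0 j)) -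
   (- d i * y 0 i + p * (\sum_j A i j * psi j (y 0 j))) =
   - d i * (x 0 i - y 0 i) + p * \sum_j A i j * (psi j (x 0 j) - psi j (y 0 j)).
  have -> : \sum_j A i j * (psi j (x 0 j) - psi j (y 0 j)) =
     \sum_j A i j * psi j (x 0 j) - \sum_j A i j * psi j (y 0 j).
    by rewrite -sumrB; apply: eq_bigr => j _; rewrite mulrBr.
  ring.
have xy j : `|x 0 j - y 0 j| <= `|x - y|.
  by have := mx_entry_le_norm (x - y) 0 j; rewrite !mxE.
apply: (le_trans (ler_normD _ _)); rewrite mulrDl lerD//.
  by rewrite normrM normrN (gtr0_norm (d_gt0 i)) ler_wpM2l// ltW.
rewrite normrM (gtr0_norm p_gt0) -mulrA ler_pM2l//; apply: (le_trans (ler_norm_sum _ _ _)).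
rewrite mulr_suml; apply: ler_sum => j _; rewrite normrM (ger0_norm (A_ge0 _ _)) ler_wpM2l//.
apply: le_trans (xy j); exact: sat_lipschitz.
Qed.

(** Supplies the trajectory against which [stable] is refuted. Its nonnegativity allows the lower
    bounds on psi_j (x_j) to be summed with the positive weights u_j. *)
Lemma nonneg_solution (x0 : 'rV[R]_n) (T : R) : 0 <= T -> (forall i, 0 <= x0 0 i) ->
  exists x : R -> 'rV[R]_n, x 0 = x0 /\
    forall t : R, 0 <= t <= T -> is_derive t 1 x (f (x t)) /\ forall i, 0 <= x t 0 i.
Proof.
move=> T0 x00; have [K K0 lip] := field_lipschitz.
(* Since c >= d_i for all i, adding c x absorbs the decay terms and makes the field nonnegative on
   the cone. *)
pose c := \sum_i d i; have dc i : d i <= c.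
  by rewrite /c (bigD1 i)//= lerDl sumr_ge0// => j _; exact: ltW.
have c0 : 0 <= c by apply: sumr_ge0 => i _; exact: ltW.
pose G x := f x + c *: x.
have GE z i : G z 0 i = f z 0 i + c * z 0 i by rewrite /G 2!mxE.
have Glip x y : `|G x - G y| <= (K + c) * `|x - y|.
  rewrite /G opprD addrACA -scalerBr (le_trans (ler_normD _ _))// mulrDl lerD//.
  by rewrite normrZ ger0_norm.
have Gc : continuous G.
  move=> x; apply: eps_continuous => e e0; have Kc : 0 < K + c by rewrite ltr_pwDl.
  exists (e / (K + c)) => [|h he]; first by rewrite divr_gt0.
  apply: (le_trans (Glip _ _)); rewrite addrAC subrr add0r mulrC -ler_pdivlMr//; exact: ltW.
pose E t := expR (c * t).
(* y = e^(ct) x solves a system whose right-hand side preserves the positive cone. *)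
pose H t (y : 'rV[R]_n) := E t *: G ((E t)^-1 *: y).
have E0 t : 0 < E t by exact: expR_gt0.
have Ec : continuous E.
  by move=> t; apply: differentiable_continuous; apply/derivable1_diffP; have [] := is_derive_exp_scale c t.
have [||||y [y0 Dy]] := @picard_nonneg R n H (K + c) T x0 _ T0 _ _ _ x00.
- by rewrite ltr_pwDl.
- move=> t x y _; rewrite /H -scalerBr normrZ gtr0_norm// mulrC -ler_pdivlMr//.
  apply: (le_trans (Glip _ _)); rewrite -scalerBr normrZ normfV gtr0_norm//.
  by rewrite mulrCA mulrC.
- move=> y cy t; rewrite /H; apply: cvgZ; first exact: Ec.
  apply: (@continuous_comp _ _ _ (fun t => (E t)^-1 *: y t) G); last exact: Gc.
  by apply: cvgZ; [apply: cvgV; [rewrite lt0r_neq0|exact: Ec]|exact: cy].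
- move=> t x _ x_ge0 i; rewrite /H; set z := (E t)^-1 *: x.
  rewrite mxE GE fE mulr_ge0 ?(ltW (E0 _))//.
  have z0 j : 0 <= z 0 j by rewrite mxE mulr_ge0 ?invr_ge0 ?(ltW (E0 _)).
  have -> : - d i * z 0 i + p * (\sum_j A i j * psi j (z 0 j)) + c * z 0 i =
     (c - d i) * z 0 i + p * (\sum_j A i j * psi j (z 0 j)) by ring.
  rewrite addr_ge0 ?mulr_ge0 ?subr_ge0 ?(ltW p_gt0) ?sumr_ge0// => j _.
  rewrite mulr_ge0// -(sat0 (psi_sat j)); exact: (sat_le (@psi_smooth j)).
exists (fun t => (E t)^-1 *: y t); split.
  by rewrite /E mulr0 expR0 invr1 scale1r.
move=> t tT; have [Dyt y_ge0] := Dy t tT; split; last first.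
  by move=> i; rewrite mxE mulr_ge0 ?invr_ge0 ?(ltW (E0 _)).
have EV s : (E s)^-1 = expR (- c * s) by rewrite -expRN mulNr.
have -> : (fun t => (E t)^-1 *: y t) = (fun t => expR (- c * t) *: y t).
  by apply/funext => s; rewrite EV.
apply: is_derive_row => i.
have -> : (fun s => (expR (- c * s) *: y s) 0 i) = (fun s => expR (- c * s) * y s 0 i).
  by apply/funext => s; rewrite mxE.
apply: (is_derive_eq (is_derive_mul (is_derive_exp_scale (- c) t) (is_derive_coord i Dyt))).
rewrite /H -EV mxE GE mxE; have := E0 t; set g := f _ 0 i; move=> Et; field; exact: lt0r_neq0.
Qed.

Section instability.
Variables (u : 'I_n -> R) (mu : R).
Hypotheses (n_gt0 : (0 < n)%N) (A_sym : A^T = A)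
  (u_gt0 : forall i, 0 < u i) (u_eig : forall i, \sum_j A i j * u j = mu * d i * u i)
  (supercritical : 1 < p * mu).

Lemma supercritical_unstable : ~ stable f 0.
Proof.
(* p mu q = p mu - 1, so psi(h) >= (1 - q / 2) h implies p mu psi(h) - h >= (p mu - 1) h / 2. *)
pose q := 1 - (p * mu)^-1.
have pmu0 : 0 < p * mu by exact: lt_trans supercritical.
have q0 : 0 < q / 2 by rewrite divr_gt0// subr_gt0 invf_lt1.
have [e e0 he] := sat_family_eps psi_smooth (fun=> 0) q0.
move=> /(_ e e0)[dl dl0 hdl].
pose i0 := Ordinal n_gt0.
pose U := \sum_i u i.
have U0 i : u i <= U.
  by rewrite /U (bigD1 i)//= ler_wpDr// sumr_ge0// => j _; exact: ltW.
have Up : 0 < U by exact: lt_le_trans (u_gt0 i0) (U0 _).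
pose s := dl / 2 / U; have s0 : 0 < s by rewrite !divr_gt0.
pose x0 : 'rV[R]_n := \row_i (s * u i).
have x0_ge0 i : 0 <= x0 0 i by rewrite mxE mulr_ge0// ltW.
have x0_small : `|x0 - 0| < dl.
  rewrite subr0; apply: (@le_lt_trans _ _ (dl / 2)); last by rewrite gtr_pMr// invf_lt1 ?ltr1n.
  apply: row_norm_le => [|i]; first by rewrite divr_ge0// ltW.
  have -> : x0 0 i = dl / 2 * u i / U by rewrite mxE /s mulrAC.
  rewrite gtr0_norm ?ler_pdivrMr ?ler_pM2l ?divr_gt0 ?mulr_gt0 ?divr_gt0//.
have [dm dm0 hdm] : exists2 dm, 0 < dm & forall i, dm <= d i.
  by apply: finite_delta => [i|i a b _ ba]; [exists (d i)|exact: le_trans ba].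
(* A growth rate for h = sum u_i x_i while the solution stays below e; [dm] is a lower bound for the
   degrees. *)
pose k := (p * mu - 1) / 2 * dm.
have k0 : 0 < k by rewrite mulr_gt0// divr_gt0// subr_gt0.
pose h0 := \sum_i u i * x0 0 i.
have h00 : 0 < h0.
  have pos : 0 < u i0 * x0 0 i0 by rewrite mxE mulr_gt0// mulr_gt0.
  rewrite /h0 (bigD1 i0)//=; apply: (ltr_pwDl pos); apply: sumr_ge0 => i _.
  by rewrite mulr_ge0// ltW.
(* Linear growth h(T) >= h0 + k h0 T is enough: by time T it exceeds e U, the largest value
   compatible with |x_i| < e. *)
pose T := (e * U) / (k * h0) + 1.
have T0 : 0 <= T by rewrite addr_ge0// divr_ge0// mulr_ge0// ltW.
(* The extra unit of time keeps T inside the half-open interval used by [stable]. *)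
have [x [xz Dx]] := @nonneg_solution x0 (T + 1) (addr_ge0 T0 ler01) x0_ge0.
have sol : solves f `[0, (T + 1)[ x.
  move=> t; rewrite /= in_itv/= => /andP[t0 tT]; apply: (Dx t _).1.
  by rewrite t0 ltW.
have bnd t : 0 <= t <= T -> forall i, `|x t 0 i| < e.
  move=> /andP[t0 tT] i; have := hdl (T + 1) x sol; rewrite xz => /(_ x0_small t).
  rewrite in_itv/= t0 subr0 (le_lt_trans tT) ?ltrDl// => /(_ isT).
  by apply: le_lt_trans; exact: mx_entry_le_norm.
have x_ge0 t i : 0 <= t <= T -> 0 <= x t 0 i.
  by move=> /andP[t0 tT]; apply: (Dx t _).2; rewrite t0 (le_trans tT)// lerDl.
pose h t := \sum_i u i * x t 0 i.
have Dh t : 0 <= t <= T -> is_derive t 1 h (\sum_i u i * f (x t) 0 i).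
  move=> tT; apply: is_derive_sumr => i; apply: is_derive_scale; apply: is_derive_coord.
  by case/andP: tT => t0 tT; apply: (Dx t _).1; rewrite t0 (le_trans tT)// lerDl.
have hz : h 0 = h0 by rewrite /h xz.
have hgrow t : 0 <= t <= T -> k * h t <= \sum_i u i * f (x t) 0 i.
  move=> tT; have -> : \sum_i u i * f (x t) 0 i =
      \sum_j u j * d j * (p * mu * psi j (x t 0 j) - x t 0 j).
    have -> : \sum_i u i * f (x t) 0 i = p * (\sum_i \sum_j u i * A i j * psi j (x t 0 j))
       - \sum_i u i * d i * x t 0 i.
      rewrite mulr_sumr -sumrB; apply: eq_bigr => i _; rewrite fE.
      have -> : \sum_j u i * A i j * psi j (x t 0 j) = u i * \sum_j A i j * psi j (x t 0 j).
        by rewrite mulr_sumr; apply: eq_bigr => j _; ring.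
      ring.
    rewrite exchange_big/= mulr_sumr -sumrB; apply: eq_bigr => j _.
    have -> : \sum_i u i * A i j * psi j (x t 0 j) = (mu * d j * u j) * psi j (x t 0 j).
      rewrite -u_eig mulr_suml; apply: eq_bigr => i _.
      by rewrite (mx_symE A_sym i j); ring.
    ring.
  rewrite /h mulr_sumr; apply: ler_sum => j _.
  have xj := x_ge0 t j tT; have := he j (x t 0 j) (bnd t tT j).
  rewrite add0r (sat0 (psi_sat j)) (sat_deriv0 (psi_sat j)) subr0 mulr1 (ger0_norm xj) ler_norml.
  move=> /andP[h1 _].
  have h2 : (p * mu - 1) / 2 * x t 0 j <= p * mu * psi j (x t 0 j) - x t 0 j.
    have : p * mu * (x t 0 j - q / 2 * x t 0 j) <= p * mu * psi j (x t 0 j).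
      by rewrite ler_pM2l//; lra.
    have -> : p * mu * (x t 0 j - q / 2 * x t 0 j) = p * mu * x t 0 j - (p * mu - 1) / 2 * x t 0 j.
      have qE : p * mu * q = p * mu - 1 by rewrite /q mulrBr mulr1 divff// lt0r_neq0.
      by rewrite -qE; ring.
    lra.
  have -> : k * (u j * x t 0 j) = u j * dm * ((p * mu - 1) / 2 * x t 0 j) by rewrite /k; ring.
  have h3 : 0 <= (p * mu - 1) / 2 * x t 0 j by rewrite mulr_ge0// divr_ge0// subr_ge0 ltW.
  apply: (@le_trans _ _ (u j * d j * ((p * mu - 1) / 2 * x t 0 j))).
    by rewrite ler_wpM2r// ler_pM2l.
  by rewrite ler_pM2l// mulr_gt0.
have h_ge0 t : 0 <= t <= T -> 0 <= h t.
  by move=> tT; apply: sumr_ge0 => i _; rewrite mulr_ge0 ?x_ge0// ltW.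
have hle t : 0 <= t <= T -> h0 <= h t.
  move=> /andP[t0 tT].
  have Dc y : 0 <= y <= t -> is_derive y 1 (cst (0 : R)) (0 : R) by move=> _; exact: is_derive_cst.
  have Dht y : 0 <= y <= t -> is_derive y 1 h (\sum_i u i * f (x y) 0 i).
    by move=> /andP[y0 yt]; apply: Dh; rewrite y0 (le_trans yt).
  have := le_of_derive t0 Dc Dht; rewrite /cst subrr hz subr_ge0; apply => y /andP[y0 yt].
  have yT : 0 <= y <= T by rewrite (ltW y0) (le_trans (ltW yt)).
  by apply: le_trans (hgrow y yT); rewrite mulr_ge0 ?h_ge0// ltW.
have Dl y : 0 <= y <= T -> is_derive y 1 (fun z : R => k * h0 * z) (k * h0 * 1).
  by move=> _; apply: is_derive_scale; exact: is_derive_id.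
have := le_of_derive T0 Dl Dh; rewrite mulr0 subr0 hz => hT.
have {}hT : k * h0 * T <= h T - h0.
  apply: hT => y /andP[y0 yT]; have yT' : 0 <= y <= T by rewrite !ltW.
  by apply: le_trans (hgrow y yT'); rewrite mulr1 ler_pM2l// hle.
have TT : 0 <= T <= T by rewrite T0 lexx.
have : h T <= e * U.
  rewrite /h /U mulr_sumr; apply: ler_sum => i _; rewrite mulrC ler_pM2r//.
  by apply: (le_trans (ler_norm _)); apply/ltW; exact: bnd.
have TE : k * h0 * T = e * U + k * h0 by rewrite /T; field; rewrite !lt0r_neq0.
move: hT; rewrite TE; have : 0 < k * h0 by rewrite mulr_gt0.
lra.
Qed.
End instability.
End cooperative_flow.

(** * The pitchfork *)

Section pitchfork_bifurcation.
Variables (R : realType) (n : nat) (A : 'M[R]_n) (d : 'I_n -> R) (psi : 'I_n -> R -> R).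
Variables (u : 'I_n -> R) (mu : R) (f : R -> 'rV[R]_n -> 'rV[R]_n).
Hypotheses (n_ge2 : (2 <= n)%N)
  (A_ge0 : forall i j, 0 <= A i j) (A_sym : A^T = A) (A_irr : irreducible_mx A)
  (d_gt0 : forall i, 0 < d i)
  (psi_smooth : forall i k (s : R), derivable (psi i)^`(k)%classic s 1)
  (psi_sat : forall i, saturating (psi i))
  (u_gt0 : forall i, 0 < u i) (u_eig : forall i, \sum_j A i j * u j = mu * d i * u i)
  (fE : forall p x i, f p x 0 i = - d i * x 0 i + p * \sum_j A i j * psi j (x 0 j)).

Lemma field_eq0 p x : f p x = 0 <-> equilibrium A d psi p (x 0).
Proof.
split=> [/rowP h i|h].
  by have := h i; rewrite fE !mxE mulNr addrC => /eqP; rewrite subr_eq0 => /eqP.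
by apply/rowP => i; rewrite fE !mxE mulNr h addrC subrr.
Qed.

Lemma cooperative_pitchfork : stable_pitchfork_bifurcation f (1 / mu).
Proof.
have mu0 := ground_state_eigenvalue_gt0 n_ge2 A_ge0 A_irr d_gt0 u_gt0 u_eig.
set p1 := 1 / mu; have p10 : 0 < p1 by rewrite /p1 divr_gt0.
have p1mu : p1 * mu = 1 by rewrite /p1 divfK// lt0r_neq0.
have [e1 e10 hsign] := equilibrium_sign n_ge2 A_ge0 A_sym A_irr d_gt0 psi_smooth psi_sat u_gt0 u_eig.
have /choice[xa hxa] : forall p, exists x : 'rV[R]_n, p1 < p ->
    equilibrium A d psi p (x 0) /\ forall i, 0 < x 0 i.
  move=> p; have [pp|npp] := pselect (p1 < p); last by exists 0.
  have p0 : 0 < p by exact: lt_trans pp.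
  have pmu : 1 < p * mu by rewrite -p1mu ltr_pM2r.
  have [x xE x0] := positive_equilibrium_exists n_ge2 A_ge0 A_irr d_gt0 psi_smooth psi_sat u_gt0 u_eig p0 pmu.
  by exists (\row_i x i) => _; split=> [i|i]; rewrite ?mxE// xE; congr (_ * _); apply: eq_bigr => j _; rewrite mxE.
pose xb p := - xa p.
have hxb p : p1 < p -> equilibrium A d psi p (xb p 0).
  move=> /hxa[xE _]; have := equilibriumN psi_sat xE.
  by move=> h i; have := h i; rewrite mxE => ->; congr (_ * _); apply: eq_bigr => j _; rewrite mxE.
pose i0 := Ordinal (ltnW n_ge2).
have small : xa p @[p --> p1^'+] --> (0 : 'rV[R]_n).
  apply/cvgrPdist_le => e e0.
  have [e2 e20 hsmall] := positive_equilibrium_small A_sym d_gt0 psi_smooth psi_sat u_gt0 u_eig e0.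
  near=> p; have pp : p1 < p by near: p; exact: nbhs_right_gt.
  have pe : p < p1 + e2 / mu by near: p; apply: nbhs_right_lt; rewrite ltrDl divr_gt0.
  have [xE x0] := hxa p pp.
  rewrite sub0r normrN; apply: row_norm_le => [|i]; first exact: ltW.
  rewrite gtr0_norm//; apply/ltW; apply: (hsmall p _ _ _ xE x0); first exact: lt_trans pp.
  by rewrite -p1mu -ltrBlDl -mulrBl -ltr_pdivlMr// ltrBlDl.
(* The classification of equilibria holds in the whole space. The bound [p1] keeps p positive, and
   [e1 / mu] ensures p mu < 1 + e1. *)
exists setT, (Num.min p1 (e1 / mu)), xa, xb; split.
- by split; [split; [exact: openT|]|rewrite lt_min p10 divr_gt0].
- move=> p /andP[pl pr] x _; rewrite field_eq0; split=> [xE|-> i]; last first.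
    rewrite mxE mulr0 big1 ?mulr0// => j _; by rewrite mxE (sat0 (psi_sat j)) mulr0.
  have p0 : 0 < p.
    by apply: le_lt_trans pl; rewrite subr_ge0 ge_min lexx.
  apply/rowP => i; rewrite mxE.
  apply: (equilibrium_subcritical A_ge0 A_sym d_gt0 psi_smooth psi_sat u_gt0 u_eig p0 _ xE).
  by rewrite -p1mu ler_pM2r.
- move=> p /andP[pl pr].
  have p0 : 0 < p by apply: le_lt_trans pl; rewrite subr_ge0 ge_min lexx.
  (* At the origin all derivatives of psi equal 1, and u itself is a strict supersolution because p
     mu < 1. *)
  apply: (hyperbolic_asymptotically_stable A_ge0 A_sym p0 psi_smooth psi_sat (fE p) _ u_gt0).
    apply/field_eq0 => i; rewrite mxE mulr0 big1 ?mulr0// => j _.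
    by rewrite mxE (sat0 (psi_sat j)) mulr0.
  move=> i; rewrite mxE (sat_deriv0 (psi_sat i)) divr1 u_eig !mulrA -mulrA.
  rewrite gtr_pMl ?mulr_gt0//; by rewrite -p1mu ltr_pM2r.
- move=> p /andP[pl pr].
  have p0 : 0 < p by exact: lt_trans pl.
  have pmu : 1 < p * mu by rewrite -p1mu ltr_pM2r.
  have [xE x0] := hxa p pl.
  have xa0 : xa p != 0.
    by apply/eqP => /rowP/(_ i0); rewrite mxE => h; have := x0 i0; rewrite h ltxx.
  split.
  + split=> //; first by rewrite /xb oppr_eq0.
    apply/eqP => /rowP/(_ i0); rewrite mxE => h; have := x0 i0; lra.
  + move=> x _; rewrite field_eq0; split=> [xxE|[->|->|->]].
    * have pe : p * mu < 1 + e1.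
        rewrite -p1mu -ltrBlDl -mulrBl -ltr_pdivlMr// ltrBlDl.
        by apply: (lt_le_trans pr); rewrite lerD2l ge_min lexx orbT.
      have [h|h|h] := hsign p (x 0) p0 pe xxE.
      - by constructor 1; apply/rowP => i; rewrite h mxE.
      - constructor 2; apply/rowP => i.
        exact: (positive_equilibrium_unique n_ge2 A_ge0 A_irr psi_smooth psi_sat p0 xxE xE h x0).
      - constructor 3; apply/rowP => i; rewrite mxE -[LHS]opprK; congr (- _).
        have h' j : 0 < - x 0 j by rewrite oppr_gt0.
        exact: (positive_equilibrium_unique n_ge2 A_ge0 A_irr psi_smooth psi_sat p0 (equilibriumN psi_sat xxE) xE h' x0).
    * by move=> i; rewrite mxE mulr0 big1 ?mulr0// => j _; rewrite mxE (sat0 (psi_sat j)) mulr0.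
    * by [].
    * exact: hxb.
  + exact: (supercritical_unstable A_ge0 p0 d_gt0 psi_smooth psi_sat (fE p) (ltnW n_ge2) A_sym u_gt0 u_eig pmu).
  + apply: (hyperbolic_asymptotically_stable A_ge0 A_sym p0 psi_smooth psi_sat (fE p) _
      (z := fun i => psi i (xa p 0 i))) => [|i|]; first exact/field_eq0.
      by rewrite (sat_gt0 (@psi_smooth i)).
    exact: (positive_equilibrium_hyperbolic d_gt0 psi_smooth psi_sat xE x0).
  (* psi' is even, so the linearizations at xa and - xa coincide and the same z serves for both. *)
  + apply: (hyperbolic_asymptotically_stable A_ge0 A_sym p0 psi_smooth psi_sat (fE p) _
      (z := fun i => psi i (xa p 0 i))) => [|i|i]; first exact/field_eq0/hxb.
      by rewrite (sat_gt0 (@psi_smooth i)).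
    rewrite mxE (sat_derivN (@psi_smooth i)) //.
    exact: (positive_equilibrium_hyperbolic d_gt0 psi_smooth psi_sat xE x0).
- split=> //; rewrite -oppr0; exact: cvgN.
Unshelve. all: by end_near. Qed.
End pitchfork_bifurcation.

(** * Calculus of C^k functions *)

Section Ck_calculus.
Variable R : realType.
Implicit Types V W : normedModType R.

Lemma near_eq_differentiable V W (f g : V -> W) (x : V) :
  (\near x, f x = g x) -> differentiable f x -> differentiable g x.
Proof.
move=> fg df; have [d d0 hd] := near_eps fg.
have fgx : f x = g x by have := hd 0; rewrite normr0 addr0; apply.
have [] // := @eps_differentiable _ _ _ g x ('d f x) (diff_continuous df) _.
move=> e e0; have [a a0 ha] := differentiable_eps df e0.
exists (Num.min a d) => [|h]; first by rewrite lt_min a0.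
by rewrite lt_min => /andP[h1 h2]; rewrite -fgx -hd//; exact: ha.
Qed.

(** Openness of U makes the equality hold near each point, so that it passes to derivatives. The
    closure rules below rely on this to replace a derivative by its formula. *)
Lemma Ck_on_eq V W k (U : set V) (f g : V -> W) : open U ->
  (forall x, U x -> f x = g x) -> Ck_on k U f -> Ck_on k U g.
Proof.
move=> oU; have nU x : U x -> \near x, U x by move=> Ux; exact: open_nbhs_nbhs.
elim: k f g => [|k IH] f g fg.
  move=> cf x Ux; have [cfx fgx] := (cf x Ux, fg x Ux).
  move: cfx; rewrite /prop_for /continuous_at -fgx; apply: cvg_trans; apply: near_eq_cvg.
  by apply: filterS (nU x Ux) => y; exact: fg.
have nfg x : U x -> \near x, f x = g x by move=> Ux; apply: filterS (nU x Ux) => y; exact: fg.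
move=> [df ddf]; split=> [x Ux|v]; first exact: near_eq_differentiable (nfg x Ux) (df x Ux).
apply: (IH (fun x => 'D_v f x)); last exact: ddf.
by move=> x Ux; exact: near_eq_derive (nfg x Ux).
Qed.

Lemma Ck_on_sub V W k (U U' : set V) (f : V -> W) : U' `<=` U -> Ck_on k U f -> Ck_on k U' f.
Proof.
move=> UU; elim: k f => [|k IH] f; first by move=> cf x /UU; exact: cf.
by move=> [df ddf]; split=> [x /UU Ux|v]; [exact: df|exact: (IH _ (ddf v))].
Qed.

Lemma Ck_on_pred V W k (U : set V) (f : V -> W) : Ck_on k.+1 U f -> Ck_on k U f.
Proof.
elim: k f => [|k IH] f [df ddf]; first by move=> x /df/differentiable_continuous.
by split=> // v; exact: IH.
Qed.

Lemma Ck_on_cst V W k (U : set V) (c : W) : Ck_on k U (cst c : V -> W).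
Proof.
elim: k c => [|k IH] c /=; first by move=> x _; exact: cvg_cst.
split=> [x _|v]; first exact: differentiable_cst.
have -> : (fun x : V => 'D_v (cst c) x) = cst 0 by apply/funext => x; rewrite derive_cst.
exact: IH.
Qed.

Lemma Ck_on_linear V W k (U : set V) (l : {linear V -> W}) : continuous l -> Ck_on k U l.
Proof.
move=> cl; case: k => [|k]; first by move=> x _; exact: cl.
split=> [x _|v]; first exact: linear_differentiable.
have -> : (fun x => 'D_v l x) = cst (l v).
  apply/funext => x; rewrite deriveE; first by rewrite diff_lin.
  exact: linear_differentiable.
exact: Ck_on_cst.
Qed.

Lemma Ck_on_add V W k (U : set V) (f g : V -> W) : open U ->
  Ck_on k U f -> Ck_on k U g -> Ck_on k U (fun x => f x + g x).
Proof.
move=> oU; elim: k f g => [|k IH] f g.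
  by move=> cf cg x Ux; apply: continuousD; [exact: cf|exact: cg].
move=> [df ddf] [dg ddg]; split=> [x Ux|v].
  by apply: differentiableD; [exact: df|exact: dg].
apply: (Ck_on_eq oU _ (IH _ _ (ddf v) (ddg v))) => x Ux.
by rewrite -deriveD//; apply: diff_derivable; [exact: df|exact: dg].
Qed.

Lemma Ck_on_mul V k (U : set V) (f g : V -> R) : open U ->
  Ck_on k U f -> Ck_on k U g -> Ck_on k U (fun x => f x * g x).
Proof.
move=> oU; elim: k f g => [|k IH] f g.
  by move=> cf cg x Ux; apply: continuousM; [exact: cf|exact: cg].
move=> Cf Cg; have [[df ddf] [dg ddg]] := (Cf, Cg); split=> [x Ux|v].
  by apply: differentiableM; [exact: df|exact: dg].
have C : Ck_on k U (fun x => f x * 'D_v g x + g x * 'D_v f x).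
  exact: (Ck_on_add oU (IH _ _ (Ck_on_pred Cf) (ddg v)) (IH _ _ (Ck_on_pred Cg) (ddf v))).
apply: (Ck_on_eq oU _ C) => x Ux.
by rewrite (deriveM (diff_derivable (df x Ux)) (diff_derivable (dg x Ux))).
Qed.

Lemma Ck_on_lin V W (W' : normedModType R) k (U : set V) (l : {linear W -> W'}) (f : V -> W) :
  open U -> continuous l -> Ck_on k U f -> Ck_on k U (fun x => l (f x)).
Proof.
move=> oU cl; elim: k f => [|k IH] f.
  by move=> cf x Ux; apply: continuous_comp; [exact: cf|exact: cl].
move=> [df ddf]; have dl y : differentiable l y by exact: linear_differentiable.
have dlf x : U x -> differentiable (l \o f) x.
  by move=> Ux; apply: differentiable_comp; [exact: df|exact: dl].
split=> [x Ux|v]; first exact: dlf.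
apply: (Ck_on_eq oU _ (IH _ (ddf v))) => x Ux.
rewrite -[RHS]/('D_v (l \o f) x) !deriveE//; [|exact: dlf|exact: df].
by rewrite (diff_comp (df x Ux) (dl _))/= diff_lin.
Qed.

(** For an affine inner map the derivative along v is the derivative of f along l v, composed with
    the same map, so the induction needs no product rule. *)
Lemma Ck_on_precomp V (V' : normedModType R) W k (U : set V) (l : {linear V' -> V}) (c : V) (f : V -> W) :
  open U -> continuous l -> Ck_on k U f ->
  Ck_on k (fun z => U (l z + c)) (fun z => f (l z + c)).
Proof.
move=> oU cl; pose L z := l z + c.
have dl y : differentiable l y by exact: linear_differentiable.
have dL y : differentiable L y by apply: differentiableD; [exact: dl|exact: differentiable_cst].
have oU' : open (L @^-1` U).
  apply: open_comp => // x _; exact: differentiable_continuous.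
elim: k f => [|k IH] f.
  move=> cf x Ux; apply: (@continuous_comp _ _ _ L f); last exact: cf.
  exact: differentiable_continuous.
move=> [df ddf].
have dlf x : U (L x) -> differentiable (f \o L) x.
  by move=> Ux; apply: differentiable_comp; [exact: dL|exact: df].
split=> [x Ux|v]; first exact: dlf.
apply: (Ck_on_eq oU' _ (IH _ (ddf (l v)))) => x Ux.
rewrite -[RHS]/('D_v (f \o L) x) !deriveE//; [|exact: dlf|exact: df].
rewrite (diff_comp (dL x) (df _ Ux))/=.
by congr ('d f _ _); rewrite /L diffD// diff_cst diff_lin//= addr0.
Qed.

Lemma Ck_on_scale V k (U : set V) (f : V -> R) (c : R) : open U ->
  Ck_on k U f -> Ck_on k U (fun x => c * f x).
Proof. by move=> oU Cf; apply: Ck_on_mul => //; exact: Ck_on_cst. Qed.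

Lemma Ck_on_sum V k (U : set V) (I : Type) (r : seq I) (F : I -> V -> R) : open U ->
  (forall i, Ck_on k U (F i)) -> Ck_on k U (fun x => \sum_(i <- r) F i x).
Proof.
move=> oU CF; elim: r => [|i r IH].
  by apply: (Ck_on_eq oU _ (Ck_on_cst k U 0)) => x _; rewrite big_nil.
by apply: (Ck_on_eq oU _ (Ck_on_add oU (CF i) IH)) => x _; rewrite big_cons.
Qed.

Lemma Ck_on_comp V k (U : set V) (phi : R -> R) (f : V -> R) : open U ->
  (forall m s, derivable phi^`(m)%classic s 1) ->
  Ck_on k U f -> Ck_on k U (fun x => phi (f x)).
Proof.
move=> oU; elim: k phi f => [|k IH] phi f sphi.
  move=> cf x Ux; apply: continuous_comp; first exact: cf.
  by apply: differentiable_continuous; apply/derivable1_diffP; exact: (sphi 0%N).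
move=> Cf; have [df ddf] := Cf.
have dphi y : differentiable phi y by apply/derivable1_diffP; exact: (sphi 0%N).
have dpf x : U x -> differentiable (phi \o f) x.
  by move=> Ux; apply: differentiable_comp; [exact: df|exact: dphi].
split=> [x Ux|v]; first exact: dpf.
have C : Ck_on k U (fun x => phi^`()%classic (f x) * 'D_v f x).
  apply: (Ck_on_mul oU _ (ddf v)); apply: IH; last exact: Ck_on_pred.
  by move=> m s; rewrite -derive1Sn; exact: sphi.
apply: (Ck_on_eq oU _ C) => x Ux.
rewrite -[RHS]/('D_v (phi \o f) x) (deriveE _ (dpf x Ux)).
rewrite (diff_comp (df x Ux) (dphi _)).
rewrite /= -(deriveE _ (df x Ux)).
by rewrite diff1E// mulrC.
Qed.

Lemma is_derive_invsqrt (s : R) : 0 < s ->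
  is_derive s 1 (fun x => (Num.sqrt x)^-1) (- (1 / 2) * (Num.sqrt s)^-1 ^+ 3).
Proof.
move=> s0; have q0 : Num.sqrt s != 0 by rewrite gt_eqF// sqrtr_gt0.
have h := is_derive1_sqrt s0.
apply: (is_derive_eq (is_deriveV q0 h)).
by rewrite /GRing.scale/=; field.
Qed.

(** The derivative of s^(-1/2) is - 1/2 times its own cube, so the induction closes on this single
    function. *)
Lemma Ck_on_invsqrt V k (U : set V) (f : V -> R) : open U ->
  (forall x, U x -> 0 < f x) -> Ck_on k U f -> Ck_on k U (fun x => (Num.sqrt (f x))^-1).
Proof.
move=> oU f0; pose phi (s : R) : R := (Num.sqrt s)^-1.
have dphi (y : R) : 0 < y -> differentiable (phi : R -> R) y.
  by move=> y0; apply/derivable1_diffP; have [] := is_derive_invsqrt y0.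
elim: k => [|k IH].
  move=> cf x Ux; apply: (@continuous_comp _ _ _ f phi); first exact: cf.
  by apply: differentiable_continuous; apply: dphi; exact: f0.
move=> Cf; have [df ddf] := Cf.
have dpf x : U x -> differentiable (phi \o f) x.
  by move=> Ux; apply: differentiable_comp; [exact: df|exact/dphi/f0].
split=> [x Ux|v]; first exact: dpf.
have C0 := IH (Ck_on_pred Cf).
have C : Ck_on k U (fun x => - (1 / 2) * (phi (f x) * (phi (f x) * phi (f x))) * 'D_v f x).
  apply: (Ck_on_mul oU _ (ddf v)); apply: Ck_on_scale => //.
  exact: (Ck_on_mul oU C0 (Ck_on_mul oU C0 C0)).
apply: (Ck_on_eq oU _ C) => x Ux.
rewrite -[RHS]/('D_v (phi \o f) x) (deriveE _ (dpf x Ux)).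
rewrite (diff_comp (df x Ux) (dphi _ (f0 x Ux))).
rewrite /= -(deriveE _ (df x Ux)).
rewrite diff1E; last exact/dphi/f0.
rewrite derive1E; have [_ ->] := is_derive_invsqrt (f0 x Ux).
by rewrite /GRing.scale/= mulrC -/(phi _) !exprS expr0 mulr1.
Qed.

Lemma Ck_on_fst V W (W' : normedModType R) k (U : set V) (f : V -> W * W') : open U ->
  Ck_on k U f -> Ck_on k U (fun x => (f x).1).
Proof. by move=> oU; apply: (Ck_on_lin (l := fst) oU) => z; exact: cvg_fst. Qed.

Lemma Ck_on_snd V W (W' : normedModType R) k (U : set V) (f : V -> W * W') : open U ->
  Ck_on k U f -> Ck_on k U (fun x => (f x).2).
Proof. by move=> oU; apply: (Ck_on_lin (l := snd) oU) => z; exact: cvg_snd. Qed.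

Lemma Ck_on_id V k (U : set V) : Ck_on k U (fun x : V => x).
Proof. by apply: (Ck_on_linear _ _ (l := idfun)) => z; exact: cvg_id. Qed.

Lemma smooth_near_precomp V (V' : normedModType R) W (l : {linear V' -> V}) (f : V -> W) (z : V') :
  continuous l -> smooth_near f (l z) -> smooth_near (fun x => f (l x)) z.
Proof.
move=> cl [U [[oU Uz] CU]]; exists (l @^-1` U); split.
  by split=> //; apply: open_comp => // x _; exact: cl.
move=> k; have := Ck_on_precomp 0 oU cl (CU k).
have -> : (fun x => U (l x + 0)) = l @^-1` U by apply/funext => x; rewrite addr0.
by have -> : (fun x => f (l x + 0)) = (fun x => f (l x)) by apply/funext => x; rewrite addr0.
Qed.

Lemma Ck_on_coord V k (U : set V) m n (f : V -> 'M[R]_(m, n)) i j : open U ->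
  Ck_on k U f -> Ck_on k U (fun x => f x i j).
Proof.
move=> oU; pose l (x : 'M[R]_(m, n)) : R := x i j.
have lin_l : linear l by move=> c x y; rewrite /l !mxE.
pose lM := GRing.isLinear.Build _ _ _ _ _ lin_l.
pose lL : {linear 'M[R]_(m, n) -> R} := HB.pack l lM.
have cl : continuous lL by exact: coord_continuous.
exact: (Ck_on_lin oU cl).
Qed.
End Ck_calculus.

(** * Hadamard's lemma *)

Section unit_integral.
Variable R : realType.
Implicit Types h H : R -> R.

Definition int01 h : R := \int[lebesgue_measure]_(t in `[0, 1]) h t.

Definition continuous01 h := forall t : R, 0 <= t <= 1 -> {for t, continuous h}.

Lemma int01_FTC h H : continuous01 h ->
  (forall t : R, 0 <= t <= 1 -> is_derive t 1 H (h t)) -> int01 h = H 1 - H 0.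
Proof.
move=> ch DH; rewrite /int01 /Rintegral.
have cH t : 0 <= t <= 1 -> {for t, continuous H}.
  by move=> /DH[/derivable1_diffP/differentiable_continuous].
have h0 : 0 <= (0 : R) <= 1 by rewrite lexx ler01.
have h1 : 0 <= (1 : R) <= 1 by rewrite lexx ler01.
rewrite (@continuous_FTC2 _ h H 0 1) ?ltr01//.
- by apply: continuous_in_subspaceT => t; rewrite inE/= in_itv/=; exact: ch.
- split.
  + by move=> t /andP[t0 t1]; have [] // := DH t _; rewrite !ltW.
  + exact: cvg_at_right_filter (cH _ h0).
  + exact: cvg_at_left_filter (cH _ h1).
- move=> t /andP[t0 t1]; rewrite derive1E; have t01 : 0 <= t <= 1 by rewrite !ltW.
  by have [_] := DH t t01.
Qed.

(** Linearity and the norm bound of [int01] are derived from primitives, as statements about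
    derivatives on [0, 1]. *)
Lemma int01_primitive h : continuous01 h ->
  exists2 H : R -> R, forall t : R, 0 <= t <= 1 -> is_derive t 1 H (h t) & int01 h = H 1 - H 0.
Proof.
move=> ch; have [H DH] := antiderivative_itv ler01 ch.
by exists H => //; exact: int01_FTC.
Qed.

Lemma int01_lin h1 h2 (a b : R) : continuous01 h1 -> continuous01 h2 ->
  int01 (fun t => a * h1 t + b * h2 t) = a * int01 h1 + b * int01 h2.
Proof.
move=> c1 c2; have [H1 D1 ->] := int01_primitive c1; have [H2 D2 ->] := int01_primitive c2.
have c12 : continuous01 (fun t => a * h1 t + b * h2 t).
  move=> t t01; apply: cvgD.
    exact: (cvgM (cvg_cst a) (c1 t t01)).
  exact: (cvgM (cvg_cst b) (c2 t t01)).
have D12 (t : R) : 0 <= t <= 1 -> is_derive t 1 (fun t => a * H1 t + b * H2 t) (a * h1 t + b * h2 t).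
  by move=> t01; apply: is_derive_add; apply: is_derive_scale; [exact: D1|exact: D2].
by rewrite (int01_FTC c12 D12); ring.
Qed.

Lemma int01_norm_le h (B : R) : continuous01 h ->
  (forall t : R, 0 <= t <= 1 -> `|h t| <= B) -> `|int01 h| <= B.
Proof.
move=> ch hB; have [H DH ->] := int01_primitive ch.
have DB (x : R) : 0 <= x <= 1 -> is_derive x 1 (fun t => B * t) (B * 1).
  by move=> _; apply: is_derive_scale; exact: is_derive_id.
have := norm_le_of_derive ler01 DH DB; rewrite mulr1 mulr0 subr0; apply.
by move=> x /andP[x0 x1]; rewrite hB// !ltW.
Qed.
End unit_integral.

Lemma is_derive_line (R : realType) (V W : normedModType R) (f : V -> W) (a b : V) (s : R) :
  differentiable f (a + s *: b) ->
  is_derive s 1 (fun s => f (a + s *: b)) ('d f (a + s *: b) b).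
Proof.
move=> df; apply: eps_is_derive => e e0.
have b1 : 0 < `|b| + 1 by rewrite ltr_wpDl.
have [dl dl0 hdl] := differentiable_eps df (divr_gt0 e0 b1).
exists (dl / (`|b| + 1)) => [|k kd]; first by rewrite divr_gt0.
have kb : `|k *: b| < dl.
  rewrite normrZ; apply: (@le_lt_trans _ _ (`|k| * (`|b| + 1))); first by rewrite ler_wpM2l// lerDl.
  by rewrite -ltr_pdivlMr.
have -> : a + (s + k) *: b = a + s *: b + k *: b by rewrite scalerDl addrA.
have := hdl _ kb; rewrite linearZ/= => /le_trans; apply.
rewrite normrZ -mulrA ler_pM2l// mulrC ler_pdivrMr// ler_wpM2l// lerDl.
exact: ler01.
Qed.

Section hadamard.
Variables (R : realType) (p1 r : R).
Local Notation R2 := ((R * R)%type).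
Let B : set R2 := ball ((0, p1) : R2) r.

Let openB : open B.
Proof. exact: ball_open. Qed.

Let BE (z : R2) : B z <-> `|z.1| < r /\ `|z.2 - p1| < r.
Proof.
rewrite /B -ball_normE /ball_/= prod_normE/= sub0r normrN (distrC p1) gt_max.
by split=> [/andP|/andP].
Qed.

Let shrink (t : R) (z : R2) : R2 := (t * z.1, z.2).

Let shrinkB t z : 0 <= t <= 1 -> B z -> B (shrink t z).
Proof.
move=> /andP[t0 t1] /BE[z1 z2]; apply/BE; split=> //=.
by apply: le_lt_trans z1; rewrite normrM (ger0_norm t0) ler_piMl.
Qed.

Lemma continuous_shrink : continuous (fun tz : R * R2 => shrink tz.1 tz.2).
Proof.
move=> [t z].
have c1 : continuous (fun tz : R * R2 => tz.1) by move=> x; exact: cvg_fst.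
have c2 : continuous (fun tz : R * R2 => tz.2.1).
  by move=> x; apply: (@continuous_comp _ _ _ (fun tz : R * R2 => tz.2) fst);
    [exact: cvg_snd|exact: cvg_fst].
have c3 : continuous (fun tz : R * R2 => tz.2.2).
  by move=> x; apply: (@continuous_comp _ _ _ (fun tz : R * R2 => tz.2) snd); exact: cvg_snd.
exact: (cvg_pair (cvgM (c1 _) (c2 _)) (c3 _)).
Qed.

(** Compactness of [0, 1] gives a radius independent of t, as required for differentiating under the
    integral sign. *)
Lemma shrink_uniform (phi : R2 -> R) (z : R2) (e : R) :
  (forall w, B w -> {for w, continuous phi}) -> B z -> 0 < e ->
  exists2 dl : R, 0 < dl & forall (t : R) (h : R2), 0 <= t <= 1 -> `|h| < dl ->
    B (z + h) /\ `|phi (shrink t (z + h)) - phi (shrink t z)| < e.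
Proof.
move=> cphi Bz e0.
have /compact_near_coveringP nc := @segment_compact R 0 1.
have [d1 d10 hd1] : exists2 d : R, 0 < d & forall h, `|h| < d -> B (z + h).
  by apply: near_eps; exact: open_nbhs_nbhs.
have H := nc R2 (nbhs (0 : R2)) (fun h t => `|phi (shrink t (z + h)) - phi (shrink t z)| < e) _ _.
have /near_eps[d2 d20 hd2] : \forall h \near (0 : R2), `[(0 : R), 1]%classic `<=` (fun t => `|phi (shrink t (z + h)) - phi (shrink t z)| < e).
  apply: H => t0; rewrite /= in_itv/= => t01.
  have Bw : B (shrink t0 z) by exact: shrinkB.
  have e2 : 0 < e / 2 by rewrite divr_gt0.
  have c1 : {for (t0, (0 : R2)), continuous (fun th : R * R2 => phi (shrink th.1 (z + th.2)))}.
    apply: (@continuous_comp _ _ _ (fun th : R * R2 => shrink th.1 (z + th.2)) phi).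
      apply: (@continuous_comp _ _ _ (fun th : R * R2 => (th.1, z + th.2)) (fun tz => shrink tz.1 tz.2)).
        have c0 : continuous (fun th : R * R2 => th.1) by move=> x; exact: cvg_fst.
        have c0' : continuous (fun th : R * R2 => th.2) by move=> x; exact: cvg_snd.
        exact: (cvg_pair (c0 (t0, (0 : R2))) (cvgD (cvg_cst z) (c0' (t0, (0 : R2))))).
      exact: continuous_shrink.
    by rewrite /= addr0; exact: cphi.
  have [a a0 ha] := continuous_eps c1 e2.
  exists (ball t0 a, ball (0 : R2) a) => /=.
    by split; exact: nbhsx_ballx.
  move=> [t h] /= [ta ha'].
  have tta : `|t - t0| < a by move: ta; rewrite -ball_normE /ball_/= distrC.
  have hha : `|h| < a by move: ha'; rewrite -ball_normE /ball_/= sub0r normrN.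
  have E1 := ha (t - t0, h); rewrite /= !subrKC !add0r addr0 in E1.
  have E2 := ha (t - t0, 0); rewrite /= !subrKC !addr0 in E2.
  have {}E1 := E1 _; have {}E2 := E2 _.
  (* Both values are compared with the one at (t0, z), since t varies along with h. *)
  have -> : phi (shrink t (z + h)) - phi (shrink t z) =
    (phi (shrink t (z + h)) - phi (shrink t0 z)) - (phi (shrink t z) - phi (shrink t0 z)) by ring.
  apply: (le_lt_trans (ler_normB _ _)); rewrite (splitr e) ltrD//.
    by apply: E1; rewrite prod_normE/= gt_max tta.
  by apply: E2; rewrite prod_normE/= gt_max tta normr0.
exists (Num.min d1 d2) => [|t h t01]; first by rewrite lt_min d10.
rewrite lt_min => /andP[h1 h2]; split; first exact: hd1.
have := hd2 h h2; rewrite add0r => /(_ t); apply.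
by rewrite /= in_itv.
Qed.
(* [moment 0] of the y-derivative of f is the Hadamard quotient (f(y, p) - f(0, p)) / y; its partial
   derivatives are again moments, which gives smoothness by induction. *)
Definition moment (m : nat) (f : R2 -> R) (z : R2) : R :=
  int01 (fun t => t ^+ m * f (shrink t z)).

Let fy (f : R2 -> R) (z : R2) : R := 'D_((1, 0) : R2) f z.
Let fp (f : R2 -> R) (z : R2) : R := 'D_((0, 1) : R2) f z.

Let continuous01_moment m (f : R2 -> R) z : (forall w, B w -> {for w, continuous f}) -> B z ->
  continuous01 (fun t => t ^+ m * f (shrink t z)).
Proof.
move=> cf Bz t t01; apply: cvgM; first exact: exprn_continuous.
have c1 : {for t, continuous (fun t => shrink t z)}.
  exact: (cvg_pair (cvgM (@cvg_id _ (nbhs t)) (cvg_cst z.1)) (cvg_cst z.2)).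
apply: (@continuous_comp _ _ _ (fun t => shrink t z) f); [exact: c1|exact/cf/shrinkB].
Qed.

Let diff_partials (f : R2 -> R) w v : differentiable f w -> 'd f w v = v.1 * fy f w + v.2 * fp f w.
Proof.
move=> df; rewrite /fy /fp !deriveE//.
have {1}-> : v = v.1 *: ((1, 0) : R2) + v.2 *: ((0, 1) : R2).
  by case: v => a b; congr (_, _); rewrite /= /GRing.scale/= ?mulr1 ?mulr0 ?addr0 ?add0r.
by rewrite linearD !linearZ.
Qed.

(** Differentiation under the integral: the mean value theorem between [shrink t z] and
    [shrink t (z + h)], with uniform control of both partial derivatives. The chain rule in y yields
    a factor t, hence the moment [m.+1]. *)
Lemma moment_differentiable m (f : R2 -> R) : (forall w, B w -> differentiable f w) ->
  (forall w, B w -> {for w, continuous (fy f)}) -> (forall w, B w -> {for w, continuous (fp f)}) ->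
  forall z, B z -> differentiable (moment m f) z /\
    forall v : R2, 'D_v (moment m f) z = v.1 * moment m.+1 (fy f) z + v.2 * moment m (fp f) z.
Proof.
move=> df cfy cfp z Bz.
have cf w : B w -> {for w, continuous f} by move=> /df; exact: differentiable_continuous.
pose a := moment m.+1 (fy f) z; pose b := moment m (fp f) z.
pose L (v : R2) : R := v.1 * a + v.2 * b.
have lin_L : linear L by move=> k v w; rewrite /L /= /GRing.scale/=; ring.
pose LM := GRing.isLinear.Build _ _ _ _ _ lin_L.
pose LL : {linear R2 -> R} := HB.pack L LM.
have cL : continuous LL.
  move=> v; have c1 : continuous (fun v : R2 => v.1) by move=> x; exact: cvg_fst.
  have c2 : continuous (fun v : R2 => v.2) by move=> x; exact: cvg_snd.
  exact: (cvgD (cvgM (c1 v) (cvg_cst a)) (cvgM (c2 v) (cvg_cst b))).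
have [|dm dmE] := @eps_differentiable _ _ _ (moment m f) z LL cL; last first.
  by split=> // v; rewrite deriveE// dmE.
move=> e e0; have e2 : 0 < e / 2 by rewrite divr_gt0.
have [d1 d10 hd1] := shrink_uniform cfy Bz e2.
have [d2 d20 hd2] := shrink_uniform cfp Bz e2.
exists (Num.min d1 d2) => [|h]; first by rewrite lt_min d10.
rewrite lt_min => /andP[hh1 hh2].
have t00 : 0 <= (0 : R) <= 1 by rewrite lexx ler01.
have [Bzh _] := hd1 0 h t00 hh1.
have cz := @continuous01_moment m f z cf Bz.
have czh := @continuous01_moment m f (z + h) cf Bzh.
have ca := @continuous01_moment m.+1 (fy f) z cfy Bz.
have cb := @continuous01_moment m (fp f) z cfp Bz.
pose D t := 1 * (t ^+ m * f (shrink t (z + h))) + -1 * (t ^+ m * f (shrink t z)).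
pose C t := h.1 * (t ^+ m.+1 * fy f (shrink t z)) + h.2 * (t ^+ m * fp f (shrink t z)).
have c_lin (k l : R) (h1 h2 : R -> R) : continuous01 h1 -> continuous01 h2 ->
    continuous01 (fun t => k * h1 t + l * h2 t).
  move=> c1 c2 t t01; apply: cvgD; [exact: (cvgM (cvg_cst k) (c1 t t01))|exact: (cvgM (cvg_cst l) (c2 t t01))].
have cD : continuous01 D by exact: c_lin.
have cC : continuous01 C by exact: c_lin.
have -> : moment m f (z + h) - moment m f z - LL h = int01 (fun t => 1 * D t + -1 * C t).
  have ED : int01 D = 1 * moment m f (z + h) + -1 * moment m f z by exact: int01_lin.
  have EC : int01 C = h.1 * a + h.2 * b by exact: int01_lin.
  have -> : LL h = h.1 * a + h.2 * b by [].
  by rewrite int01_lin// ED EC !mul1r !mulN1r.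
apply: int01_norm_le; first exact: c_lin.
move=> t t01.
have Bseg (s : R) : 0 <= s <= 1 -> `|s *: h| <= `|h|.
  by move=> /andP[s0 s1]; rewrite normrZ (ger0_norm s0) ler_piMl.
have segE (s : R) : shrink t z + s *: shrink t h = shrink t (z + s *: h).
  by congr (_, _); rewrite /= /GRing.scale/=; ring.
have Dline (s : R) : 0 <= s <= 1 -> is_derive s 1 (fun s => f (shrink t z + s *: shrink t h))
   ('d f (shrink t z + s *: shrink t h) (shrink t h)).
  move=> s01; apply: is_derive_line; rewrite segE; apply/df/shrinkB => //.
  by have [] := hd1 0 (s *: h) t00 (le_lt_trans (Bseg s s01) hh1).
have [s /andP[s0 s1]] := derive_MVT ltr01 Dline.
have s01 : 0 <= s <= 1 by rewrite !ltW.
rewrite scale0r scale1r addr0 subr0 mulr1 => E.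
have [Bs g1] := hd1 t (s *: h) t01 (le_lt_trans (Bseg s s01) hh1).
have [_ g2] := hd2 t (s *: h) t01 (le_lt_trans (Bseg s s01) hh2).
have -> : 1 * D t + -1 * C t = t ^+ m *
   (t * h.1 * (fy f (shrink t (z + s *: h)) - fy f (shrink t z))
    + h.2 * (fp f (shrink t (z + s *: h)) - fp f (shrink t z))).
  have {}E : f (shrink t (z + h)) - f (shrink t z) =
      t * h.1 * fy f (shrink t (z + s *: h)) + h.2 * fp f (shrink t (z + s *: h)).
    rewrite -[in LHS](scale1r h) -segE scale1r E segE diff_partials//.
    exact/df/shrinkB.
  have -> : 1 * D t + -1 * C t = t ^+ m * (f (shrink t (z + h)) - f (shrink t z)) - C t.
    by rewrite /D; ring.
  by rewrite E /C exprS; ring.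
have /andP[t0 t1] := t01.
rewrite normrM (ger0_norm (exprn_ge0 m t0)).
have hn1 : `|h.1| <= `|h| by rewrite prod_normE le_max lexx.
have hn2 : `|h.2| <= `|h| by rewrite prod_normE le_max lexx orbT.
have hn1' : `|t * h.1| <= `|h|.
  by rewrite normrM (ger0_norm t0) (le_trans _ hn1)// ler_piMl.
apply: (@le_trans _ _ (1 * (e * `|h|))); last by rewrite mul1r.
apply: ler_pM => //; [exact: exprn_ge0|exact: exprn_ile1|].
apply: (le_trans (ler_normD _ _)); rewrite (splitr e) mulrDl lerD// normrM.
  by rewrite mulrC (ler_pM (normr_ge0 _) (normr_ge0 _) (ltW g1) hn1').
by rewrite mulrC (ler_pM (normr_ge0 _) (normr_ge0 _) (ltW g2) hn2).
Qed.

Lemma Ck_on_moment k m (f : R2 -> R) : (forall j, Ck_on j B f) -> Ck_on k B (moment m f).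
Proof.
elim: k m f => [|k IH] m f Cf.
  have [df Df] := Cf 1%N; move=> z Bz; apply: differentiable_continuous.
  by have [] := moment_differentiable m df (Df _) (Df _) Bz.
have [df Df] := Cf 1%N; split=> [z Bz|v].
  by have [] := moment_differentiable m df (Df _) (Df _) Bz.
have C1 : Ck_on k B (moment m.+1 (fy f)) by apply: IH => j; have [_ D] := Cf j.+1; exact: D.
have C2 : Ck_on k B (moment m (fp f)) by apply: IH => j; have [_ D] := Cf j.+1; exact: D.
apply: (Ck_on_eq openB _ (Ck_on_add openB (Ck_on_scale v.1 openB C1) (Ck_on_scale v.2 openB C2))).
by move=> z Bz; have [_ ->] := moment_differentiable m df (Df _) (Df _) Bz.
Qed.

Lemma hadamard (f : R2 -> R) : (forall k, Ck_on k B f) ->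
  exists2 h : R2 -> R, forall k, Ck_on k B h & forall z, B z -> f z = f (0, z.2) + z.1 * h z.
Proof.
move=> Cf; have [df Df] := Cf 1%N; exists (moment 0 (fy f)).
  by move=> k; apply: Ck_on_moment => j; have [_ D] := Cf j.+1; exact: D.
move=> z Bz.
(* The summand [0 * 0] gives the integrand the two-term shape of [int01_lin]. *)
have cy : continuous01 (fun t => z.1 * (t ^+ 0 * fy f (shrink t z)) + 0 * 0).
  move=> t t01; apply: cvgD; last exact: cvg_cst.
  by apply: (cvgM (cvg_cst z.1)); exact: (continuous01_moment (Df _)).
have lineE (s : R) : (0, z.2) + s *: ((z.1, 0) : R2) = shrink s z.
  by congr (_, _); rewrite /= /GRing.scale/=; ring.
have DH (s : R) : 0 <= s <= 1 -> is_derive s 1 (fun s => f ((0, z.2) + s *: ((z.1, 0) : R2)))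
    (z.1 * (s ^+ 0 * fy f (shrink s z)) + 0 * 0).
  move=> s01; have dfs : differentiable f ((0, z.2) + s *: ((z.1, 0) : R2)).
    by rewrite lineE; apply/df/shrinkB.
  apply: (is_derive_eq (is_derive_line dfs)); rewrite diff_partials// lineE /=.
  by rewrite expr0 mul1r mul0r !mulr0.
have := int01_FTC cy DH; rewrite !lineE.
have -> : int01 (fun t => z.1 * (t ^+ 0 * fy f (shrink t z)) + 0 * 0) = z.1 * moment 0 (fy f) z.
  rewrite (int01_lin z.1 0 (h2 := fun=> 0)); first by rewrite mul0r addr0.
    exact: (continuous01_moment (Df _)).
  by move=> t _; exact: cvg_cst.
move=> ->; rewrite /shrink mul0r mul1r; case: (z) => y p /=; ring.
Qed.
End hadamard.

(** * Recognition of the pitchfork *)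

(** The difference quotient at x0 is s itself, so continuity of s at x0 is enough; this is all that
    is known of the factor m. *)
Lemma is_derive_mul_id (R : realType) (s : R -> R) (x0 : R) : {for x0, continuous s} ->
  is_derive x0 1 (fun x => (x - x0) * s x) (s x0).
Proof.
move=> cs; apply: eps_is_derive => e e0; have [d d0 hd] := continuous_eps cs e0.
exists d => // h hx; rewrite subrr mul0r subr0 addrAC subrr add0r /GRing.scale/= -mulrBr normrM mulrC.
by rewrite ler_wpM2r// ltW// hd.
Qed.

Section pitchfork_recognition.
Variables (R : realType) (p1 c : R) (g : R -> R -> R) (m : R -> R).
Local Notation R2 := ((R * R)%type).
Hypotheses (g_smooth : smooth_near (fun z : R2 => g z.1 z.2) (0, p1))
  (g_odd : odd_near p1 g)
  (g_y : \forall p \near p1, is_derive (0 : R) 1 (fun y => g y p) ((p - p1) * m p))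
  (m_cont : {for p1, continuous m}) (m_gt0 : 0 < m p1)
  (g_yyy : forall e : R, 0 < e -> exists2 d, 0 < d &
    forall y : R, `|y| < d -> `|g y p1 - c * y ^+ 3| <= e * `|y| ^+ 3)
  (c_lt0 : c < 0).

Let ball_in (z : R2) (r : R) : ball ((0, p1) : R2) r z <-> `|z.1| < r /\ `|z.2 - p1| < r.
Proof.
rewrite -ball_normE /ball_/= prod_normE/= sub0r normrN (distrC p1) gt_max.
by split=> [/andP|/andP].
Qed.

Let nbhs_ball_in (P : R2 -> Prop) : (\forall z \near ((0, p1) : R2), P z) ->
  exists2 r, 0 < r & forall z, ball ((0, p1) : R2) r z -> P z.
Proof.
move=> /nbhs_ballP[r /= r0 hr]; exists r => // z; exact: hr.
Qed.

(** g is odd in y, so in the expansion g = y (h1(0, p) + y h2) the quotient h2 is odd too. It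
    vanishes at y = 0, and one more division produces y^2 h3. *)
Lemma odd_factorization : exists2 r, 0 < r & exists h1 h3 : R2 -> R,
  [/\ forall k, Ck_on k (ball ((0, p1) : R2) r) h1,
      forall k, Ck_on k (ball ((0, p1) : R2) r) h3,
      forall z, ball ((0, p1) : R2) r z -> g z.1 z.2 = z.1 * h1 z &
      forall z, ball ((0, p1) : R2) r z -> h1 z = h1 (0, z.2) + z.1 ^+ 2 * h3 z].
Proof.
have [U [[oU Uz] CU]] := g_smooth.
have [r1 r10 hr1] := nbhs_ball_in (open_nbhs_nbhs (conj oU Uz)).
have [r2 r20 hr2] := nbhs_ball_in g_odd.
pose r := Num.min r1 r2; have r0 : 0 < r by rewrite lt_min r10.
exists r => //; set B := ball _ _.
have Bsub1 z : B z -> ball ((0, p1) : R2) r1 z.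
  by move=> /ball_in[]; rewrite !lt_min => /andP[a b] /andP[a' b']; apply/ball_in.
have Bsub2 z : B z -> ball ((0, p1) : R2) r2 z.
  by move=> /ball_in[]; rewrite !lt_min => /andP[a b] /andP[a' b']; apply/ball_in.
have CB k : Ck_on k B (fun z : R2 => g z.1 z.2).
  by apply: Ck_on_sub (CU k) => z /Bsub1/hr1.
have B0 z : B z -> B (0, z.2) by move=> /ball_in[_ h]; apply/ball_in; split=> //=; rewrite normr0.
have BN z : B z -> B (- z.1, z.2) by move=> /ball_in[h h']; apply/ball_in; split=> //=; rewrite normrN.
have odd z : B z -> g (- z.1) z.2 = - g z.1 z.2 by move=> /Bsub2/hr2.
have [h1 C1 E1] := hadamard CB.
have [h2 C2 E2] := hadamard C1.
have [h3 C3 E3] := hadamard C2.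
have g0 z : B z -> g 0 z.2 = 0.
  by move=> /B0/odd/=; rewrite oppr0 => E; lra.
have gE z : B z -> g z.1 z.2 = z.1 * h1 z by move=> Bz; rewrite E1//= g0// add0r.
have h2odd z : B z -> z.1 != 0 -> h2 (- z.1, z.2) = - h2 z.
  move=> Bz z0; have z0' : z.1 ^+ 2 != 0 by rewrite sqrf_eq0.
  have := odd z Bz; have /= := gE _ (BN z Bz); rewrite gE// => -> /=.
  rewrite (E2 z)// (E2 _ (BN z Bz))/= => E.
  by apply: (mulfI z0'); lra.
(* Oddness of h2 is obtained by cancelling y^2, hence only for y nonzero; continuity yields the
   value at 0. *)
have h20 z : B z -> h2 (0, z.2) = 0.
  move=> Bz; have Bz0 := B0 z Bz; apply/eqP; rewrite -normr_le0; apply/ler_addgt0Pr => e e0.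
  have [d d0 hd] := continuous_eps (C2 0%N _ Bz0) e0.
  have [y y0 [yd yr]] : exists2 y : R, 0 < y & y < d /\ y < r.
    exists (Num.min d r / 2); first by rewrite divr_gt0// lt_min d0.
    have md : Num.min d r <= d by rewrite ge_min lexx.
    have mr : Num.min d r <= r by rewrite ge_min lexx orbT.
    have m0 : 0 < Num.min d r by rewrite lt_min d0.
    by split; lra.
  have By : B (y, z.2) by move: Bz => /ball_in[_ h]; apply/ball_in; split=> //=; rewrite gtr0_norm.
  have h := h2odd _ By (lt0r_neq0 y0); rewrite /= in h.
  have H1 := hd (y, 0); have H2 := hd (- y, 0).
  have E (a : R) : (0, z.2) + (a, 0) = (a, z.2) :> R2 by congr (_, _); rewrite /= ?add0r ?addr0.
  have N (a : R) : `|(a, 0) : R2| = `|a| by rewrite prod_normE/= normr0 max_l.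
  rewrite !E !N normrN gtr0_norm// in H1 H2.
  have := H1 yd; have := H2 yd; rewrite h.
  set a := h2 (0, z.2); set b := h2 (y, z.2) => A1 A2.
  have -> : a = - ((- b - a) + (b - a)) / 2 by field.
  rewrite normrM normrN (gtr0_norm (x := 2^-1)) ?invr_gt0// ler_pdivrMr//.
  by apply: (le_trans (ler_normD _ _)); lra.
exists h1, h3; split=> // z Bz.
by rewrite (E2 z)// (E3 z)// h20// add0r; ring.
Qed.

Lemma pitchfork_recognition :
  bifurcation_equiv p1 g (fun y p => (p - p1) * y - y ^+ 3).
Proof.
have [r r0 [h1 [h3 [C1 C3 E1 E3]]]] := odd_factorization; set B := ball _ _ in C1 C3 E1 E3.
have oB : open B by exact: ball_open.
have Bc : B (0, p1) by exact: ballxx.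
pose al p := h1 (0, p).
have Bp p : `|p - p1| < r -> B (0, p) by move=> h; apply/ball_in; split=> //=; rewrite normr0.
(* The y-derivative of y h1(y, p) at 0 is h1(0, p), which identifies [al] with the derivative in
   [g_y]. *)
have ial p : B (0, p) -> is_derive (0 : R) 1 (fun y => g y p) (al p).
  move=> B0; pose L (y : R) : R2 := (y, p).
  have cL : {for (0 : R), continuous (h1 \o L)}.
    apply: (@continuous_comp _ _ _ L h1); last exact: (C1 0%N _ B0).
    exact: (cvg_pair (@cvg_id _ (nbhs (0 : R))) (cvg_cst p)).
  have := is_derive_mul_id cL; apply: near_eq_is_derive.
  have /near_eps[d d0 hd] : \forall z \near ((0, p) : R2), B z by exact: open_nbhs_nbhs.
  apply/nbhs_normP; exists d => // y; rewrite /ball_/= sub0r normrN => yd.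
  have := hd (y, 0); rewrite prod_normE/= normr0 max_l// => /(_ yd).
  have -> : (0, p) + (y, 0) = (y, p) :> R2 by congr (_, _); rewrite /= ?add0r ?addr0.
  by move=> /E1 /= ->; rewrite subr0.
have alE : \forall p \near p1, al p = (p - p1) * m p.
  near=> p; have B0 : B (0, p).
    apply: Bp; near: p; apply/nbhs_normP; exists r => // z.
    by rewrite /ball_/= distrC.
  have h : is_derive (0 : R) 1 (fun y => g y p) ((p - p1) * m p) by near: p.
  by have [_ <-] := ial p B0; have [_ ->] := h.
have al1 : al p1 = 0 by rewrite (nbhs_singleton alE) subrr mul0r.
have Dal : is_derive p1 1 al (m p1).
  have := is_derive_mul_id m_cont; apply: near_eq_is_derive.
  by apply: filterS alE => p ->.
(* At p1 the linear coefficient vanishes and g = y^3 h3, so the cubic asymptotics of g determine h3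
   at the base point. *)
have h3c : h3 (0, p1) = c.
  apply/eqP; rewrite -subr_eq0 -normr_le0; apply/ler_addgt0Pr => e e0; rewrite add0r.
  have e2 : 0 < e / 2 by rewrite divr_gt0.
  have [d1 d10 hd1] := continuous_eps (C3 0%N _ Bc) e2.
  have [d2 d20 hd2] := g_yyy e2.
  pose d := Num.min r (Num.min d1 d2); have d0 : 0 < d by rewrite !lt_min r0 d10.
  pose y := d / 2; have y0 : 0 < y by rewrite divr_gt0.
  have yd : y < d by rewrite /y; lra.
  have [yr [y1 y2]] : y < r /\ y < d1 /\ y < d2.
    by move: yd; rewrite /d !lt_min => /andP[-> /andP[-> ->]].
  have By : B (y, p1) by apply/ball_in; rewrite /= gtr0_norm// subrr normr0.
  have := hd2 y; rewrite gtr0_norm// => /(_ y2).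
  have /= -> := E1 _ By; have /= -> := E3 _ By; rewrite -/(al p1) al1 add0r.
  have -> : y * (y ^+ 2 * h3 (y, p1)) - c * y ^+ 3 = (h3 (y, p1) - c) * y ^+ 3 by ring.
  have y3 : 0 < y ^+ 3 by rewrite exprn_gt0.
  rewrite normrM (gtr0_norm y3) ler_pM2r// => A1.
  have := hd1 (y, 0); rewrite prod_normE/= normr0 max_l// gtr0_norm// => /(_ y1).
  have -> : (0, p1) + (y, 0) = (y, p1) :> R2 by congr (_, _); rewrite /= ?add0r ?addr0.
  move=> A2; have -> : h3 (0, p1) - c = (h3 (y, p1) - c) - (h3 (y, p1) - h3 (0, p1)) by ring.
  by apply: (le_trans (ler_normB _ _)); lra.
pose ka z := -1 * h3 z.
have Cka k : Ck_on k B ka by exact: Ck_on_scale.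
have [r2 r20 hr2] : exists2 r2, 0 < r2 & forall z, ball ((0, p1) : R2) r2 z -> B z /\ 0 < ka z.
  apply: nbhs_ball_in.
  have c0 : 0 < - c by rewrite oppr_gt0.
  have [d d0 hd] := continuous_eps (Cka 0%N _ Bc) c0.
  apply/nbhs_normP; exists (Num.min r d) => [|z]; first by rewrite /= lt_min r0.
  rewrite /ball_/= lt_min distrC => /andP[zr zd]; split.
    by rewrite /B -ball_normE /ball_/= distrC.
  by have := hd _ zd; rewrite subrKC ltr_norml => /andP[+ _]; rewrite {2}/ka h3c; lra.
pose B2 : set R2 := ball ((0, p1) : R2) r2.
have oB2 : open B2 by exact: ball_open.
have B2c : B2 (0, p1) by exact: ballxx.
have B2B z : B2 z -> B z by move=> /hr2[].
have ka0 z : B2 z -> 0 < ka z by move=> /hr2[].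
pose S z := (Num.sqrt (ka z))^-1.
have CS k : Ck_on k B2 S.
  by apply: Ck_on_invsqrt => //; apply: Ck_on_sub (Cka k) => z /B2B.
(* The square root of [ka], written through [S] so that its smoothness is that of a product. *)
pose sq z := ka z * S z.
have Csq k : Ck_on k B2 sq.
  by apply: Ck_on_mul => //; apply: Ck_on_sub (Cka k) => z /B2B.
have Cfst k : Ck_on k B2 (fst : R2 -> R).
  exact: (Ck_on_fst oB2 (Ck_on_id _ _)).
have sqE z : B2 z -> sq z ^+ 2 = ka z.
  move=> /ka0 k0; have q0 : 0 < Num.sqrt (ka z) by rewrite sqrtr_gt0.
  have q2 : Num.sqrt (ka z) ^+ 2 = ka z by rewrite sqr_sqrtr// ltW.
  rewrite /sq /S; move: q0 q2; set q := Num.sqrt _ => q0 <-.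
  by field; exact: lt0r_neq0.
have sq0 z : B2 z -> 0 < sq z by move=> Bz; rewrite mulr_gt0 ?ka0// invr_gt0 sqrtr_gt0 ka0.
have Ssq z : B2 z -> S z * sq z = 1.
  move=> Bz; have k0 := ka0 z Bz; have q0 : 0 < Num.sqrt (ka z) by rewrite sqrtr_gt0.
  have q2 : Num.sqrt (ka z) ^+ 2 = ka z by rewrite sqr_sqrtr// ltW.
  rewrite /sq /S; move: q0 q2; set q := Num.sqrt _ => q0 <-.
  by field; exact: lt0r_neq0.
exists (fun y p => S (y, p)), (fun y p => y * sq (y, p)), (fun p => p1 + al p); split.
- split.
  + by exists B2; split=> // k; apply: (Ck_on_eq oB2 _ (CS k)) => -[].
  + exists B2; split=> // k.
    by apply: (Ck_on_eq oB2 _ (Ck_on_mul oB2 (Cfst k) (Csq k))) => -[].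
  + pose l (p : R) : R2 := (0, p).
    have lin_l : linear l by move=> k x y; congr (_, _); rewrite /= /GRing.scale/= ?mulr0 ?addr0.
    pose lM := GRing.isLinear.Build _ _ _ _ _ lin_l.
    pose lL : {linear R -> R2} := HB.pack l lM.
    have cl : continuous lL.
      by move=> p; exact: (cvg_pair (cvg_cst (0 : R)) (@cvg_id _ (nbhs p))).
    have cL : continuous (fun p => lL p + 0).
      by move=> p; exact: (cvgD (cl p) (cvg_cst (0 : R2))).
    have oU : open (fun p : R => B (lL p + 0)) by apply: open_comp => // p _; exact: cL.
    exists (fun p : R => B (lL p + 0)); split; first by split; rewrite ?addr0.
    move=> k; have Cl := Ck_on_precomp 0 oB cl (C1 k).
    apply: (Ck_on_eq oU _ (Ck_on_add oU (Ck_on_cst k _ p1) Cl)) => p _.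
    by rewrite addr0.
- by rewrite invr_gt0 sqrtr_gt0 ka0.
- split; first by rewrite mul0r.
  have cs : {for (0 : R), continuous (fun y : R => sq (y, p1))}.
    apply: (@continuous_comp _ _ _ (fun y : R => (y, p1) : R2) sq); last exact: (Csq 0%N _ B2c).
    exact: (cvg_pair (@cvg_id _ (nbhs (0 : R))) (cvg_cst p1)).
  have h := is_derive_mul_id cs.
  have E : (fun y : R => (y - 0) * sq (y, p1)) = (fun y => y * sq (y, p1)).
    by apply/funext => y; rewrite subr0.
  by rewrite E in h; rewrite derive1E (derive_val (is_derive := h)) sq0.
- rewrite al1 addr0; split=> //.
  have h := is_derive_add (is_derive_cst p1 p1 (1 : R)) Dal.
  by rewrite derive1E (derive_val (is_derive := h)) add0r.
- have nB2 : \forall z \near ((0, p1) : R2), B2 z by exact: open_nbhs_nbhs.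
  apply: filterS nB2 => -[y p] /= Bz; have /= -> := E1 _ (B2B _ Bz); have /= -> := E3 _ (B2B _ Bz).
  have -> : p1 + al p - p1 = al p by rewrite addrAC subrr add0r.
  have -> : (y * sq (y, p)) ^+ 3 = y ^+ 3 * sq (y, p) ^+ 2 * sq (y, p) by ring.
  rewrite sqE// mulrBr.
  have -> : S (y, p) * (al p * (y * sq (y, p))) = S (y, p) * sq (y, p) * (al p * y) by ring.
  have -> : S (y, p) * (y ^+ 3 * ka (y, p) * sq (y, p)) = S (y, p) * sq (y, p) * (y ^+ 3 * ka (y, p)) by ring.
  by rewrite Ssq// !mul1r /ka -/(al p); ring.
Unshelve. all: by end_near. Qed.
End pitchfork_recognition.

(** * The Lyapunov-Schmidt reduction *)

Lemma mulmx_norm_le (R : realType) m n (P : 'M[R]_(m, n)) :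
  exists2 C : R, 0 < C & forall x : 'rV[R]_m, `|x *m P| <= C * `|x|.
Proof.
pose C := \sum_i \sum_j `|P i j|.
have C0 : 0 <= C by apply: sumr_ge0 => i _; exact: sumr_ge0.
exists (C + 1) => [|x]; first by rewrite ltr_wpDl.
apply: (@le_trans _ _ (C * `|x|)); last by rewrite ler_wpM2r// lerDl.
apply: row_norm_le => [|j]; first by rewrite mulr_ge0.
rewrite mxE (le_trans (ler_norm_sum _ _ _))// mulr_suml; apply: ler_sum => i _.
rewrite normrM mulrC; apply: ler_pM => //; last exact: mx_entry_le_norm.
by rewrite (bigD1 j)//= lerDl sumr_ge0.
Qed.

(* Right multiplication by L is injective on M, and here its inverse is linear, hence Lipschitz. *)
Lemma mulmx_left_inverse_on (F : fieldType) n (L M : 'M[F]_n) : (kermx L :&: M)%MS = 0 ->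
  exists P : 'M[F]_n, forall w : 'rV[F]_n, (w <= M)%MS -> w = w *m L *m P.
Proof.
move=> LM; exists (pinvmx (M *m L) *m M) => w wM.
have [c wE] : exists c, w = c *m M by apply/submxP.
pose c' := w *m L *m pinvmx (M *m L).
have wL : (w *m L <= M *m L)%MS by rewrite submxMr.
have c'E : c' *m (M *m L) = w *m L by rewrite mulmxKpV.
rewrite mulmxA -/c'; apply/eqP; rewrite -subr_eq0 {1}wE -mulmxBl; apply/eqP.
apply/eqP; rewrite -submx0 -LM sub_capmx submxMl andbT; apply/sub_kermxP.
by rewrite -mulmxA mulmxBl c'E mulmxA -wE subrr.
Qed.

Section strict_differentiability.
Variables (R : realType) (n : nat) (A : 'M[R]_n) (d : 'I_n -> R) (psi : 'I_n -> R -> R).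
Variables (p1 : R) (f : R -> 'rV[R]_n -> 'rV[R]_n).
Hypotheses
  (psi_smooth : forall i k (s : R), derivable (psi i)^`(k)%classic s 1)
  (psi_sat : forall i, saturating (psi i))
  (fE : forall p x i, f p x 0 i = - d i * x 0 i + p * \sum_j A i j * psi j (x 0 j)).

Definition lin_field (w : 'rV[R]_n) : 'rV[R]_n :=
  \row_i (- d i * w 0 i + p1 * \sum_j A i j * w 0 j).

(** Strict differentiability at 0, with both points free: the mean value theorem and continuity of
    psi' at 0. *)
Lemma sat_strict_eps e : 0 < e -> exists2 dl, 0 < dl & forall j x y,
  `|x| < dl -> `|y| < dl -> `|psi j x - psi j y - (x - y)| <= e * `|x - y|.
Proof.
move=> e0; apply: finite_delta => [j|j a b _ ba H x y xb yb]; last first.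
  by apply: H; exact: lt_le_trans ba.
have c1 := @sat_continuousn R (psi j) (@psi_smooth j) 1%N 0.
have [dl dl0 hdl] := continuous_eps c1 e0; exists dl => // x y.
wlog xy : x y / y <= x.
  move=> H xd yd; have [/H h|/ltW/H h] := leP y x; first exact: h.
  have := h yd xd; rewrite (distrC y x).
  have -> : psi j y - psi j x - (y - x) = - (psi j x - psi j y - (x - y)) by ring.
  by rewrite normrN.
move=> xd yd; move: xy; rewrite le_eqVlt => /predU1P[->|xy]; first by rewrite !subrr normr0 mulr0.
have [k /andP[yk kx] ->] := derive_MVT xy (fun z _ => sat_is_derive (@psi_smooth j) z).
rewrite -[X in _ - X]mul1r -mulrBl normrM ler_wpM2r// ltW//.
have := hdl k; rewrite add0r derive1n1 (sat_deriv0 (psi_sat j)); apply.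
by move: xd yd; rewrite !ltr_norml => /andP[? ?] /andP[? ?]; apply/andP; split; lra.
Qed.

(** The linear part is frozen at p1 while p varies. This takes the place of the contraction estimate
    in an implicit function argument. *)
Lemma field_strict_eps e : 0 < e -> exists2 dl, 0 < dl & forall p (x y : 'rV[R]_n),
  `|p - p1| < dl -> `|x| < dl -> `|y| < dl ->
  `|f p x - f p y - lin_field (x - y)| <= e * `|x - y|.
Proof.
move=> e0; pose C := \sum_i \sum_j `|A i j|.
have C0 : 0 <= C by apply: sumr_ge0 => i _; exact: sumr_ge0.
have AC i : \sum_j `|A i j| <= C.
  by rewrite /C [leRHS](bigD1 i)//= lerDl sumr_ge0// => k _; exact: sumr_ge0.
(* Half of e pays for replacing p by p1, the other half for linearizing psi; the added ones keep
   denominators positive. *)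
pose C1 := 2 * (C + 1) * (`|p1| + 1).
have C10 : 0 < C1 by rewrite !mulr_gt0// ltr_wpDl.
have eC : 0 < e / C1 by rewrite divr_gt0.
have [d1 d10 hd1] := sat_strict_eps eC.
have eC2 : 0 < e / (2 * (C + 1)) by rewrite divr_gt0// mulr_gt0// ltr_wpDl.
exists (Num.min d1 (e / (2 * (C + 1)))) => [|p x y]; first by rewrite lt_min d10.
rewrite !lt_min => /andP[_ pe] /andP[xd _] /andP[yd _].
apply: row_norm_le => [|i]; first by rewrite mulr_ge0// ltW.
have xyj j : `|x 0 j - y 0 j| <= `|x - y|.
  by have := mx_entry_le_norm (x - y) 0 j; rewrite !mxE.
have E : (f p x - f p y - lin_field (x - y)) 0 i =
   (p - p1) * (\sum_j A i j * (psi j (x 0 j) - psi j (y 0 j))) +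
   p1 * (\sum_j A i j * (psi j (x 0 j) - psi j (y 0 j) - (x 0 j - y 0 j))).
  have -> : (f p x - f p y - lin_field (x - y)) 0 i =
     f p x 0 i - f p y 0 i - (- d i * (x 0 i - y 0 i) + p1 * \sum_j A i j * (x 0 j - y 0 j)).
    by rewrite !mxE; congr (_ - (_ + _ * _)); apply: eq_bigr => j _; rewrite !mxE.
  rewrite !fE.
  have E1 : \sum_j A i j * (psi j (x 0 j) - psi j (y 0 j)) =
     \sum_j A i j * psi j (x 0 j) - \sum_j A i j * psi j (y 0 j).
    by rewrite -sumrB; apply: eq_bigr => j _; rewrite mulrBr.
  have -> : \sum_j A i j * (psi j (x 0 j) - psi j (y 0 j) - (x 0 j - y 0 j)) =
     \sum_j A i j * (psi j (x 0 j) - psi j (y 0 j)) - \sum_j A i j * (x 0 j - y 0 j).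
    by rewrite -sumrB; apply: eq_bigr => j _; rewrite mulrBr.
  by rewrite E1; ring.
rewrite E; apply: (le_trans (ler_normD _ _)).
apply: (@le_trans _ _ (e / 2 * `|x - y| + e / 2 * `|x - y|)); last by rewrite -mulrDl -splitr.
apply: lerD.
  rewrite normrM; apply: (@le_trans _ _ (e / (2 * (C + 1)) * (C * `|x - y|))).
    apply: ler_pM => //; first exact: ltW.
    rewrite (le_trans (ler_norm_sum _ _ _))//; apply: (le_trans _ (ler_wpM2r (normr_ge0 _) (AC i))).
    rewrite mulr_suml; apply: ler_sum => j _; rewrite normrM ler_wpM2l//.
    by apply: le_trans (xyj j); exact: sat_lipschitz.
  rewrite mulrA ler_wpM2r//.
  have -> : e / (2 * (C + 1)) * C = e / 2 * (C / (C + 1)) by field; lra.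
  by rewrite ler_piMr ?divr_ge0 ?(ltW e0)// ler_pdivrMr ?mul1r ?lerDl// ltr_wpDl.
rewrite normrM; apply: (@le_trans _ _ (`|p1| * (C * (e / C1 * `|x - y|)))).
  rewrite ler_wpM2l// (le_trans (ler_norm_sum _ _ _))//.
  apply: (@le_trans _ _ ((\sum_j `|A i j|) * (e / C1 * `|x - y|))); last first.
    by rewrite ler_wpM2r ?AC// mulr_ge0// ltW.
  rewrite mulr_suml; apply: ler_sum => j _; rewrite normrM ler_wpM2l//.
  apply: (@le_trans _ _ (e / C1 * `|x 0 j - y 0 j|)); last by rewrite ler_pM2l.
  by apply: hd1; apply: le_lt_trans (mx_entry_le_norm _ _ _) _.
have -> : `|p1| * (C * (e / C1 * `|x - y|)) = e / 2 * `|x - y| * ((`|p1| * C) / ((C + 1) * (`|p1| + 1))).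
  rewrite /C1; have p10 := normr_ge0 p1; field; apply/andP; split; lra.
have den : 0 < (C + 1) * (`|p1| + 1) by rewrite mulr_gt0// ltr_wpDl.
rewrite ler_piMr ?mulr_ge0 ?divr_ge0 ?(ltW e0)// ler_pdivrMr// mul1r mulrC.
by apply: ler_pM => //; rewrite lerDl.
Qed.

Lemma lin_field_linear : linear lin_field.
Proof.
move=> k x y; apply/rowP => i; rewrite !mxE.
have -> : \sum_j A i j * (k *: x + y) 0 j = k * (\sum_j A i j * x 0 j) + \sum_j A i j * y 0 j.
  by rewrite mulr_sumr -big_split/=; apply: eq_bigr => j _; rewrite !mxE; ring.
ring.
Qed.

Lemma field0 p : f p 0 = 0.
Proof.
apply/rowP => i; rewrite fE !mxE mulr0 big1 ?mulr0 ?addr0// => j _.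
by rewrite mxE (sat0 (psi_sat j)) mulr0.
Qed.

Lemma fieldN p x : f p (- x) = - f p x.
Proof.
apply/rowP => i; rewrite mxE !fE mxE mulrN opprD; congr (_ + _); rewrite -mulrN; congr (_ * _).
by rewrite -sumrN; apply: eq_bigr => j _; rewrite mxE (satN (psi_sat j)) mulrN.
Qed.

Lemma field_jacobian (w : 'rV[R]_n) : w *m 'J (f p1) 0 = lin_field w.
Proof.
have lin := lin_field_linear.
pose M := GRing.isLinear.Build _ _ _ _ _ lin.
pose LL : {linear 'rV[R]_n -> 'rV[R]_n} := HB.pack lin_field M.
have LLE (h : 'rV[R]_n) : LL h = h *m lin1_mx LL by rewrite mul_rV_lin1.
have cL : continuous LL.
  have [C C0 hC] := mulmx_norm_le (lin1_mx LL).
  move=> x; apply: eps_continuous => e e0; exists (e / C) => [|h he]; first by rewrite divr_gt0.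
  rewrite linearD addrAC subrr add0r LLE (le_trans (hC h))// mulrC -ler_pdivlMr//; exact: ltW.
have [|df dfE] := @eps_differentiable _ _ _ (f p1) 0 LL cL; last first.
  by rewrite -deriveEjacobian// deriveE// dfE.
move=> e e0; have [dl dl0 hdl] := field_strict_eps e0; exists dl => // h hd.
have := hdl p1 h 0; rewrite subrr normr0 !subr0 field0 subr0 add0r subr0; apply => //.
by rewrite normr0.
Qed.
End strict_differentiability.

(** The difference of cubes factors through X - v y, and each of the three quadratic terms is at
    most ((|v| + 1) |y|)^2. *)
Lemma cube_perturb (R : realType) (X v y eta : R) : 0 <= eta <= 1 -> `|X - v * y| <= eta * `|y| ->
  `|X| <= (`|v| + 1) * `|y| /\ `|X ^+ 3 - v ^+ 3 * y ^+ 3| <= 3 * eta * (`|v| + 1) ^+ 2 * `|y| ^+ 3.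
Proof.
move=> /andP[e0 e1] Xv; have y0 := normr_ge0 y; have v0 := normr_ge0 v.
set V := `|v| + 1; have V0 : 0 <= V by rewrite addr_ge0.
have vy : `|v * y| <= V * `|y| by rewrite normrM ler_wpM2r// lerDl.
have XV : `|X| <= V * `|y|.
  have -> : X = (X - v * y) + v * y by ring.
  apply: (le_trans (ler_normD _ _)); apply: (@le_trans _ _ (eta * `|y| + `|v| * `|y|)).
    by rewrite lerD// normrM.
  have : eta * `|y| <= 1 * `|y| by rewrite ler_wpM2r.
  by rewrite /V mulrDl; lra.
split=> //; have Vy0 : 0 <= V * `|y| by rewrite mulr_ge0.
have -> : X ^+ 3 - v ^+ 3 * y ^+ 3 = (X - v * y) * (X * X + X * (v * y) + (v * y) * (v * y)) by ring.
have -> : 3 * eta * V ^+ 2 * `|y| ^+ 3 = eta * `|y| * (3 * ((V * `|y|) * (V * `|y|))) by ring.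
have m (s t : R) : `|s| <= V * `|y| -> `|t| <= V * `|y| -> `|s * t| <= (V * `|y|) * (V * `|y|).
  by move=> hs ht; rewrite normrM; apply: ler_pM.
rewrite normrM; apply: ler_pM => //.
apply: (le_trans (ler_normD _ _)); apply: (le_trans (lerD (ler_normD _ _) (lexx _))).
by have h1 := m _ _ XV XV; have h2 := m _ _ XV vy; have h3 := m _ _ vy vy; lra.
Qed.

Section reduction.
Variables (R : realType) (n : nat) (A : 'M[R]_n) (d : 'I_n -> R) (psi : 'I_n -> R -> R).
Variables (u : 'I_n -> R) (mu p1 : R).
Hypotheses (A_ge0 : forall i j, 0 <= A i j) (A_sym : A^T = A) (A_irr : irreducible_mx A)
  (d_gt0 : forall i, 0 < d i)
  (psi_smooth : forall i k (s : R), derivable (psi i)^`(k)%classic s 1)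
  (psi_sat : forall i, saturating (psi i))
  (u_gt0 : forall i, 0 < u i) (u_eig : forall i, \sum_j A i j * u j = mu * d i * u i)
  (p1mu : p1 * mu = 1).
Local Notation PT := 'M[R]_(n, n * n).
Local Notation F := (opinion_field d A psi).

Lemma opinion_field0 p x i :
  F x p (0 : PT) 0 i = - d i * x 0 i + p * \sum_j A i j * psi j (x 0 j).
Proof.
rewrite mxE [X in _ + _ * X]big1 ?mulr0 ?addr0// => j _; rewrite big1// => k _.
by rewrite /slice row0 linear0 mxE !mul0r.
Qed.

Let fE p (x : 'rV[R]_n) i := opinion_field0 p x i.

Let L : 'M[R]_n := 'J (fun x => F x p1 (0 : PT)) (0 : 'rV[R]_n).

Let LE (w : 'rV[R]_n) : w *m L = lin_field A d p1 w.
Proof.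
have := @field_jacobian R n A d psi p1 (fun p x => F x p 0) psi_smooth psi_sat fE w.
exact.
Qed.

Let lin_field_eq0 (w : 'rV[R]_n) : lin_field A d p1 w = 0 -> exists a, forall i, w 0 i = a * u i.
Proof.
move=> w0; apply: (ground_state_unique A_ge0 A_sym A_irr u_gt0 u_eig) => i.
have := congr1 (fun m : 'rV_n => m 0 i) w0; rewrite !mxE => /eqP.
rewrite addrC mulNr subr_eq0 => /eqP E.
by rewrite -[LHS]mul1r -p1mu mulrAC E; ring.
Qed.

(** Symmetry of A makes the linearization self-adjoint, so vs, orthogonal to the range, lies in the
    kernel, which is spanned by u. The orientation of v and vs becomes a b > 0. *)
Lemma reduction_kernel (v vs : 'rV[R]_n) : (v == kermx L)%MS -> L *m vs^T = 0 ->
  0 < \sum_i v 0 i * vs 0 i ->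
  v *m L = 0 /\ exists a b, [/\ 0 < a * b, forall i, v 0 i = a * u i & forall i, vs 0 i = b * u i].
Proof.
move=> /andP[/sub_kermxP vL _] Lvs vvs; split=> //.
have [a va] : exists a, forall i, v 0 i = a * u i by apply: lin_field_eq0; rewrite -LE.
have [b vb] : exists b, forall i, vs 0 i = b * u i.
  apply: lin_field_eq0; set w := lin_field A d p1 vs.
  have self (x y : 'rV[R]_n) : \sum_i lin_field A d p1 x 0 i * y 0 i = \sum_i x 0 i * lin_field A d p1 y 0 i.
    have E (x' y' : 'rV[R]_n) : \sum_i lin_field A d p1 x' 0 i * y' 0 i =
       - \sum_i d i * x' 0 i * y' 0 i + p1 * \sum_i \sum_j A i j * x' 0 j * y' 0 i.
      rewrite mulr_sumr -sumrN -big_split/=; apply: eq_bigr => i _; rewrite mxE.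
      have -> : \sum_j A i j * x' 0 j * y' 0 i = (\sum_j A i j * x' 0 j) * y' 0 i.
        by rewrite mulr_suml.
      ring.
    rewrite E; under [RHS]eq_bigr do rewrite mulrC.
    rewrite E; congr (- _ + _ * _); first by apply: eq_bigr => i _; ring.
    rewrite exchange_big/=; apply: eq_bigr => i _; apply: eq_bigr => j _.
    by rewrite (mx_symE A_sym); ring.
  (* w is the linearization applied to vs, so its squared length is the pairing of vs with the image
     of w, which vanishes. *)
  have : \sum_i w 0 i * w 0 i = 0.
    have Z : \sum_i lin_field A d p1 w 0 i * vs 0 i = 0.
      have := congr1 (fun m : 'M[R]_1 => m 0 0) (congr1 (mulmx w) Lvs).
      rewrite mulmxA LE mulmx0 mxE [RHS]mxE => Z; rewrite -[RHS]Z.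
      by apply: eq_bigr => i _; rewrite [vs^T _ _]mxE.
    by rewrite -[RHS]Z self.
  move/eqP; rewrite psumr_eq0 => [/allP h|i _]; last by rewrite -expr2 sqr_ge0.
  apply/rowP => i; rewrite [RHS]mxE; have := h i; rewrite mem_index_enum => /(_ isT) /=.
  by rewrite -expr2 sqrf_eq0 => /eqP.
exists a, b; split=> //; move: vvs.
have -> : \sum_i v 0 i * vs 0 i = a * b * \sum_i u i ^+ 2.
  by rewrite mulr_sumr; apply: eq_bigr => i _; rewrite va vb; ring.
have u2 : 0 <= \sum_i u i ^+ 2 by apply: sumr_ge0 => i _; exact: sqr_ge0.
by rewrite [0 < a * b]ltNge; move=> h; apply/negP => ab; move: h; rewrite ltNge mulr_le0_ge0.
Qed.

(** * The implicit solution W at zero interaction tensor *)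

Section implicit_solution.
Variables (v : 'rV[R]_n) (M N : 'M[R]_n) (W : R -> R -> PT -> 'rV[R]_n).
Hypotheses (vL : v *m L = 0) (LM : (kermx L :&: M)%MS = 0) (LN : (L :&: N)%MS = 0)
  (W_smooth : smooth_near (fun z : R * R * PT => W z.1.1 z.1.2 z.2) (0, p1, 0))
  (W0 : W 0 p1 0 = 0)
  (W_solves : \forall z \near ((0, p1, 0) : R * R * PT),
     let w := W z.1.1 z.1.2 z.2 in
     (w <= M)%MS /\ F (z.1.1 *: v + w) z.1.2 z.2 *m proj_mx L N = 0).

Lemma near_slice (P : R * R * PT -> Prop) : (\forall z \near ((0, p1, 0) : R * R * PT), P z) ->
  exists2 dl : R, 0 < dl & forall y p : R, `|y| < dl -> `|p - p1| < dl -> P (y, p, 0).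
Proof.
move=> /near_eps[dl dl0 hdl]; exists dl => // y p yd pd.
have := hdl ((y, p - p1), 0); rewrite !prod_normE/= normr0 !gt_max yd pd dl0 => /(_ isT).
suff -> : (0, p1, 0) + (y, p - p1, 0) = (y, p, 0) :> R * R * PT by [].
by congr (_, _, _); rewrite /= ?add0r ?subrKC.
Qed.

Lemma solution_small (e : R) : 0 < e -> exists2 dl : R, 0 < dl &
  forall y p : R, `|y| < dl -> `|p - p1| < dl -> `|W y p 0| < e.
Proof.
move=> e0; apply: (near_slice (P := fun z => `|W z.1.1 z.1.2 z.2| < e)).
have [U [[oU Uz] CU]] := W_smooth.
have [a a0 ha] := continuous_eps (CU 0%N _ Uz) e0.
apply/nbhs_normP; exists a => // z; rewrite /ball_/= distrC => za.
by have := ha _ za; rewrite subrKC /= W0 subr0.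
Qed.

(** If x and x' solve the projected equation, only the remainder of the strict linearization
    survives projection, and it equals - w L. The left inverse of L on M recovers w. *)
Lemma solution_estimate (e : R) : 0 < e -> exists2 dl : R, 0 < dl & forall p (x x' : 'rV[R]_n),
  `|p - p1| < dl -> `|x| < dl -> `|x'| < dl -> forall w : 'rV[R]_n, (w <= M)%MS ->
  (x - x') *m L = w *m L -> F x p 0 *m proj_mx L N = 0 -> F x' p 0 *m proj_mx L N = 0 ->
  `|w| <= e * `|x - x'|.
Proof.
have [P hP] := mulmx_left_inverse_on LM.
have [C1 C10 hC1] := mulmx_norm_le P.
have [C2 C20 hC2] := mulmx_norm_le (proj_mx L N).
move=> e0; have e'0 : 0 < e / (C1 * C2) by rewrite divr_gt0// mulr_gt0.
have [dl dl0 hdl] := @field_strict_eps R n A d psi p1 (fun p x => F x p 0) psi_smooth psi_sat fE _ e'0.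
exists dl => // p x x' pd xd xd' w wM xw Fx Fx'.
have := hdl p x x' pd xd xd'; set E := _ - _ - _ => hE.
have EP : E *m proj_mx L N = - (w *m L).
  rewrite /E -LE xw !mulmxBl Fx Fx' subrr sub0r proj_mx_id//; exact: submxMl.
rewrite [w]hP//; apply: (le_trans (hC1 _)).
rewrite -normrN -EP; apply: (le_trans (ler_wpM2l (ltW C10) (hC2 _))).
apply: (le_trans (ler_wpM2l (ltW C10) (ler_wpM2l (ltW C20) hE))).
have -> : C1 * (C2 * (e / (C1 * C2) * `|x - x'|)) = e * `|x - x'|; last by [].
by field; rewrite !lt0r_neq0.
Qed.

(** The estimate with e = 1 / 2 gives |w - w'| <= |w - w'| / 2. *)
Lemma solution_unique : exists2 dl : R, 0 < dl & forall y p (w w' : 'rV[R]_n),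
  `|y| < dl -> `|p - p1| < dl -> `|w| < dl -> `|w'| < dl -> (w <= M)%MS -> (w' <= M)%MS ->
  F (y *: v + w) p 0 *m proj_mx L N = 0 -> F (y *: v + w') p 0 *m proj_mx L N = 0 -> w = w'.
Proof.
have h2 : 0 < (1 / 2 : R) by lra.
have [dl dl0 hdl] := solution_estimate h2.
have v1 : 0 < `|v| + 1 by rewrite ltr_wpDl.
exists (dl / 2 / (`|v| + 1)); first by rewrite !divr_gt0.
move=> y p w w' yd pd wd wd' wM wM' Fw Fw'.
have le_dl : dl / 2 / (`|v| + 1) <= dl / 2.
  by rewrite ler_pdivrMr// ler_peMr ?lerDr// divr_ge0// ltW.
have small w0 : `|w0| < dl / 2 / (`|v| + 1) -> `|y *: v + w0| < dl.
  move=> w0d; apply: (le_lt_trans (ler_normD _ _)); rewrite (splitr dl) ltr_leD//.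
    rewrite normrZ; apply: (@le_lt_trans _ _ (`|y| * (`|v| + 1))); first by rewrite ler_wpM2l// lerDl.
    by rewrite -ltr_pdivlMr.
  by apply: (le_trans (ltW w0d)).
have diff : y *: v + w - (y *: v + w') = w - w' by rewrite opprD addrACA subrr add0r.
have := hdl p (y *: v + w) (y *: v + w') _ (small _ wd) (small _ wd') (w - w').
rewrite diff => /(_ _ _ erefl Fw Fw') h.
have {}h : `|w - w'| <= 1 / 2 * `|w - w'|.
  apply: h; last by rewrite addmx_sub// eqmx_opp.
  by apply: (lt_le_trans pd); apply: (le_trans le_dl); lra.
apply/eqP; rewrite -subr_eq0 -normr_le0; lra.
Qed.

Lemma solution_odd : exists2 dl : R, 0 < dl & forall y p : R,
  `|y| < dl -> `|p - p1| < dl -> W (- y) p 0 = - W y p 0.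
Proof.
have [d1 d10 h1] := solution_unique.
have [d2 d20 h2] := solution_small d10.
have [d3 d30 h3] := near_slice W_solves.
exists (Num.min d1 (Num.min d2 d3)) => [|y p]; first by rewrite !lt_min d10 d20.
rewrite !lt_min => /andP[y1 /andP[y2 y3]] /andP[q1 /andP[q2 q3]].
have yN : `|- y| < d3 by rewrite normrN.
have [/= Wm Fm] := h3 (- y) p yN q3.
have [/= Wp Fp] := h3 y p y3 q3.
apply: (h1 (- y) p) => //; rewrite ?normrN//; first by apply: h2; rewrite ?normrN.
- exact: h2.
- by rewrite eqmx_opp.
by rewrite scaleNr -opprD (fieldN psi_sat (f := fun p x => F x p 0) fE) mulNmx Fp oppr0.
Qed.

(** Compares the solution y v + W with the trivial solution 0. Since v L = 0, the component seen by
    L is W itself. *)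
Lemma solution_tangent (e : R) : 0 < e -> exists2 dl : R, 0 < dl &
  forall y : R, `|y| < dl -> `|W y p1 0| <= e * `|y|.
Proof.
(* Solving |W| <= e' (|y| |v| + |W|) for |W| then gives |W| (|v| + 1) <= e |y| |v|. *)
move=> e0; pose e' := e / (`|v| + e + 1).
have v0 := normr_ge0 v.
have den : 0 < `|v| + e + 1 by lra.
have e'0 : 0 < e' by rewrite divr_gt0.
have [d1 d10 h1] := solution_estimate e'0.
have d12 : 0 < d1 / 2 by rewrite divr_gt0.
have [d2 d20 h2] := solution_small d12.
have [d3 d30 h3] := near_slice W_solves.
have v1 : 0 < `|v| + 1 by rewrite ltr_wpDl.
exists (Num.min (d1 / 2 / (`|v| + 1)) (Num.min d2 d3)) => [|y].
  by rewrite !lt_min d20 d30 !divr_gt0.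
rewrite !lt_min => /andP[y1 /andP[y2 y3]].
have pp a : 0 < a -> `|p1 - p1| < a by rewrite subrr normr0.
have [/= WM FW] := h3 y p1 y3 (pp _ d30).
have small : `|y *: v + W y p1 0| < d1.
  apply: (le_lt_trans (ler_normD _ _)); rewrite (splitr d1) ltrD//; last exact: h2 (pp _ d20).
  rewrite normrZ; apply: (@le_lt_trans _ _ (`|y| * (`|v| + 1))); first by rewrite ler_wpM2l// lerDl.
  by rewrite -ltr_pdivlMr.
have z0 : `|0 : 'rV[R]_n| < d1 by rewrite normr0.
have := h1 p1 _ 0 (pp _ d10) small z0 (W y p1 0) WM.
rewrite subr0 mulmxDl -scalemxAl vL scaler0 add0r => /(_ erefl FW).
rewrite (field0 psi_sat (f := fun p x => F x p 0) fE) mul0mx => /(_ erefl) h.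
have {}h : `|W y p1 0| <= e' * (`|y| * `|v| + `|W y p1 0|).
  by apply: (le_trans h); rewrite ler_wpM2l ?(ltW e'0)// (le_trans (ler_normD _ _))// normrZ.
move: h; rewrite /e' mulrAC ler_pdivlMr// => h.
have y0 := normr_ge0 y; have Wn := normr_ge0 (W y p1 0).
have h5 : `|W y p1 0| * (`|v| + 1) <= e * `|y| * `|v| by lra.
rewrite -(ler_pM2r v1); apply: (le_trans h5); rewrite ler_wpM2l ?lerDl//.
by rewrite mulr_ge0// ltW.
Qed.

(** * Taylor coefficients of the reduced function *)

Section reduced_function.
Variables (vs : 'rV[R]_n) (a b : R) (g : R -> R -> PT -> R).
Hypotheses (n_gt0 : (0 < n)%N) (p1_gt0 : 0 < p1)
  (ab_gt0 : 0 < a * b) (va : forall i, v 0 i = a * u i) (vsb : forall i, vs 0 i = b * u i)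
  (gE : \forall z \near ((0, p1, 0) : R * R * PT), g z.1.1 z.1.2 z.2 =
     \sum_i F (z.1.1 *: v + W z.1.1 z.1.2 z.2) z.1.2 z.2 0 i * vs 0 i).

(** Moving A onto the eigenvector u decouples the coordinates. At p1 mu = 1 only psi_j(x_j) - x_j
    remains, which has no linear part. *)
Lemma field_pairing p (x : 'rV[R]_n) : \sum_i F x p (0 : PT) 0 i * vs 0 i =
  b * \sum_j d j * u j * (p * mu * psi j (x 0 j) - x 0 j).
Proof.
have -> : \sum_i F x p (0 : PT) 0 i * vs 0 i = b * (p * (\sum_i \sum_j u i * A i j * psi j (x 0 j))
       - \sum_i u i * d i * x 0 i).
  rewrite !mulr_sumr -sumrB mulr_sumr; apply: eq_bigr => i _; rewrite fE vsb.
  have -> : \sum_j u i * A i j * psi j (x 0 j) = u i * \sum_j A i j * psi j (x 0 j).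
    by rewrite mulr_sumr; apply: eq_bigr => j _; ring.
  ring.
congr (_ * _); rewrite exchange_big/= mulr_sumr -sumrB; apply: eq_bigr => j _.
have -> : \sum_i u i * A i j * psi j (x 0 j) = (mu * d j * u j) * psi j (x 0 j).
  by rewrite -u_eig mulr_suml; apply: eq_bigr => i _; rewrite (mx_symE A_sym i j); ring.
ring.
Qed.

Let x_ y p : 'rV[R]_n := y *: v + W y p 0.

Lemma reduced_slice : exists2 dl : R, 0 < dl & forall y p : R, `|y| < dl -> `|p - p1| < dl ->
  g y p 0 = b * \sum_j d j * u j * (p * mu * psi j (x_ y p 0 j) - x_ y p 0 j).
Proof.
have [dl dl0 h] := near_slice gE; exists dl => // y p yd pd.
by have /= -> := h y p yd pd; rewrite field_pairing.
Qed.

Lemma reduced_odd : odd_near p1 (fun y p => g y p 0).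
Proof.
have [d1 d10 h1] := reduced_slice; have [d2 d20 h2] := solution_odd.
apply/nbhs_normP; exists (Num.min d1 d2) => [|[y p]]; first by rewrite /= lt_min d10.
rewrite /ball_/= prod_normE/= sub0r normrN distrC gt_max !lt_min => /andP[/andP[y1 y2] /andP[q1 q2]].
have yN : `|- y| < d1 by rewrite normrN.
rewrite (h1 _ _ yN q1) (h1 _ _ y1 q1) -mulrN -sumrN; congr (_ * _); apply: eq_bigr => j _.
have -> : x_ (- y) p = - x_ y p by rewrite /x_ h2// scaleNr -opprD.
by rewrite mxE (satN (psi_sat j)); ring.
Qed.

Let Wz (z : R * R * PT) := W z.1.1 z.1.2 z.2.
Let dW p : 'rV[R]_n := 'D_((1, 0, 0) : R * R * PT) Wz (0, p, 0).
(** Since p mu - 1 = (p - p1) mu, the y-derivative of g at (0, p) is (p - p1) m(p). *)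
Let m p := mu * b * \sum_j d j * u j * (v 0 j + dW p 0 j).

Lemma solution_derive : exists2 dl : R, 0 < dl & forall p : R, `|p - p1| < dl ->
  W 0 p 0 = 0 /\ is_derive (0 : R) 1 (fun y => W y p 0) (dW p).
Proof.
have [U [[oU Uz] CU]] := W_smooth.
have [d1 d10 h1] := near_slice (open_nbhs_nbhs (conj oU Uz)).
have [d2 d20 h2] := solution_odd.
exists (Num.min d1 d2) => [|p]; first by rewrite lt_min d10.
rewrite lt_min => /andP[pd1 pd2]; split.
  have := h2 0 p; rewrite oppr0 normr0 => /(_ d20 pd2) /rowP E; apply/rowP => i.
  by have := E i; rewrite !mxE => ?; lra.
have U0 : U (0, p, 0) by apply: h1; rewrite ?normr0.
pose e1 : R * R * PT := (1, 0, 0).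
have lineE s : (0, p, 0) + s *: e1 = (s, p, 0) :> R * R * PT.
  by congr (_, _, _); rewrite /= ?scaler0 ?addr0// add0r /GRing.scale/= mulr1.
have dWz : differentiable Wz ((0, p, 0) + 0 *: e1) by rewrite lineE; have [+ _] := CU 1%N; apply.
have := is_derive_line dWz; rewrite -(deriveE _ dWz) lineE.
have -> : (fun s => Wz ((0, p, 0) + s *: e1)) = (fun y => W y p 0).
  by apply/funext => s; rewrite lineE.
exact.
Qed.

Lemma solution_derive0 : dW p1 = 0.
Proof.
have [dl dl0 h] := solution_derive; have [] := h p1; first by rewrite subrr normr0.
move=> W00 [_ <-]; have D0 : is_derive (0 : R) 1 (fun y => W y p1 0) 0.
  apply: eps_is_derive => e e0; have [d1 d10 h1] := solution_tangent e0.
  by exists d1 => // y yd; rewrite add0r W00 scaler0 !subr0; exact: h1.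
by have [_ ->] := D0.
Qed.

Lemma reduced_derive : \forall p \near p1,
  is_derive (0 : R) 1 (fun y => g y p 0) ((p - p1) * m p).
Proof.
have [d1 d10 h1] := reduced_slice; have [d2 d20 h2] := solution_derive.
apply/nbhs_normP; exists (Num.min d1 d2) => [|p]; first by rewrite /= lt_min d10.
rewrite /ball_/= distrC lt_min => /andP[q1 q2].
have [W0p DW] := h2 p q2.
have Dx j : is_derive (0 : R) 1 (fun y => x_ y p 0 j) (v 0 j + dW p 0 j).
  have -> : (fun y => x_ y p 0 j) = (fun y => v 0 j * y + W y p 0 0 j).
    by apply/funext => y; rewrite !mxE mulrC.
  have h := is_derive_add (is_derive_scale (is_derive_id (0 : R) 1) (v 0 j)) (is_derive_coord j DW).
  by apply: (is_derive_eq h); rewrite mulr1.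
have x0 j : x_ 0 p 0 j = 0 by rewrite /x_ W0p scale0r addr0 mxE.
have Dpsi j : is_derive (0 : R) 1 (fun y => psi j (x_ y p 0 j)) (v 0 j + dW p 0 j).
  have Dp : is_derive (x_ 0 p 0 j) 1 (psi j) 1.
    apply: (is_derive_eq (sat_is_derive (@psi_smooth j) _)).
    by rewrite x0 (sat_deriv0 (psi_sat j)).
  by apply: (is_derive_eq (is_derive1_comp Dp (Dx j))); rewrite ?mul1r ?mulr1.
have DG : is_derive (0 : R) 1
   (fun y => b * \sum_j d j * u j * (p * mu * psi j (x_ y p 0 j) - x_ y p 0 j)) ((p - p1) * m p).
  have := is_derive_scale (is_derive_sumr (index_enum 'I_n) (fun j =>
     is_derive_scale (is_derive_sub (is_derive_scale (Dpsi j) (p * mu)) (Dx j)) (d j * u j))) b.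
  move=> h; apply: (is_derive_eq h).
  rewrite /m; have -> : (p - p1) * (mu * b * (\sum_j d j * u j * (v 0 j + dW p 0 j))) =
    b * ((p * mu - 1) * \sum_j d j * u j * (v 0 j + dW p 0 j)) by rewrite -p1mu; ring.
  by congr (_ * _); rewrite [RHS]mulr_sumr; apply: eq_bigr => j _; ring.
apply: near_eq_is_derive DG; apply/nbhs_normP; exists d1 => // y.
by rewrite /ball_/= sub0r normrN => yd; rewrite h1.
Qed.

Lemma reduced_derive_continuous : {for p1, continuous m}.
Proof.
have [U [[oU Uz] CU]] := W_smooth.
have cdW : {for p1, continuous dW}.
  apply: (@continuous_comp _ _ _ (fun p : R => (0, p, 0) : R * R * PT)
     (fun z => 'D_((1, 0, 0) : R * R * PT) Wz z)).
    exact: (cvg_pair (cvg_pair (cvg_cst (0 : R)) (@cvg_id _ (nbhs p1))) (cvg_cst (0 : PT))).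
  by have [_ D] := CU 1%N; exact: D.
have cj j : {for p1, continuous (fun p => dW p 0 j)}.
  apply: (@continuous_comp _ _ _ dW (fun w : 'rV[R]_n => w 0 j)); first exact: cdW.
  exact: coord_continuous.
rewrite /m; apply: (cvgM (cvg_cst (mu * b))).
apply: (cvg_big (op := +%R)); first exact: add_continuous.
move=> j _; apply: (cvgM (cvg_cst (d j * u j))).
exact: (cvgD (cvg_cst (v 0 j)) (cj j)).
Qed.

Lemma reduced_derive_gt0 : 0 < m p1.
Proof.
have mu0 : 0 < mu by rewrite -(pmulr_rgt0 _ p1_gt0) p1mu.
have -> : m p1 = mu * (a * b) * \sum_j d j * u j ^+ 2.
  rewrite /m solution_derive0 -!mulrA; congr (_ * _); rewrite [RHS]mulrA [in RHS](mulrC a) -mulrA; congr (_ * _).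
  by rewrite mulr_sumr; apply: eq_bigr => j _; rewrite va mxE; ring.
rewrite mulr_gt0//; first by rewrite mulr_gt0.
have pos j : 0 < d j * u j ^+ 2 by rewrite mulr_gt0// exprn_gt0.
by rewrite (bigD1 (Ordinal n_gt0))//= ltr_pwDl// sumr_ge0// => j _; exact: ltW.
Qed.

Let c := b * \sum_j d j * u j * ((psi j)^`(3)%classic 0 / 6 * v 0 j ^+ 3).

Lemma reduced_cubic_lt0 : (exists j, (psi j)^`(3)%classic 0 != 0) -> c < 0.
Proof.
move=> [k k0]; have le0 j := sat_deriv3_le0 (@psi_smooth j) (psi_sat j).
(* b a^3 is written as (a b) a^2, so the sign does not depend on the orientation chosen for v. *)
have -> : c = - (a * b * a ^+ 2 * \sum_j d j * u j ^+ 4 * (- (psi j)^`(3)%classic 0 / 6)).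
  rewrite /c mulr_sumr [in RHS]mulr_sumr -sumrN; apply: eq_bigr => j _.
  by rewrite va; field.
have a0 : a != 0 by apply/eqP => az; move: ab_gt0; rewrite az mul0r ltxx.
rewrite oppr_lt0 mulr_gt0//; first by rewrite mulr_gt0// exprn_even_gt0.
have ge0 j : 0 <= d j * u j ^+ 4 * (- (psi j)^`(3)%classic 0 / 6).
  by rewrite mulr_ge0 ?divr_ge0 ?oppr_ge0// mulr_ge0 ?exprn_ge0// ltW.
rewrite (bigD1 k)//= ltr_pwDl ?sumr_ge0//.
by rewrite mulr_gt0 ?divr_gt0 ?oppr_gt0 ?mulr_gt0 ?exprn_gt0// lt_def eq_sym k0 le0.
Qed.

(** At p1 each summand psi_j(x_j) - x_j is cubic in x_j = v_j y + o(y), so W contributes only o(y^3)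
    and no expansion of W is required. *)
Lemma reduced_cubic (e : R) : 0 < e -> exists2 dl : R, 0 < dl &
  forall y : R, `|y| < dl -> `|g y p1 0 - c * y ^+ 3| <= e * `|y| ^+ 3.
Proof.
move=> e0.
have single j e1 : 0 < e1 -> exists2 dl : R, 0 < dl & forall y : R, `|y| < dl ->
    `|psi j (x_ y p1 0 j) - x_ y p1 0 j - (psi j)^`(3)%classic 0 / 6 * v 0 j ^+ 3 * y ^+ 3| <= e1 * `|y| ^+ 3.
  move=> e10; set k := (psi j)^`(3)%classic 0 / 6; pose V := `|v 0 j| + 1.
  have V0 : 0 < V by rewrite ltr_wpDl.
  have K0 : 0 < 6 * `|k| * V ^+ 2 + 1.
    by rewrite ltr_wpDl// mulr_ge0 ?sqr_ge0// mulr_ge0.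
  (* Makes the error from replacing X by v_j y in the cubic term at most e1 |y|^3 / 2. The other
     half goes to the Taylor remainder, whose tolerance is divided by V^3 because |X| <= V |y|. *)
  pose eta := Num.min 1 (e1 / (6 * `|k| * V ^+ 2 + 1)).
  have eta0 : 0 < eta by rewrite lt_min ltr01 divr_gt0.
  have eta1 : eta <= 1 by rewrite ge_min lexx.
  have eta01 : 0 <= eta <= 1 by rewrite (ltW eta0).
  have etak : 3 * `|k| * eta * V ^+ 2 <= e1 / 2.
    have h : eta * (6 * `|k| * V ^+ 2 + 1) <= e1 by rewrite -ler_pdivlMr// ge_min lexx orbT.
    by lra.
  have t0 : 0 < e1 / (2 * V ^+ 3) by rewrite divr_gt0// mulr_gt0// exprn_gt0.
  have [d1 d10 h1] := sat_taylor3 (@psi_smooth j) (psi_sat j) t0.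
  have [d2 d20 h2] := solution_tangent eta0.
  exists (Num.min (d1 / V) d2) => [|y]; first by rewrite lt_min d20 divr_gt0.
  rewrite lt_min => /andP[y1 y2].
  have Xv : `|x_ y p1 0 j - v 0 j * y| <= eta * `|y|.
    have -> : x_ y p1 0 j - v 0 j * y = W y p1 0 0 j by rewrite !mxE; ring.
    by apply: le_trans (h2 y y2); exact: mx_entry_le_norm.
  have [XV X3] := cube_perturb eta01 Xv; rewrite -/V in XV X3.
  set X := x_ y p1 0 j in Xv XV X3 *.
  have Xd : `|X| < d1 by apply: (le_lt_trans XV); rewrite mulrC -ltr_pdivlMr.
  have T := h1 X Xd; rewrite -/k in T.
  have -> : psi j X - X - k * v 0 j ^+ 3 * y ^+ 3 =
     (psi j X - X - k * X ^+ 3) + k * (X ^+ 3 - v 0 j ^+ 3 * y ^+ 3) by ring.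
  apply: (le_trans (ler_normD _ _)).
  have T2 : `|psi j X - X - k * X ^+ 3| <= e1 / 2 * `|y| ^+ 3.
    apply: (le_trans T); apply: (@le_trans _ _ (e1 / (2 * V ^+ 3) * (V * `|y|) ^+ 3)).
      by rewrite ler_wpM2l ?(ltW t0)// lerXn2r// nnegrE// mulr_ge0// ltW.
    have -> // : e1 / (2 * V ^+ 3) * (V * `|y|) ^+ 3 = e1 / 2 * `|y| ^+ 3.
    by field; rewrite lt0r_neq0.
  have T3 : `|k * (X ^+ 3 - v 0 j ^+ 3 * y ^+ 3)| <= e1 / 2 * `|y| ^+ 3.
    rewrite normrM; apply: (le_trans (ler_wpM2l (normr_ge0 k) X3)).
    have -> : `|k| * (3 * eta * V ^+ 2 * `|y| ^+ 3) = 3 * `|k| * eta * V ^+ 2 * `|y| ^+ 3 by ring.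
    by rewrite ler_wpM2r// exprn_ge0.
  by lra.
pose D := \sum_j d j * u j; have D0 : 0 <= D by apply: sumr_ge0 => j _; rewrite mulr_ge0// ltW.
pose B := `|b| * D + 1; have B0 : 0 < B by rewrite ltr_wpDl// mulr_ge0.
have [d1 d10 h1] := @finite_delta R 'I_n (fun j dl => forall y : R, `|y| < dl ->
    `|psi j (x_ y p1 0 j) - x_ y p1 0 j - (psi j)^`(3)%classic 0 / 6 * v 0 j ^+ 3 * y ^+ 3| <= e / B * `|y| ^+ 3)
  (fun j => single j _ (divr_gt0 e0 B0))
  (fun j k l _ lk H y yl => H y (lt_le_trans yl lk)).
have [d2 d20 h2] := reduced_slice.
exists (Num.min d1 d2) => [|y]; first by rewrite lt_min d10.
rewrite lt_min => /andP[y1 y2]; rewrite h2//; last by rewrite subrr normr0.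
have -> : b * (\sum_j d j * u j * (p1 * mu * psi j (x_ y p1 0 j) - x_ y p1 0 j)) - c * y ^+ 3 =
   b * \sum_j d j * u j * (psi j (x_ y p1 0 j) - x_ y p1 0 j - (psi j)^`(3)%classic 0 / 6 * v 0 j ^+ 3 * y ^+ 3).
  rewrite /c -mulrA -mulrBr mulr_suml -sumrB; congr (_ * _); apply: eq_bigr => j _.
  by rewrite p1mu; ring.
rewrite normrM; apply: (@le_trans _ _ (`|b| * (D * (e / B * `|y| ^+ 3)))).
  rewrite ler_wpM2l// (le_trans (ler_norm_sum _ _ _))// mulr_suml; apply: ler_sum => j _.
  have du : 0 < d j * u j by rewrite mulr_gt0.
  by rewrite normrM (gtr0_norm du) ler_pM2l// h1.
have -> : `|b| * (D * (e / B * `|y| ^+ 3)) = e * `|y| ^+ 3 * ((`|b| * D) / B) by ring.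
by rewrite ler_piMr ?mulr_ge0 ?exprn_ge0 ?(ltW e0)// ler_pdivrMr// mul1r lerDl.
Qed.

Lemma reduced_smooth : smooth_near (fun z : R * R * PT => g z.1.1 z.1.2 z.2) (0, p1, 0).
Proof.
have [U [[oU Uz] CU]] := W_smooth.
have [r /= r0 hr] := (iffLR (nbhs_ballP _ _)) gE.
(* The formula for g is valid only near the base point, so smoothness is proved where it holds and W
   is smooth. *)
pose B : set (R * R * PT) := U `&` ball ((0, p1, 0) : R * R * PT) r.
have oB : open B by apply: openI => //; exact: ball_open.
exists B; split; first by split=> //; split=> //; exact: ballxx.
move=> k; have CW : Ck_on k B Wz by apply: Ck_on_sub (CU k) => z [].
have Ci : Ck_on k B (fun z : R * R * PT => z) by exact: Ck_on_id.
have Cf := Ck_on_fst oB Ci; have Cs := Ck_on_snd oB Ci.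
have Cy := Ck_on_fst oB Cf; have Cp := Ck_on_snd oB Cf.
pose X (z : R * R * PT) j := z.1.1 * v 0 j + Wz z 0 j.
have CX j : Ck_on k B (fun z => X z j).
  apply: (Ck_on_add oB); last exact: Ck_on_coord.
  exact: (Ck_on_mul oB Cy (Ck_on_cst k B (v 0 j))).
have Cpsi j : Ck_on k B (fun z => psi j (X z j)) by apply: Ck_on_comp.
have Ca i j l : Ck_on k B (fun z => slice z.2 i j l).
  have := Ck_on_coord i (mxvec_index j l) oB Cs.
  by apply: Ck_on_eq => // z _; rewrite /slice !mxE.
have CF i : Ck_on k B (fun z => - d i * X z i + z.1.2 * (\sum_j A i j * psi j (X z j))
    + z.1.2 * (\sum_j \sum_l slice z.2 i j l * psi j (X z j) * psi l (X z l))).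
  apply: (Ck_on_add oB); first apply: (Ck_on_add oB).
  - exact: Ck_on_scale.
  - by apply: (Ck_on_mul oB Cp); apply: Ck_on_sum => // j; exact: Ck_on_scale.
  - apply: (Ck_on_mul oB Cp); apply: Ck_on_sum => // j; apply: Ck_on_sum => // l.
    exact: (Ck_on_mul oB (Ck_on_mul oB (Ca i j l) (Cpsi j)) (Cpsi l)).
have C : Ck_on k B (fun z => \sum_i (- d i * X z i + z.1.2 * (\sum_j A i j * psi j (X z j))
    + z.1.2 * (\sum_j \sum_l slice z.2 i j l * psi j (X z j) * psi l (X z l))) * vs 0 i).
  by apply: Ck_on_sum => // i; exact: (Ck_on_mul oB (CF i) (Ck_on_cst k B (vs 0 i))).
have XE z j : (z.1.1 *: v + W z.1.1 z.1.2 z.2) 0 j = X z j by rewrite !mxE.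
apply: (Ck_on_eq oB _ C) => z [_ /hr /= ->]; apply: eq_bigr => i _; congr (_ * _).
rewrite mxE XE; congr (_ + _ * _ + _ * _); first by apply: eq_bigr => j _; rewrite XE.
by apply: eq_bigr => j _; apply: eq_bigr => l _; rewrite !XE.
Qed.

(** [n ^ 3] is convertible to [n * (n * n)], so [vec_mx] turns the parameter row into the tensor.
    Being linear, it preserves smoothness. *)
Lemma reduced_unfolding : unfolding p1 (k := (n ^ 3)%N) (fun y p => g y p 0)
  (fun y p (b : 'rV[R]_(n * (n * n))) => g y p (vec_mx b)).
Proof.
pose RT := 'rV[R]_(n * (n * n)).
split; last by apply: filterE => z; rewrite linear0.
pose l (z : R * R * RT) : R * R * PT := (z.1, vec_mx z.2).
have lin_l : linear l by move=> k x y; congr (_, _); rewrite /= linearP.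
pose lM := GRing.isLinear.Build _ _ _ _ _ lin_l.
pose lL : {linear (R * R * RT)%type -> (R * R * PT)%type} := HB.pack l lM.
have cl : continuous lL.
  move=> z; apply: eps_continuous => e e0; exists e => // h he.
  rewrite linearD addrAC subrr add0r; apply: (le_trans _ (ltW he)).
  rewrite [leLHS]prod_normE [leRHS]prod_normE ge_max.
  apply/andP; split; rewrite le_max; apply/orP; [by left|right].
  by apply: mx_norm_le => // i j; rewrite !mxE; exact: mx_entry_le_norm.
have lz : lL (0, p1, 0) = (0, p1, 0) by rewrite /= /l /= linear0.
have := smooth_near_precomp (l := lL) (z := (0, p1, 0)) cl.
by move=> /(_ R^o (fun z => g z.1.1 z.1.2 z.2)); rewrite lz; apply; exact: reduced_smooth.
Qed.

Lemma reduced_pitchfork : (exists j, (psi j)^`(3)%classic 0 != 0) ->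
  symmetric_pitchfork p1 (fun y p => g y p 0).
Proof.
move=> psi3; split; first exact: reduced_odd.
apply: (pitchfork_recognition _ reduced_odd reduced_derive reduced_derive_continuous
  reduced_derive_gt0 reduced_cubic (reduced_cubic_lt0 psi3)).
pose l (z : R * R) : R * R * PT := (z, 0).
have lin_l : linear l by move=> k x y; congr (_, _); rewrite /= scaler0 addr0.
pose lM := GRing.isLinear.Build _ _ _ _ _ lin_l.
pose lL : {linear (R * R)%type -> (R * R * PT)%type} := HB.pack l lM.
have cl : continuous lL by move=> z; exact: (cvg_pair (@cvg_id _ (nbhs z)) (cvg_cst (0 : PT))).
have := smooth_near_precomp (l := lL) (z := (0, p1)) cl.
by move=> /(_ R^o (fun z => g z.1.1 z.1.2 z.2)); apply; exact: reduced_smooth.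
Qed.
End reduced_function.
End implicit_solution.
End reduction.

Unset Implicit Arguments.

Theorem theorem4 (R : realType) (n : nat) (n_ge2 : (2 <= n)%N)
    (A2 : 'M[R]_n) (A3 : 'M[R]_(n, n * n)) (psi : 'I_n -> R -> R)
    (lam : n.-tuple R)
    (A2_ge0 : forall i j, 0 <= A2 i j)
    (A2_sym : A2^T = A2)
    (A2_irr : irreducible_mx A2)
    (A2_diag : forall i, A2 i i = 0)
    (A3_ge0 : forall i j k, 0 <= slice A3 i j k)
    (A3_sym : forall i, slice A3 i = (slice A3 i)^T)
    (A3_self : forall i j, slice A3 i i j = 0 /\ slice A3 i j i = 0)
    (degree_gt0 : forall i, 0 < degree A2 A3 i)
    (psi_smooth : forall i k (s : R), derivable (psi i)^`(k)%classic s 1)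
    (psi_sat : forall i, saturating (psi i))
    (lamP : ordered_eigenvalues (invmx (degree_mx (degree A2 A3)) *m A2) lam)
    (lam_simple : count_mem lam`_n.-1 lam = 1%N) :
  let p1 := 1 / lam`_n.-1 in
  let F := opinion_field (degree A2 A3) A2 psi in
  stable_pitchfork_bifurcation (fun p x => F x p 0) p1 /\
  forall g : R -> R -> 'M[R]_(n, n * n) -> R,
    lyapunov_schmidt F p1 0 g ->
    [/\ odd_near p1 (fun y p => g y p 0),
        (exists j, (psi j)^`(3)%classic 0 != 0) ->
          symmetric_pitchfork p1 (fun y p => g y p 0)
      & unfolding p1 (k := (n ^ 3)%N) (fun y p => g y p 0)
          (fun y p (b : 'rV[R]_(n * (n * n))) => g y p (vec_mx b))].
Proof.
move=> p1 F; set d := degree A2 A3 in F degree_gt0 lamP *.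
have n_gt0 : (0 < n)%N := ltnW n_ge2.
(* [mu] is constructed without reference to the list [lam]; it is then identified with the last
   entry, which gives p1 = 1 / mu. *)
have [mu [u [u_gt0 u_eig]]] := perron_frobenius A2_ge0 A2_sym A2_irr degree_gt0 n_gt0.
have lamE := largest_eigenvalue n_ge2 A2_ge0 A2_sym degree_gt0 lamP u_gt0 u_eig.
have mu_gt0 := ground_state_eigenvalue_gt0 n_ge2 A2_ge0 A2_irr degree_gt0 u_gt0 u_eig.
have p1E : p1 = 1 / mu by rewrite /p1 lamE.
have p1mu : p1 * mu = 1 by rewrite p1E divfK// lt0r_neq0.
have p1_gt0 : 0 < p1 by rewrite p1E divr_gt0.
split.
  rewrite p1E; apply: (cooperative_pitchfork n_ge2 A2_ge0 A2_sym A2_irr degree_gt0 psi_smooth psi_sat u_gt0 u_eig).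
  by move=> p x i; exact: opinion_field0.
move=> g [v [vs [M [N [W [[v0 vker Lvs vvs] [_ LM] [_ LN] [W_smooth W0 W_solves] gE]]]]]].
have [vL [a [b [ab va vsb]]]] := reduction_kernel A2_ge0 A2_sym A2_irr psi_smooth psi_sat u_gt0 u_eig p1mu vker Lvs vvs.
split.
- exact: (reduced_odd A2_sym psi_smooth psi_sat u_eig LM LN W_smooth W0 W_solves vsb gE).
- exact: (reduced_pitchfork A2_sym degree_gt0 psi_smooth psi_sat u_gt0 u_eig p1mu vL LM LN W_smooth W0
    W_solves n_gt0 p1_gt0 ab va vsb gE).
- exact: (reduced_unfolding psi_smooth W_smooth gE).
Qed.
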